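(* Let $y>0$. For real $a>-1/2$, $$w_yH_a(\cdot,y)=y^a\,\mathcal{D}_-^a w_y .$$ Thus $\mathcal{R}_y^a1=H_a(\cdot,y)$, and for real $s$ with $a+s>-1/2$, $$\mathcal{R}_y^sH_a(\cdot,y)=H_{a+s}(\cdot,y).$$ For $a,s,t\in\mathbb{R}$ satisfying $a>-\tfrac12$, $a+s>-\tfrac12$ and $a+s+t>-\tfrac12$, the successive operations satisfy $$\mathcal{R}_y^t\bigl(\mathcal{R}_y^sH_a(\cdot,y)\bigr)=\mathcal{R}_y^{s+t}H_a(\cdot,y)=H_{a+s+t}(\cdot,y).$$
   Context: $w_y(x)=(2\pi y)^{-1/2}e^{-x^2/(2y)}$ for $y>0$. The power-normalised parabolic-cylinder functions are $H_a(x,y)=y^{a/2}e^{x^2/(4y)}D_a(x/\sqrt y)$, where $$D_a(z)=\sqrt{\pi}\,2^{a/2}e^{-z^2/4}\left[\frac{{}_1F_1(-\frac a2;\frac12;\frac{z^2}{2})}{\Gamma((1-a)/2)}-\frac{\sqrt2\,z}{\Gamma(-a/2)}\,{}_1F_1\left(\tfrac{1-a}{2};\tfrac32;\tfrac{z^2}{2}\right)\right],$$ ${}_1F_1$ is Kummer's confluent hypergeometric function and $1/\Gamma$ is the entire reciprocal Gamma function. $L^2=L^2(\mathbb{R},\mathrm{d}x)$ and $\widehat h(\xi)=\int_{\mathbb{R}}e^{-ix\xi}h(x)\,\mathrm{d}x$ (extended to $L^2$), with inverse $\mathcal{F}^{-1}$. For real $s$, $$\mathcal{D}_-^sh=\mathcal{F}^{-1}\bigl[(-i\xi)^s\widehat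 h(\xi)\bigr],\qquad \mathrm{Dom}(\mathcal{D}_-^s)=\{h\in L^2:(-i\xi)^s\widehat h(\xi)\in L^2\},$$ where $(-i\xi)^s=|\xi|^se^{-i\pi s\,\mathrm{sgn}(\xi)/2}$ for $\xi\ne0$. The Rodrigues operator is $$\mathcal{R}_y^sf=y^sw_y^{-1}\mathcal{D}_-^s(w_yf),\qquad\text{defined for } f \text{ with } w_yf\in\mathrm{Dom}(\mathcal{D}_-^s).$$ The identities include the assertion that the functions to which the operators are applied lie in the relevant domains. *)

(* Defs.v *)
From HB Require Import structures.
From mathcomp Require Export all_boot all_order all_algebra.
From mathcomp Require Export all_classical all_reals all_analysis.
From mathcomp Require Export complex.
Export Order.TTheory GRing.Theory Num.Theory numFieldNormedType.Exports.

Set Implicit Arguments.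
Unset Strict Implicit.
Unset Printing Implicit Defensive.

Local Open Scope classical_set_scope.
Local Open Scope ring_scope.
Local Open Scope complex_scope.

Section SpecialFunctions.
Context {R : realType}.
Implicit Types a b x y z : R.

Definition heat_kernel y x : R :=
  (2 * pi * y) `^ (- 2^-1) * expR (- (x ^+ 2 / (2 * y))).

(* Euler's integral, only meant for [0 < x] *)
Definition gamma x : R :=
  \int[lebesgue_measure]_(t in `]0, +oo[) (t `^ (x - 1) * expR (- t)).

(* The entire function 1/Gamma at a real point, obtained from Euler's integral
   by the functional equation Gamma (x + n) = x (x + 1) ... (x + n - 1) Gamma x,
   with an [n] such that [0 < x + n]. *)
Definition rgamma x : R :=
  let n := `|Num.floor x|%N.+1 in
  (\prod_(i < n) (x + i%:R)) / gamma (x + n%:R).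

Definition rising a n : R := \prod_(i < n) (a + i%:R).

(* Kummer's function 1F1(a; b; z) *)
Definition kummer a b z : R :=
  limn (series (fun n => rising a n / rising b n * (z ^+ n / n`!%:R))).

(* Whittaker's parabolic-cylinder function D_a(z) *)
Definition parabolic_cylinder a z : R :=
  Num.sqrt pi * 2 `^ (a / 2) * expR (- (z ^+ 2 / 4)) *
  (rgamma ((1 - a) / 2) * kummer (- (a / 2)) 2^-1 (z ^+ 2 / 2)
   - Num.sqrt 2 * z * rgamma (- (a / 2))
     * kummer ((1 - a) / 2) (3 / 2) (z ^+ 2 / 2)).

(* H_a(x, y) *)
Definition pcH a x y : R :=
  y `^ (a / 2) * expR (x ^+ 2 / (4 * y)) *
  parabolic_cylinder a (x / Num.sqrt y).

End SpecialFunctions.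

Section Fourier.
Context {R : realType}.
Notation mu := (@lebesgue_measure R).
Implicit Types (f g h : R -> R[i]) (s y : R).

Definition cmeasurable f :=
  measurable_fun setT (fun x => complex.Re (f x)) /\
  measurable_fun setT (fun x => complex.Im (f x)).

Definition sqmod (z : R[i]) : R := complex.Re z ^+ 2 + complex.Im z ^+ 2.

Definition inL1 f :=
  mu.-integrable setT (fun x => (complex.Re (f x))%:E) /\
  mu.-integrable setT (fun x => (complex.Im (f x))%:E).

Definition sqdist f g : \bar R := (\int[mu]_x (sqmod (f x - g x)%R)%:E)%E.

Definition inL2 f := cmeasurable f /\ (sqdist f (fun=> 0%R) < +oo)%E.

Definition cintegral f : R[i] :=
  (\int[mu]_x complex.Re (f x)) +i* (\int[mu]_x complex.Im (f x)).

Definition expi (t : R) : R[i] := cos t +i* sin t.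

(* the Fourier integral, only meant for [inL1 h] *)
Definition fourier_integral h (xi : R) : R[i] :=
  cintegral (fun x => expi (- (x * xi)) * h x).

(* [g] represents the L^2 Fourier transform of [h]: the pair (h, g) is in the
   closure, in L^2 x L^2, of the graph of the Fourier integral on the
   intersection of L^1 and L^2 (extension by continuity). *)
Definition is_fourier h g :=
  [/\ inL2 h, inL2 g &
    exists u : nat -> R -> R[i],
      [/\ forall n, inL1 (u n) /\ inL2 (u n),
          sqdist (u n) h @[n --> \oo] --> 0%E &
          sqdist (fourier_integral (u n)) g @[n --> \oo] --> 0%E]].

(* Elements of L^2 are handled through representatives: [fourier] and
   [inv_fourier] choose one, so their values are meaningful up to a null set. *)
Definition fourier h : R -> R[i] := xget (fun=> 0) [set g | is_fourier h g].

Definition inv_fourier g : R -> R[i] := xget (fun=> 0) [set h | is_fourier h g].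

(* (- i xi)^s for [xi != 0]; the value at [xi = 0] is immaterial *)
Definition symbol s (xi : R) : R[i] :=
  (`|xi| `^ s)%:C * expi (- (pi * s * Num.sg xi / 2)).

Definition symbol_fourier s h (xi : R) : R[i] := symbol s xi * fourier h xi.

Definition fracD_dom s h := inL2 h /\ inL2 (symbol_fourier s h).

Definition fracD s h : R -> R[i] := inv_fourier (symbol_fourier s h).

Definition weighted y f (x : R) : R[i] := (heat_kernel y x)%:C * f x.

Definition rodrigues_dom y s f := fracD_dom s (weighted y f).

Definition rodrigues y s f (x : R) : R[i] :=
  (y `^ s)%:C * (heat_kernel y x)^-1%:C * fracD s (weighted y f) x.

Definition aeq f g := {ae mu, forall x, f x = g x}.

Definition cpcH a y (x : R) : R[i] := (pcH a x y)%:C.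

End Fourier.

(* Main.v *)
(** Write h_a for y^(-a) w_y H_a.  Integrating the power series of cos and sin
    term by term against t^a exp(- y t^2/2), Kummer's transformation and the
    reflection formula of the Gamma function show that h_a is the inverse Fourier
    integral of g_a(xi) = (- i xi)^a exp(- y xi^2/2), and g_a is square integrable
    for a > -1/2.  Multiplying h_a by exp(- eps x^2/2) convolves g_a with a
    Gaussian: this gives the Plancherel inequality, hence h_a is in L^2, and by
    Fatou's lemma g_a is the L^2 Fourier transform of h_a.  As (- i xi)^s g_a is
    g_(a+s) off 0, the identities follow from the uniqueness of L^2 Fourier
    transforms and of inverse transforms, for which it is enough to pair with
    Gaussians times cos(b xi) and sin(b xi).

    Fourier transforms of real functions are read off the Hartley transform, the
    real integral transform with kernel cos + sin. *)

(* The bound a > -1/2 is exactly square integrability of |xi|^a at 0. For -1/2 < a < 0 the function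
   h_a decays only like |x|^(-a-1) at -oo and is not integrable, so its transform is not given by
   the Fourier integral. The Gaussian factor exp(- eps x^2/2) supplies approximants in L^1 and L^2
   whose transforms are heat averages of g_a. For these averages a bound on the norm and convergence
   at every point other than 0 are available, and the two together force convergence in L^2. As
   [fourier] and [inv_fourier] select representatives, [fracD] cannot be evaluated directly: each
   value is pinned down up to a null set by uniqueness, and for iterates the argument itself must be
   allowed to differ from h_a on a null set. The functions h_a are real, which is why one real
   transform with a symmetric kernel, its own inverse up to the factor 2 pi, can replace the complex
   one. *)
Require Import Defs.
From mathcomp Require Import measurable_realfun ring lra.

Set Implicit Arguments.
Unset Strict Implicit.
Unset Printing Implicit Defensive.

Local Open Scope classical_set_scope.
Local Open Scope ring_scope.

(** * Integration of real functions *)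

Section RealValuedIntegrals.
Context d (T : measurableType d) (R : realType).
Context (mu : {measure set T -> \bar R}).
Implicit Types (D : set T) (f g h : T -> R).

Lemma L1_measurable D f : mu.-integrable D (EFin \o f) -> measurable_fun D f.
Proof. by move=> /measurable_int/measurable_EFinP. Qed.

Lemma L1_le D f g : measurable D -> measurable_fun D f ->
  (forall x, D x -> `|f x| <= g x) ->
  mu.-integrable D (EFin \o g) -> mu.-integrable D (EFin \o f).
Proof.
move=> mD mf fg ig; apply: le_integrable ig => //; first exact/measurable_EFinP.
by move=> x Dx /=; rewrite lee_fin (le_trans (fg x Dx))// ler_norm.
Qed.

Lemma L1_Zl D f k : measurable D -> mu.-integrable D (EFin \o f) ->
  mu.-integrable D (EFin \o (fun x => k * f x)).
Proof.
by move=> mD If; apply: eq_integrable (integrableZl mD k If) => // x _ /=; rewrite EFinM.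
Qed.

Lemma L1_mulM D f h M : measurable D -> mu.-integrable D (EFin \o f) ->
  measurable_fun D h -> (forall x, D x -> `|h x| <= M) ->
  mu.-integrable D (EFin \o (fun x => h x * f x)).
Proof.
move=> mD If mh hM.
have mf := L1_measurable If.
have IM : mu.-integrable D (EFin \o (fun x => M * `|f x|)).
  by apply: L1_Zl => //; exact: integrable_norm.
apply: L1_le IM => //; first exact: measurable_funM.
by move=> x Dx; rewrite normrM ler_wpM2r// hM.
Qed.

Lemma L1_D D f g : measurable D -> mu.-integrable D (EFin \o f) ->
  mu.-integrable D (EFin \o g) ->
  mu.-integrable D (EFin \o (fun x => f x + g x)).
Proof.
by move=> mD If Ig; apply: eq_integrable (integrableD mD If Ig) => // x _ /=; rewrite EFinD.
Qed.

Lemma L1_B D f g : measurable D -> mu.-integrable D (EFin \o f) ->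
  mu.-integrable D (EFin \o g) ->
  mu.-integrable D (EFin \o (fun x => f x - g x)).
Proof.
by move=> mD If Ig; apply: eq_integrable (integrableB mD If Ig) => // x _ /=; rewrite EFinB.
Qed.

Lemma Rintegral_dominated D (f_ : nat -> T -> R) f g : measurable D ->
  (forall n, measurable_fun D (f_ n)) -> mu.-integrable D (EFin \o g) ->
  (forall n x, D x -> `|f_ n x| <= g x) ->
  (forall x, D x -> f_ n x @[n --> \oo] --> f x) ->
  mu.-integrable D (EFin \o f) /\
  (\int[mu]_(x in D) f_ n x) @[n --> \oo] --> \int[mu]_(x in D) f x.
Proof.
move=> mD mf ig fg ff.
have mF : measurable_fun D f by exact: measurable_fun_cvg mf ff.
have [] := @dominated_convergence _ T R mu D mD (fun n => EFin \o f_ n)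
   (EFin \o f) (EFin \o g).
- by move=> n; exact/measurable_EFinP.
- exact/measurable_EFinP.
- by apply: aeW => x Dx /=; apply: cvg_EFin; [exact: nearW|exact: ff].
- exact: ig.
- by apply: aeW => x Dx n /=; rewrite lee_fin fg.
move=> If _ cv; split => //.
by apply: fine_cvg; rewrite fineK //; exact: integrable_fin_num.
Qed.

End RealValuedIntegrals.

(** * Fubini's theorem under an explicit majorant *)

Section Fubini.
Context d1 d2 (T1 : measurableType d1) (T2 : measurableType d2) (R : realType).
Context (m1 : {sigma_finite_measure set T1 -> \bar R})
  (m2 : {sigma_finite_measure set T2 -> \bar R}).

(** The product majorant yields more than Tonelli's theorem: every section, not just almost every
    one, is integrable, so that the inner integrals are genuine real numbers at every point. *)
Lemma L1_prod (F : T1 * T2 -> R) (f : T1 -> R) (g : T2 -> R) : measurable_fun setT F ->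
  m1.-integrable setT (EFin \o f) -> m2.-integrable setT (EFin \o g) ->
  (forall x y, `|F (x, y)| <= f x * g y) ->
  [/\ forall x, m2.-integrable setT (EFin \o (fun y => F (x, y))),
      (m1 \x m2)%E.-integrable setT (EFin \o F) &
      m1.-integrable setT (EFin \o (fun x => \int[m2]_y F (x, y)))].
Proof.
move=> mF If Ig Ffg.
have mFx x : measurable_fun setT (fun y => F (x, y)).
  by apply: measurableT_comp.
have Ix x : m2.-integrable setT (EFin \o (fun y => F (x, y))).
  by apply: L1_le (L1_Zl (f x) _ Ig) => // y _; exact: Ffg.
have IF : (m1 \x m2)%E.-integrable setT (EFin \o F).
  apply/integrable12ltyP; first exact/measurable_EFinP.
  apply: (@le_lt_trans _ _ (\int[m1]_x (`|f x|%:E * \int[m2]_y `|g y|%:E))%E).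
    apply: ge0_le_integral => //=.
    - by move=> x _; exact: integral_ge0.
    - apply: (@measurable_fun_fubini_tonelli_F _ _ _ _ _ m2 (fun z => `|F z|%:E)) => //.
      by apply/measurable_EFinP; exact: measurableT_comp.
    - apply: emeasurable_funM => //.
      apply/measurable_EFinP; apply: measurableT_comp => //.
      exact: L1_measurable If.
    - move=> x _; rewrite -ge0_integralZl//; last first.
        apply/measurable_EFinP; apply: measurableT_comp => //.
        exact: L1_measurable Ig.
      apply: ge0_le_integral => //=.
      + by apply/measurable_EFinP; exact: measurableT_comp.
      + apply/measurable_EFinP; apply: measurable_funM => //; apply: measurableT_comp => //.
        exact: L1_measurable Ig.
      + by move=> y _; rewrite lee_fin (le_trans (Ffg x y))// -normrM ler_norm.
  have /integrableP[mf fy] := If; have /integrableP[mg gy] := Ig.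
  rewrite ge0_integralZr//.
  - apply: lte_mul_pinfty => //; first exact: integral_ge0.
    by rewrite ge0_fin_numE//; exact: integral_ge0.
  - by apply/measurable_EFinP; apply: measurableT_comp => //; exact/measurable_EFinP.
  - exact: integral_ge0.
split => //.
apply: eq_integrable (integrable_fubini_F IF) => // x _ /=.
by rewrite /fubini_F fineK//; exact: (integrable_fin_num _ (Ix x)).
Qed.

End Fubini.

Lemma Rintegral_Fubini d1 d2 (T1 : measurableType d1) (T2 : measurableType d2)
    (R : realType) (m1 : {sigma_finite_measure set T1 -> \bar R})
    (m2 : {sigma_finite_measure set T2 -> \bar R})
    (F : T1 * T2 -> R) (f : T1 -> R) (g : T2 -> R) :
  measurable_fun setT F ->
  m1.-integrable setT (EFin \o f) -> m2.-integrable setT (EFin \o g) ->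
  (forall x y, `|F (x, y)| <= f x * g y) ->
  [/\ m1.-integrable setT (EFin \o (fun x => \int[m2]_y F (x, y))),
      m2.-integrable setT (EFin \o (fun y => \int[m1]_x F (x, y))) &
      \int[m1]_x \int[m2]_y F (x, y) = \int[m2]_y \int[m1]_x F (x, y)].
Proof.
move=> mF If Ig Ffg.
have [Ix IF IFx] := L1_prod mF If Ig Ffg.
have mFs : measurable_fun setT (fun z : T2 * T1 => F (z.2, z.1)).
  by apply: measurableT_comp mF _; exact: measurable_fun_pair.
have [|Iy _ IFy] := L1_prod mFs Ig If.
  by move=> x y /=; rewrite mulrC; exact: Ffg.
split => //; congr fine.
transitivity (\int[m1]_x \int[m2]_y (F (x, y))%:E)%E.
  by apply: eq_integral => x _; rewrite fineK//; exact: (integrable_fin_num _ (Ix x)).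
rewrite (Fubini IF); apply: eq_integral => y _.
by rewrite fineK//; exact: (integrable_fin_num _ (Iy y)).
Qed.

(** * Folding integrals over the line onto the half-line *)

Section RealLine.
Context {R : realType}.
Notation mu := (@lebesgue_measure R).
Implicit Types f : R -> R.

Lemma ge0_integral_oppr (f : R -> \bar R) (D : set R) : measurable D ->
  measurable_fun D f -> (forall r, D r -> 0 <= f r)%E ->
  (\int[mu]_(x in -%R @^-1` D) f (- x)%R = \int[mu]_(x in D) f x)%E.
Proof.
move=> mD mf f0.
rewrite -(@ge0_integral_pushforward _ _ _ _ R (-%R : measurableTypeR R -> measurableTypeR R) _ mu)//.
  by apply: eq_measure_integral => //= A mA AS; exact/lebesgue_measureN.
by move=> x /set_mem; exact: f0.
Qed.

Lemma ge0_integral_fold (f : R -> \bar R) : measurable_fun setT f ->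
  (forall r, 0 <= f r)%E ->
  (\int[mu]_x f x = \int[mu]_(x in `]0%R, +oo[) (f x + f (- x)%R))%E.
Proof.
move=> mf f0.
have mfN : measurable_fun setT (fun x : R => f (- x)) by exact: measurableT_comp.
rewrite ge0_integralD//; try exact: measurable_funTS.
rewrite -(@ge0_integral_oppr (fun x : R => f (- x)) `]0, +oo[)//; last exact: measurable_funTS.
under [X in (_ = _ + X)%E]eq_integral do rewrite opprK.
rewrite opp_preimage_itvbndy oppr0.
(* Adding the null point 0 to one of the two open half-lines makes them a partition of the line. *)
rewrite integral_itv_obnd_cbnd; last exact: measurable_funTS.
rewrite -ge0_integral_setU//; last 2 first.
- exact: measurable_funTS.
- rewrite disj_set2E; apply/eqP/seteqP; split => // x [] /=.
  by rewrite !in_itv/= andbT => x0; rewrite ltNge x0.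
congr integral; apply/seteqP; split => // x _ /=.
by rewrite !in_itv/= andbT; case: (lerP 0 x); [left|right].
Qed.

Lemma L1_fold f : measurable_fun setT f ->
  mu.-integrable `]0, +oo[ (EFin \o f) ->
  mu.-integrable `]0, +oo[ (EFin \o (fun x : R => f (- x))) ->
  mu.-integrable setT (EFin \o f) /\
  \int[mu]_x f x = \int[mu]_(x in `]0, +oo[) (f x + f (- x)).
Proof.
move=> mf If IfN.
have mfN : measurable_fun setT (fun x : R => f (- x)) by exact: measurableT_comp.
have IT : mu.-integrable setT (EFin \o f).
  apply/integrableP; split; first exact/measurable_EFinP.
  rewrite ge0_integral_fold//; last first.
    by apply: measurableT_comp => //; exact/measurable_EFinP.
  rewrite ge0_integralD//; last 2 first.
    by apply: measurable_funTS; apply: measurableT_comp => //; exact/measurable_EFinP.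
    by apply: measurable_funTS; apply: measurableT_comp => //; exact/measurable_EFinP.
  by apply: lte_add_pinfty; [case/integrableP: If|case/integrableP: IfN].
split => //.
(* Folding is known for nonnegative functions only; it is applied to the positive and negative parts
   of [f], both bounded by |f|. *)
have posfold (g : R -> R) : measurable_fun setT g -> (forall x, 0 <= g x <= `|f x|) ->
  [/\ mu.-integrable setT (EFin \o g),
   mu.-integrable `]0, +oo[ (EFin \o (fun x => g x + g (- x))) &
   \int[mu]_x g x = \int[mu]_(x in `]0, +oo[) (g x + g (- x))].
  move=> mg gf.
  have gn x : `|g x| <= `|f x| by rewrite ger0_norm; case/andP: (gf x).
  split.
  - by apply: L1_le (integrable_norm IT) => // x _ /=; exact: gn.
  - apply: L1_D => //.
      by apply: L1_le (integrable_norm If) => //; exact: measurable_funTS.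
    apply: L1_le (integrable_norm IfN) => //.
      by apply: measurable_funTS; exact: measurableT_comp.
  - rewrite /Rintegral (@ge0_integral_fold (fun x => (g x)%:E))//.
      exact/measurable_EFinP.
    by move=> x; rewrite lee_fin; case/andP: (gf x).
have [|x|Ip Ip2 Ep] := posfold (fun x => Num.max (f x) 0).
- exact: measurable_maxr.
- by rewrite le_max lexx orbT ge_max ler_norm normr_ge0.
have [|x|In In2 En] := posfold (fun x => Num.max (- f x) 0).
- by apply: measurable_maxr => //; exact: measurableT_comp.
- by rewrite le_max lexx orbT ge_max -normrN ler_norm normr_ge0.
have maxE (r : R) : r = Num.max r 0 - Num.max (- r) 0.
  by rewrite /Num.max; case: ifP; case: ifP; lra.
transitivity (\int[mu]_x (Num.max (f x) 0 - Num.max (- f x) 0)).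
  by apply: eq_Rintegral => x _.
rewrite RintegralB// Ep En -RintegralB//.
by apply: eq_Rintegral => x _; rewrite [in RHS](maxE (f x)) [in RHS](maxE (f (- x))); lra.
Qed.

End RealLine.

(** * The Gamma function *)

Section CalculusTools.
Context {R : realType}.
Notation mu := (@lebesgue_measure R).
Implicit Types a b x : R.

Lemma is_derive_continuous (f : R -> R) x (df : R) : is_derive x 1 f df ->
  {for x, continuous f}.
Proof. by case=> dfx _; exact/differentiable_continuous/derivable1_diffP. Qed.

Lemma continuous_within_itvcc (f : R -> R) a b :
  (forall x, a <= x <= b -> {for x, continuous f}) ->
  {within `[a, b], continuous f}.
Proof.
move=> cf; apply: continuous_in_subspaceT => x /set_mem/=.
by rewrite in_itv/= => xab; exact: cf.
Qed.

Lemma derivable_oo_LRcontinuousW (F f : R -> R) a b : a < b ->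
  (forall x, a <= x <= b -> is_derive x 1 F (f x)) ->
  derivable_oo_LRcontinuous F a b.
Proof.
move=> ab dF; split.
- by move=> x /[!in_itv]/= /andP[/ltW ax /ltW xb]; have [] := dF x; rewrite ?ax.
- apply: cvg_at_right_filter; apply: is_derive_continuous.
  by apply: dF; rewrite lexx ltW.
- apply: cvg_at_left_filter; apply: is_derive_continuous.
  by apply: dF; rewrite lexx ltW.
Qed.

Lemma integral_is_derive (F f : R -> R) a b : a < b ->
  (forall x, a <= x <= b -> is_derive x 1 F (f x)) ->
  (forall x, a <= x <= b -> {for x, continuous f}) ->
  (\int[mu]_(x in `[a, b]) (f x)%:E = (F b - F a)%:E)%E.
Proof.
move=> ab dF cf; rewrite (@continuous_FTC2 _ f F)//.
- exact: continuous_within_itvcc.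
- exact: derivable_oo_LRcontinuousW dF.
- move=> x /[!in_itv]/= /andP[/ltW ax /ltW xb].
  by rewrite derive1E; have [|_ ->] := dF x; rewrite ?ax.
Qed.

Lemma L1_continuous_itv (f : R -> R) a b :
  (forall x, a <= x <= b -> {for x, continuous f}) ->
  mu.-integrable `[a, b] (EFin \o f).
Proof.
move=> cf; apply: continuous_compact_integrable; first exact: segment_compact.
exact: continuous_within_itvcc.
Qed.

(** Monotone convergence along compact intervals, on which the fundamental theorem and changes of
    variables apply. The end points are arbitrary monotone sequences because the substitution in
    [gaussian_moment] moves them. *)
Lemma cvg_integral_itv0y (f : R -> \bar R) (a b : R^nat) :
  (forall n, 0 < a n) -> nonincreasing_seq a -> a n @[n --> \oo] --> (0 : R) ->
  nondecreasing_seq b -> b n @[n --> \oo] --> +oo ->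
  measurable_fun (`]0%R, +oo[ : set R) f -> (forall x : R, (0 < x)%R -> 0 <= f x)%E ->
  (\int[mu]_(x in `[a n, b n]) f x)%E @[n --> \oo] -->
  (\int[mu]_(x in `]0%R, +oo[) f x)%E.
Proof.
move=> a_gt0 a_ni a0 b_nd b_oo mf f0.
have sub n : `[a n, b n] `<=` `]0%R, +oo[.
  by move=> x /=; rewrite !in_itv/= andbT => /andP[/(lt_le_trans (a_gt0 n))].
rewrite (_ : `]0%R, +oo[%classic = \bigcup_n `[a n, b n]%classic); last first.
  apply/seteqP; split => [x|x [n _]]; last exact: sub.
  rewrite /= in_itv/= andbT => x0.
  have [N _ aN] : \forall n \near \oo, a n < x.
    by have /cvgr_lt := a0; apply.
  have [M _ bM] : \forall n \near \oo, x <= b n.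
    by have /cvgryPge := b_oo; apply.
  exists (maxn N M) => //=; rewrite in_itv/= bM ?andbT//=; last exact: leq_maxr.
  by apply/ltW/aN => /=; exact: leq_maxl.
apply: ge0_nondecreasing_set_cvg_integral.
- move=> m n mn; apply/subsetPset => x /=; rewrite !in_itv/= => /andP[ax xb].
  by rewrite (le_trans (a_ni _ _ mn) ax) (le_trans xb (b_nd _ _ mn)).
- by move=> n; exact: measurable_itv.
- by move=> n; apply: measurable_funS mf => //; exact: sub.
- by move=> n x /sub/=; rewrite in_itv/= andbT => /f0.
Qed.

End CalculusTools.

(** * Functional equation of Euler's integral *)

Section Gamma.
Context {R : realType}.
Notation mu := (@lebesgue_measure R).
Implicit Types x y b : R.

(** With values in [0, +oo] the functional equation makes sense before finiteness is known, and
    finiteness is then deduced from it. *)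
Definition egamma x : \bar R :=
  (\int[mu]_(t in `]0%R, +oo[) (t `^ (x - 1) * expR (- t))%:E)%E.

Lemma measurable_powR_expR x (g : R -> R) D : measurable_fun setT g ->
  measurable_fun D (fun t : R => t `^ x * expR (g t)).
Proof.
move=> mg; apply: measurable_funTS; apply: measurable_funM.
  exact: measurable_powR.
exact: measurableT_comp.
Qed.

Lemma cvg_invS_0 : (n.+1%:R^-1 : R) @[n --> \oo] --> (0 : R).
Proof. exact: cvg_harmonic. Qed.

Lemma cvg_natS_oo : (n.+1%:R : R) @[n --> \oo] --> +oo.
Proof.
apply/cvgryPge => M; exists (Num.bound `|M|) => // n /= Mn.
have M1 : M <= (Num.bound `|M|)%:R.
  by rewrite (le_trans (ler_norm _))// ltW// archi_boundP.
by rewrite (le_trans M1)// ler_nat leqW.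
Qed.

Lemma cvg_egamma x : (\int[mu]_(t in `[n.+1%:R^-1%R, n.+1%:R%R])
    (t `^ (x - 1) * expR (- t))%:E)%E @[n --> \oo] --> egamma x.
Proof.
apply: cvg_integral_itv0y.
- by move=> n; rewrite invr_gt0.
- by move=> m n mn; rewrite lef_pV2 ?posrE// ler_nat.
- exact: cvg_invS_0.
- by move=> m n mn; rewrite ler_nat.
- exact: cvg_natS_oo.
- apply/measurable_EFinP; apply: measurable_powR_expR.
  exact: measurable_funN.
- by move=> t t0; rewrite lee_fin mulr_ge0// ?powR_ge0 ?expR_ge0.
Qed.

Lemma continuous_powR_expRN x (t : R) : 0 < t ->
  {for t, continuous (fun t => t `^ x * expR (- t))}.
Proof.
move=> t0; apply: (@is_derive_continuous _ _ _ (x * t `^ (x - 1) * expR (- t) - t `^ x * expR (- t))).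
have := @is_derive1_powR _ x _ t0 => ?.
by apply: is_derive_eq; rewrite /GRing.scale/=; ring.
Qed.

Lemma cvg_powR_expRN x : ((n.+1%:R : R) `^ x * expR (- n.+1%:R)) @[n --> \oo] --> (0 : R).
Proof.
(* A natural exponent k >= x: the term of degree k+1 of the exponential series gives N^(k+1) <=
   (k+1)! e^N, hence the majorant (k+1)!/N. *)
pose k := `|Num.ceil x|%N.
have xk : x <= k%:R.
  by rewrite (le_trans (ceil_ge x))// /k natr_absz ler_int ler_norm.
apply: (@squeeze_cvgr _ _ _ _ (cst 0) (fun n => (k.+1)`!%:R * n.+1%:R^-1)).
- near=> n; rewrite mulr_ge0 ?powR_ge0 ?expR_ge0//= expRN ler_pdivrMr ?expR_gt0//.
  have n1 : 1 <= n.+1%:R :> R by rewrite ler1n.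
  have n0 : 0 <= n.+1%:R :> R by rewrite ler0n.
  have := expR_ge1Dxn k n0; set e := expR _ => he.
  rewrite (le_trans (ler_powR n1 xk))// powR_mulrn//.
  rewrite mulrAC ler_pdivlMr ?ltr0n// -exprSr.
  rewrite -ler_pdivrMl ?ltr0n ?fact_gt0// mulrC.
  by rewrite (le_trans _ he)// lerDr.
- exact: cvg_cst.
- by rewrite -[X in _ --> X](mulr0 (k.+1)`!%:R); apply: cvgMr; exact: cvg_invS_0.
Unshelve. all: by end_near. Qed.

Lemma cvg_powR_invS x : 0 < x ->
  ((n.+1%:R^-1 : R) `^ x * expR (- n.+1%:R^-1)) @[n --> \oo] --> (0 : R).
Proof.
move=> x0.
have h : ((n.+1%:R^-1 : R) `^ x) @[n --> \oo] --> (0 : R).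
  have /cvg_at_rightP := powR_cvg0 x0; apply; split; last exact: cvg_invS_0.
  by move=> n; rewrite invr_gt0.
apply: (@squeeze_cvgr _ _ _ _ (cst 0) (fun n => (n.+1%:R^-1 : R) `^ x)) => //.
- near=> n; rewrite mulr_ge0 ?powR_ge0 ?expR_ge0//= ler_piMr ?powR_ge0//.
- exact: cvg_cst.
Unshelve. all: by end_near. Qed.

Lemma egamma_ge0 x : (0 <= egamma x)%E.
Proof.
by apply: integral_ge0 => t _; rewrite lee_fin mulr_ge0 ?powR_ge0 ?expR_ge0.
Qed.

(** Integration by parts on [1/(n+1), n+1]; the boundary terms t^x e^(-t) vanish in the limit, at
    the lower end because x > 0. *)
Lemma egammaS x : 0 < x -> egamma (x + 1) = (x%:E * egamma x)%E.
Proof.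
move=> x0.
pose g (s t : R) := t `^ (s - 1) * expR (- t).
pose I s (n : nat) := \int[mu]_(t in `[n.+1%:R^-1, n.+1%:R]) g s t.
have pos n (t : R) : n.+1%:R^-1 <= t <= n.+1%:R -> 0 < t.
  by case/andP => + _; apply: lt_le_trans; rewrite invr_gt0.
have Ig s n : mu.-integrable `[n.+1%:R^-1, n.+1%:R] (EFin \o g s).
  by apply: L1_continuous_itv => t /pos; exact: continuous_powR_expRN.
have IE s n : (\int[mu]_(t in `[n.+1%:R^-1%R, n.+1%:R%R]) (g s t)%:E)%E = (I s n)%:E.
  by rewrite /I /Rintegral fineK//; exact: (integrable_fin_num _ (Ig s n)).
pose F (t : R) := t `^ x * expR (- t).
(* For n = 0 the interval [1, 1] is degenerate, while the fundamental theorem is applied with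
   distinct end points. *)
have step n : (0 < n)%N -> I (x + 1) n = x * I x n - (F n.+1%:R - F n.+1%:R^-1).
  move=> n0.
  have nn : n.+1%:R^-1 < n.+1%:R :> R.
    by rewrite (@lt_trans _ _ 1)// ?invf_lt1 ?ltr1n ?ltr0n.
  have := @integral_is_derive _ F (fun t => x * g x t - g (x + 1) t) _ _ nn.
  have -> : (\int[mu]_(t in `[n.+1%:R^-1%R, n.+1%:R%R]) (x * g x t - g (x + 1) t)%:E)%E
     = (x * I x n - I (x + 1) n)%:E.
    have Ix : mu.-integrable `[n.+1%:R^-1, n.+1%:R] (EFin \o (fun t => x * g x t)).
      exact: L1_Zl.
    rewrite -[LHS]fineK; last first.
      by apply: integrable_fin_num => //; exact: L1_B.
    congr EFin; transitivity (\int[mu]_(t in `[n.+1%:R^-1, n.+1%:R]) (x * g x t - g (x + 1) t)) => //.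
    by rewrite RintegralB// RintegralZl.
  move=> h; suff [e] : (x * I x n - I (x + 1) n)%:E =
    (F n.+1%:R - F n.+1%:R^-1)%:E by move: e; lra.
  apply: h => t /pos t0.
  - have := @is_derive1_powR _ x _ t0 => ?.
    by apply: is_derive_eq; rewrite /g /GRing.scale/= addrK; ring.
  - apply: cvgB; last exact: continuous_powR_expRN.
    by apply: cvgMr; exact: continuous_powR_expRN.
have c1 : (x%:E * (I x n)%:E)%E @[n --> \oo] --> (x%:E * egamma x)%E.
  apply: cvgeZl => //; have := @cvg_egamma x.
  by under eq_fun do rewrite -/(g x _) IE.
have c2 : ((I (x + 1) n)%:E)%E @[n --> \oo] --> egamma (x + 1).
  have := @cvg_egamma (x + 1).
  by under eq_fun do rewrite -/(g (x + 1) _) IE.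
have c3 : ((F n.+1%:R - F n.+1%:R^-1)%:E)%E @[n --> \oo] --> 0%E.
  apply: cvg_EFin; first exact: nearW.
  rewrite -[X in _ --> X](subr0 (0 : R)); apply: cvgB.
    exact: cvg_powR_expRN.
  exact: cvg_powR_invS.
have c4 : (x%:E * (I x n)%:E)%E @[n --> \oo] --> egamma (x + 1).
  rewrite -[X in _ --> X]adde0.
  apply: cvg_trans (cvgeD _ c2 c3); last by rewrite fin_num_adde_defl.
  apply: near_eq_cvg; near=> n.
  by rewrite -EFinD -EFinM step; [congr EFin; lra|near: n; exists 1%N].
by apply: cvg_unique c4 c1.
Unshelve. all: by end_near. Qed.

End Gamma.

(** * Finiteness, convexity and Gaussian moments *)

Section GammaFunction.
Context {R : realType}.
Notation mu := (@lebesgue_measure R).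
Implicit Types x y b c s t : R.

Lemma egamma1 : egamma 1 = 1%:E :> \bar R.
Proof.
rewrite /egamma; under eq_integral do rewrite subrr powRr0 mul1r.
rewrite integral_itv_obnd_cbnd; last first.
  apply/measurable_EFinP; apply: measurable_funTS; apply: measurableT_comp => //.
rewrite (@ge0_continuous_FTC2y _ (fun t => expR (- t)) (fun t => - expR (- t)) 0 0).
- by rewrite oppr0 expR0 -EFinB opprK add0r.
- by move=> *; exact: expR_ge0.
- apply: continuous_subspaceT => t; apply: (@is_derive_continuous _ _ _ (- expR (- t))).
  by apply: is_derive_eq; rewrite /GRing.scale/=; ring.
- by rewrite -oppr0; apply: cvgN; exact: cvgr_expR.
- by move=> *; exact: derivableN.
- apply: cvg_at_right_filter.
  apply: (@is_derive_continuous _ (fun t => - expR (- t)) 0 (expR (- 0))).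
  by apply: is_derive_eq; rewrite /GRing.scale/=; ring.
- move=> t _; rewrite derive1E; have d : is_derive t 1 (fun t => - expR (- t)) (expR (- t)).
    by apply: is_derive_eq; rewrite /GRing.scale/=; ring.
  by have [_ ->] := d.
Qed.

Lemma measurable_gammaI x D : measurable_fun D (fun t : R => (t `^ (x - 1) * expR (- t))%:E).
Proof. by apply/measurable_EFinP; exact: measurable_powR_expR. Qed.

(** Finiteness holds at positive integers by the functional equation. Since t^x <= 1 + t^n for n >=
    x, it follows at x+1, and then at x, because x times an infinite value would be infinite. *)
Lemma egamma_lty x : 0 < x -> (egamma x < +oo)%E.
Proof.
move=> x0.
have natlty n : (egamma (n.+1%:R : R) < +oo)%E.
  elim: n => [|n ih]; first by rewrite egamma1 ltry.
  by rewrite -natr1 egammaS// lte_mul_pinfty// lee_fin.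
have h : (egamma (x + 1) < +oo)%E.
  pose n := `|Num.ceil x|%N.
  have xn : x <= n%:R by rewrite (le_trans (ceil_ge x))// /n natr_absz ler_int ler_norm.
  apply: (@le_lt_trans _ _ (egamma 1 + egamma n.+1%:R)%E); last first.
    by rewrite lte_add_pinfty// egamma1 ltry.
  rewrite /egamma -ge0_integralD//; last 4 first.
  - by move=> t _; rewrite lee_fin mulr_ge0 ?powR_ge0 ?expR_ge0.
  - exact: measurable_gammaI.
  - by move=> t _; rewrite lee_fin mulr_ge0 ?powR_ge0 ?expR_ge0.
  - exact: measurable_gammaI.
  apply: ge0_le_integral => //.
  - by move=> t _; rewrite lee_fin mulr_ge0 ?powR_ge0 ?expR_ge0.
  - exact: measurable_gammaI.
  - by apply: emeasurable_funD; exact: measurable_gammaI.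
  move=> t /=; rewrite in_itv/= andbT => t0.
  rewrite -EFinD lee_fin -mulrDl ler_wpM2r ?expR_ge0//.
  rewrite subrr powRr0 addrK -natr1 addrK.
  have [t1|t1] := leP t 1.
    rewrite (@le_trans _ _ 1)// ?lerDl ?powR_ge0//.
    by rewrite -(powRr0 t) ger_powR ?t0// ltW.
  by rewrite (le_trans (ler_powR (ltW t1) xn))// lerDr.
move: h; rewrite egammaS//; have := egamma_ge0 x.
by case: (egamma x) => [r| |]//= _; rewrite ?ltry// mulry gtr0_sg ?mul1e.
Qed.

Lemma gammaE x : 0 < x -> (gamma x)%:E = egamma x.
Proof. by move=> x0; rewrite fineK// ge0_fin_numE ?egamma_lty// egamma_ge0. Qed.

Lemma gammaS x : 0 < x -> gamma (x + 1) = x * gamma x.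
Proof.
by move=> x0; apply: EFin_inj; rewrite EFinM !gammaE ?egammaS// addr_gt0.
Qed.

Lemma gamma1 : gamma 1 = 1 :> R.
Proof. by apply: EFin_inj; rewrite gammaE// egamma1. Qed.

(** Weighted inequality of arithmetic and geometric means: with w = ln t, add e^u >= 1 + u at u =
    (1-s)w and at u = -sw with weights s and 1-s, then multiply by e^(sw). *)
Lemma powR_le_affine s t : 0 <= s <= 1 -> 0 < t -> t `^ s <= 1 - s + s * t.
Proof.
move=> /andP[s0 s1] t0; rewrite -[t]lnK// -expRM mulrC; set w := ln t.
have h1 := expR_ge1Dx (w - s * w); have h2 := expR_ge1Dx (- (s * w)).
have e0 := expR_ge0 (s * w).
have -> : expR w = expR (s * w) * expR (w - s * w) by rewrite -expRD addrC subrK.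
have e1 : 1 = expR (s * w) * expR (- (s * w)) by rewrite -expRD subrr expR0.
rewrite [X in _ <= X - s + _]e1.
have := ler_wpM2l e0 h1; have := ler_wpM2l e0 h2.
rewrite -e1; set e := expR (s * w); set E := e * expR _.
nra.
Qed.

Lemma gamma_ge0 x : 0 <= gamma x.
Proof. by apply: fine_ge0; exact: egamma_ge0. Qed.

(** Wendel's inequality. Integrate t^s <= x^s (1 - s + s t/x) against t^(x-1) e^(-t); as Gamma(x+1)
    = x Gamma(x), the right side integrates to x^s Gamma(x). *)
Lemma gamma_le_powR x s : 0 < x -> 0 <= s <= 1 -> gamma (x + s) <= x `^ s * gamma x.
Proof.
move=> x0 s01; have xs0 : 0 < x + s by rewrite ltr_wpDr//; case/andP: s01.
rewrite -lee_fin EFinM !gammaE//.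
have e : ((x `^ s)%:E * egamma x = ((x `^ s * (1 - s))%:E * egamma x) +
  ((x `^ s * s / x)%:E * egamma (x + 1)))%E.
  rewrite egammaS// muleA -EFinM mulfVK ?gt_eqF// -ge0_muleDl.
  - by rewrite -EFinD -mulrDr subrK mulr1.
  - by rewrite lee_fin mulr_ge0 ?powR_ge0// subr_ge0; case/andP: s01.
  - by rewrite lee_fin mulr_ge0 ?powR_ge0//; case/andP: s01.
have k1 : 0 <= x `^ s * (1 - s) by rewrite mulr_ge0 ?powR_ge0// subr_ge0; case/andP: s01.
have k2 : 0 <= x `^ s * s / x.
  apply: divr_ge0; last exact: ltW.
  by rewrite mulr_ge0 ?powR_ge0//; case/andP: s01.
have Z k u : 0 <= k -> (k%:E * egamma u = \int[mu]_(t in `]0%R, +oo[)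
    (k%:E * (t `^ (u - 1) * expR (- t))%:E))%E.
  move=> k0; rewrite ge0_integralZl_EFin//; last exact: measurable_gammaI.
  by move=> t _; rewrite lee_fin mulr_ge0 ?powR_ge0 ?expR_ge0.
rewrite {}e !Z//.
rewrite -ge0_integralD//; last 4 first.
- by move=> t _; rewrite -EFinM lee_fin !mulr_ge0 ?powR_ge0 ?expR_ge0// subr_ge0; case/andP: s01.
- by apply: measurable_funeM; exact: measurable_gammaI.
- by move=> t _; rewrite -EFinM lee_fin mulr_ge0// mulr_ge0 ?powR_ge0 ?expR_ge0.
- by apply: measurable_funeM; exact: measurable_gammaI.
apply: ge0_le_integral => //.
- by move=> t _; rewrite lee_fin mulr_ge0 ?powR_ge0 ?expR_ge0.
- exact: measurable_gammaI.
- by apply: emeasurable_funD; apply: measurable_funeM; exact: measurable_gammaI.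
move=> t /=; rewrite in_itv/= andbT => t0.
rewrite -!EFinM -EFinD lee_fin !mulrA -mulrDl ler_wpM2r ?expR_ge0//.
have -> : x + s - 1 = (x - 1) + s by ring.
rewrite addrK powRD; last by rewrite (gt_eqF t0) implybT.
have -> : t `^ x = t * t `^ (x - 1) by rewrite mulr_powRB1// ltW.
have -> : t `^ s = x `^ s * (t / x) `^ s.
  by rewrite -powRM ?divr_ge0 ?ltW// mulrC divfK ?gt_eqF.
have := @powR_le_affine s (t / x) s01 (divr_gt0 t0 x0).
move=> /(ler_wpM2l (powR_ge0 x s))/(ler_wpM2l (powR_ge0 t (x - 1))) /le_trans; apply.
by rewrite le_eqVlt; apply/orP; left; apply/eqP; ring.
Qed.

(** If Gamma(x) were 0, Wendel's inequality from x up to the integer floor(x) + 1, at a distance at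
    most 1, would make Gamma vanish at a positive integer. *)
Lemma gamma_gt0 x : 0 < x -> 0 < gamma x.
Proof.
move=> x0; rewrite lt_neqAle gamma_ge0 andbT eq_sym; apply/negP => /eqP gx.
have gxn n : gamma (x + n%:R) = 0.
  elim: n => [|n ih]; first by rewrite addr0.
  by rewrite -natr1 addrA gammaS ?ih ?mulr0// ltr_wpDr.
have gn n : gamma (n.+1%:R : R) > 0.
  elim: n => [|n ih]; first by rewrite gamma1.
  by rewrite -natr1 gammaS// mulr_gt0.
have fx := floor_itv x; pose n := `|Num.floor x|%N.
have xf : (Num.floor x)%:~R = n%:R :> R.
  by rewrite /n natr_absz ger0_norm// floor_ge0 ltW.
have s01 : 0 <= n%:R + 1 - x <= 1.
  by move: (floor_itv x); rewrite intrD xf => /andP[h1 h2]; apply/andP; split; lra.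
have := gamma_le_powR x0 s01.
have -> : x + (n%:R + 1 - x) = n.+1%:R by rewrite -natr1; ring.
by rewrite gx mulr0 leNgt gn.
Qed.

(** The substitution u = c t^2 turns the integral into Euler's at (b+1)/2. It is carried out on
    compact intervals, and both sides are passed to the limit. *)
Lemma gaussian_moment b c : -1 < b -> 0 < c ->
  (\int[mu]_(t in `]0%R, +oo[) (t `^ b * expR (- (c * t ^+ 2)))%:E =
   (2^-1 * c `^ (- ((b + 1) / 2)) * gamma ((b + 1) / 2))%:E)%E.
Proof.
move=> b1 c0; set s := (b + 1) / 2.
have s0 : 0 < s by rewrite /s; lra.
set M := (LHS).
pose F (t : R) : R := c * t ^+ 2.
have dF (t : R) : is_derive t 1 F (2 * c * t).
  by apply: is_derive_eq; rewrite /GRing.scale/=; ring.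
have F'E : (F^`())%classic = fun t => 2 * c * t.
  by apply/funext => t; rewrite derive1E; have [_ ->] := dF t.
have cF' : continuous (F^`())%classic.
  rewrite F'E => t; apply: (@is_derive_continuous _ _ _ (2 * c)).
  by apply: is_derive_eq; rewrite /GRing.scale/=; ring.
have mfM D : measurable_fun D (fun t => (t `^ b * expR (- (c * t ^+ 2)))%:E).
  apply/measurable_EFinP; apply: measurable_powR_expR.
  by apply: measurable_funN; apply: measurable_funM => //; exact: measurable_funX.
have c1 : (\int[mu]_(t in `[F n.+1%:R^-1%R, F n.+1%:R%R]) (t `^ (s - 1) * expR (- t))%:E)%E
    @[n --> \oo] --> egamma s.
  apply: cvg_integral_itv0y.
  - by move=> n; rewrite /F mulr_gt0// exprn_gt0// invr_gt0.
  - move=> m n mn; rewrite /F ler_pM2l// ler_sqr ?nnegrE ?invr_ge0// lef_pV2 ?posrE//.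
    by rewrite ler_nat.
  - have -> : 0 = F 0 by rewrite /F expr0n mulr0.
    apply: (cvg_comp (fun n : nat => n.+1%:R^-1 : R) F cvg_invS_0).
    exact: is_derive_continuous (dF 0).
  - by move=> m n mn; rewrite /F ler_pM2l// ler_sqr ?nnegrE// ler_nat.
  - apply: (cvg_comp (fun n : nat => n.+1%:R : R) F cvg_natS_oo).
    exact: (gt0_cvgMry c0 cvgr_expr2).
  - exact: measurable_gammaI.
  - by move=> t _; rewrite lee_fin mulr_ge0 ?powR_ge0 ?expR_ge0.
have c2 : (\int[mu]_(t in `[n.+1%:R^-1%R, n.+1%:R%R]) (t `^ b * expR (- (c * t ^+ 2)))%:E)%E
    @[n --> \oo] --> M.
  apply: cvg_integral_itv0y.
  - by move=> n; rewrite invr_gt0.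
  - by move=> m n mn; rewrite lef_pV2 ?posrE// ler_nat.
  - exact: cvg_invS_0.
  - by move=> m n mn; rewrite ler_nat.
  - exact: cvg_natS_oo.
  - exact: mfM.
  - by move=> t t0; rewrite lee_fin mulr_ge0// ?powR_ge0 ?expR_ge0.
have k0 : 0 <= 2 * c `^ s by rewrite mulr_ge0 ?powR_ge0.
have e n : (\int[mu]_(t in `[F n.+1%:R^-1%R, F n.+1%:R%R]) (t `^ (s - 1) * expR (- t))%:E =
    (2 * c `^ s)%:E * \int[mu]_(t in `[n.+1%:R^-1%R, n.+1%:R%R])
      (t `^ b * expR (- (c * t ^+ 2)))%:E)%E.
  have nn : n.+1%:R^-1 <= n.+1%:R :> R.
    by rewrite (@le_trans _ _ 1)// ?invf_le1 ?ler1n ?ltr0n.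
  have n0 : 0 < n.+1%:R^-1 :> R by rewrite invr_gt0.
  rewrite (@integration_by_substitution_increasing _ F (fun t => t `^ (s - 1) * expR (- t)))//.
  - rewrite -ge0_integralZl_EFin//; last first.
    + exact: mfM.
    + by move=> t _; rewrite lee_fin mulr_ge0 ?powR_ge0 ?expR_ge0.
    apply: eq_integral => t /set_mem/=; rewrite in_itv/= => /andP[/(lt_le_trans n0) t0 _].
    rewrite -EFinM F'E; congr EFin.
    transitivity (F t `^ (s - 1) * expR (- F t) * (2 * c * t)) => //.
    rewrite /F powRM ?sqr_ge0 ?ltW//.
    have -> : (t ^+ 2) `^ (s - 1) = t `^ (b - 1).
      by rewrite -powR_mulrn ?ltW// -powRrM; congr powR; rewrite /s; field.
    have -> : c `^ s = c * c `^ (s - 1) by rewrite mulr_powRB1// ltW.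
    have -> : t `^ b = t * t `^ (b - 1).
      rewrite -{2}(powRr1 (ltW t0)) -powRD; last by rewrite (gt_eqF t0) implybT.
      by congr powR; ring.
    by ring.
  - move=> t u /[!in_itv]/= /andP[/(lt_le_trans n0) t0 _] /andP[/(lt_le_trans n0) u0 _] tu.
    by rewrite /F ltr_pM2l// ltr_sqr ?nnegrE ?ltW.
  - by apply: cvgP; apply: cvg_at_right_filter; exact: cF'.
  - by apply: cvgP; apply: cvg_at_left_filter; exact: cF'.
  - split => [t _||]; first by have [] := dF t.
      by apply: cvg_at_right_filter; exact: is_derive_continuous (dF _).
    by apply: cvg_at_left_filter; exact: is_derive_continuous (dF _).
  - apply: continuous_within_itvcc => t /andP[ht _].
    by apply: continuous_powR_expRN; apply: lt_le_trans ht; rewrite mulr_gt0// exprn_gt0.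
have c3 : ((2 * c `^ s)%:E * M)%E = egamma s.
  apply: cvg_unique (c1) => //=.
  by under eq_fun do rewrite e; exact: cvgeZl.
have cs0 : c `^ s != 0 by rewrite gt_eqF// powR_gt0.
have -> : (2^-1 * c `^ (- s) * gamma s)%:E = ((2 * c `^ s)^-1%:E * egamma s)%E.
  by rewrite -gammaE// -EFinM powRN invfM.
by rewrite -c3 muleA -EFinM mulVf ?mul1e// mulf_neq0// pnatr_eq0.
Qed.

Lemma gamma_half : gamma 2^-1 = Num.sqrt pi :> R.
Proof.
have := @gaussian_moment 0 1; rewrite oppr_lt0 !ltr01 => /(_ isT isT).
rewrite powR1 mulr1 add0r mul1r => h.
have : (\int[mu]_(t in `]0%R, +oo[) (t `^ 0 * expR (- (1 * t ^+ 2)))%:E =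
   (Num.sqrt pi / 2)%:E)%E.
  rewrite -integral0y_gauss integral_itv_obnd_cbnd.
    apply: eq_integral => t _.
    by rewrite powRr0 !mul1r.
  apply/measurable_EFinP; apply: measurable_powR_expR.
  by apply: measurable_funN; apply: measurable_funM => //; exact: measurable_funX.
by rewrite h => -[]; lra.
Qed.

End GammaFunction.

(** * The reflection formula *)

Section ReflectionFormula.
Context {R : realType}.
Notation mu := (@lebesgue_measure R).
Implicit Types s t u x N : R.

Local Opaque gamma rgamma.

(* [wallis s 0] is [sin (pi s) / (2 s)] and the ratios [wallis s n / wallis 0 n]
   tend to 1, so that the recurrence in [n] yields Euler's product for the sine,
   that is, the reflection formula. *)
Definition wallis s (n : nat) : R :=
  \int[mu]_(x in `[0, pi / 2]) (cos (2 * s * x) * cos x ^+ n.*2).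

Lemma is_derive_subf (f g : R -> R) x (df dg : R) : is_derive x 1 f df ->
  is_derive x 1 g dg -> is_derive x 1 (fun t => f t - g t) (df - dg).
Proof. exact: is_deriveB. Qed.

Lemma is_derive_mulf (f g : R -> R) x (df dg : R) : is_derive x 1 f df ->
  is_derive x 1 g dg -> is_derive x 1 (fun t => f t * g t) (df * g x + f x * dg).
Proof.
move=> hf hg; apply: is_derive_eq (is_deriveM hf hg) _.
by rewrite /GRing.scale/=; ring.
Qed.

Lemma is_derive_Zf (k : R) (f : R -> R) x (df : R) : is_derive x 1 f df ->
  is_derive x 1 (fun t => k * f t) (k * df).
Proof. by move=> hf; apply: is_derive_eq (is_deriveZ k hf) _. Qed.

Lemma is_derive_linear (k x : R) : is_derive x 1 (fun t => k * t) k.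
Proof.
by apply: is_derive_eq (is_derive_Zf k (is_derive_id x 1)) _; rewrite mulr1.
Qed.

Lemma is_derive_cos_linear k x : is_derive x 1 (fun t => cos (k * t)) (- (k * sin (k * x))).
Proof.
apply: is_derive_eq (@is_derive1_comp _ cos _ _ _ _ (is_derive_cos _) (is_derive_linear k x)) _.
by ring.
Qed.

Lemma is_derive_sin_linear k x : is_derive x 1 (fun t => sin (k * t)) (k * cos (k * x)).
Proof.
apply: is_derive_eq (@is_derive1_comp _ sin _ _ _ _ (is_derive_sin _) (is_derive_linear k x)) _.
by ring.
Qed.

Lemma is_derive_cosX n x :
  is_derive x 1 (fun t => cos t ^+ n) (- (n%:R * cos x ^+ n.-1 * sin x)).
Proof.
elim: n => [|n ih]; first by rewrite !mul0r oppr0; exact: is_derive_cst.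
have -> : (fun t => cos t ^+ n.+1) = (fun t : R => cos t * cos t ^+ n).
  by apply/funext => t; rewrite exprS.
apply: is_derive_eq (is_derive_mulf (is_derive_cos x) ih) _.
case: n {ih} => [|n]; first by rewrite !expr0; ring.
by rewrite /= -[n.+2%:R]natr1 !exprS; ring.
Qed.

Lemma continuous_wallisI s n : continuous (fun x : R => cos (2 * s * x) * cos x ^+ n.*2).
Proof.
move=> x; apply: is_derive_continuous.
exact: is_derive_mulf (is_derive_cos_linear _ _) (is_derive_cosX _ _).
Qed.

Lemma L1_wallisI s n :
  mu.-integrable `[0, pi / 2] (EFin \o (fun x : R => cos (2 * s * x) * cos x ^+ n.*2)).
Proof. by apply: L1_continuous_itv => x _; exact: continuous_wallisI. Qed.

Lemma Rintegral_is_derive (F f : R -> R) (a b : R) : a < b ->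
  (forall x, a <= x <= b -> is_derive x 1 F (f x)) ->
  (forall x, a <= x <= b -> {for x, continuous f}) ->
  \int[mu]_(x in `[a, b]) f x = F b - F a.
Proof. by move=> ab dF cf; rewrite /Rintegral (integral_is_derive ab dF cf). Qed.

Lemma pihalf_gt0 : 0 < pi / 2 :> R. Proof. by rewrite divr_gt0// pi_gt0. Qed.

Lemma wallis0 s : s != 0 -> wallis s 0 = sin (pi * s) / (2 * s).
Proof.
move=> s0; have dF x (_ : 0 <= x <= pi / 2) : is_derive x 1
    (fun t => (2 * s)^-1 * sin (2 * s * t)) (cos (2 * s * x) * cos x ^+ 0.*2).
  apply: is_derive_eq (is_derive_Zf _ (is_derive_sin_linear _ _)) _.
  by rewrite /= expr0; field.
rewrite /wallis (Rintegral_is_derive pihalf_gt0 dF); last first.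
  by move=> x _; exact: continuous_wallisI.
have -> : 2 * s * (pi / 2) = pi * s by field.
by rewrite mulr0 sin0 mulr0 subr0 mulrC.
Qed.

Lemma wallis00 : wallis 0 0 = pi / 2.
Proof.
have dF x (_ : 0 <= x <= pi / 2) : is_derive x 1 id (cos (2 * 0 * x) * cos x ^+ 0.*2).
  by apply: is_derive_eq (is_derive_id x 1) _; rewrite mulr0 mul0r cos0 expr0 mulr1.
rewrite /wallis (Rintegral_is_derive pihalf_gt0 dF) ?subr0//.
by move=> x _; exact: continuous_wallisI.
Qed.

Lemma wallisS s n : (n.+1%:R ^+ 2 - s ^+ 2) * wallis s n.+1
  = n.+1%:R * (n.+1%:R - 2^-1) * wallis s n.
Proof.
set N : R := n.+1%:R.
(* Two integrations by parts merged into one primitive. It vanishes at both ends: at 0 through the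
   sines, at pi/2 through the positive powers of the cosine. *)
pose F x := 2 * s * (sin (2 * s * x) * cos x ^+ n.*2.+2)
  - 2 * N * (cos (2 * s * x) * (cos x ^+ n.*2.+1 * sin x)).
have NE : n.*2.+2%:R = 2 * N by rewrite /N -doubleS -muln2 natrM mulrC.
have NE1 : n.*2.+1%:R = 2 * N - 1 by rewrite -NE -[X in _ = X - _]natr1 addrK.
have := @Rintegral_is_derive F (fun x =>
  4 * N * (N - 2^-1) * (cos (2 * s * x) * cos x ^+ n.*2)
  - 4 * (N ^+ 2 - s ^+ 2) * (cos (2 * s * x) * cos x ^+ n.+1.*2)) _ _ pihalf_gt0.
rewrite RintegralB//; last 2 first.
- by apply: L1_Zl => //; exact: L1_wallisI.
- by apply: L1_Zl => //; exact: L1_wallisI.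
rewrite !RintegralZl//; try exact: L1_wallisI.
rewrite -!/(wallis _ _) => h.
have /h {}h x : 0 <= x <= pi / 2 -> is_derive x 1 F
   (4 * N * (N - 2^-1) * (cos (2 * s * x) * cos x ^+ n.*2) -
    4 * (N ^+ 2 - s ^+ 2) * (cos (2 * s * x) * cos x ^+ n.+1.*2)).
  move=> _; apply: is_derive_eq (is_derive_subf
    (is_derive_Zf _ (is_derive_mulf (is_derive_sin_linear _ _) (is_derive_cosX _ _)))
    (is_derive_Zf _ (is_derive_mulf (is_derive_cos_linear _ _)
      (is_derive_mulf (is_derive_cosX _ _) (is_derive_sin _))))) _.
  rewrite NE NE1 doubleS /=.
  have : sin x * sin x = 1 - cos x ^+ 2 by rewrite -expr2 sin2cos2.
  rewrite !exprS; set S := sin x; set C := cos x; set D := C ^+ n.*2.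
  set u := sin (2 * s * x); set v := cos (2 * s * x) => SE.
  transitivity ((4 * s ^+ 2 * v * (C * (C * D)) - 2 * N * v * (C * (C * D)))
     + 2 * N * (2 * N - 1) * v * D * (S * S)); first by ring.
  by rewrite SE; field.
have : 4 * N * (N - 2^-1) * wallis s n - 4 * (N ^+ 2 - s ^+ 2) * wallis s n.+1 = 0.
  rewrite h; last first.
    move=> x _; apply: cvgB; apply: cvgMr; exact: continuous_wallisI.
  by rewrite /F cos_pihalf !mulr0 sin0 !exprS !mul0r !(mulr0, mul0r) !subr0.
by lra.
Qed.

Lemma wallis_gt0 n : 0 < wallis 0 n.
Proof.
elim: n => [|n ih]; first by rewrite wallis00 pihalf_gt0.
have := wallisS 0 n; rewrite expr0n subr0 => h.
have n0 : 0 < n.+1%:R :> R by rewrite ltr0n.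
have n1 : 1 <= n.+1%:R :> R by rewrite ler1n.
have : 0 < n.+1%:R ^+ 2 * wallis 0 n.+1.
  by rewrite h !mulr_gt0//; lra.
by rewrite pmulr_rgt0// exprn_gt0.
Qed.

(** The upper bound is cos <= 1. For the lower one, sin(sx) <= sin(x) on [0, pi/2] gives cos(2sx) >=
    2 cos(x)^2 - 1, so that [wallis s n] is at least 2 [wallis 0 n.+1] - [wallis 0 n], which is (1 -
    1/(n+1)) [wallis 0 n] by the recurrence. *)
Lemma wallis_ratio_cvg s : 0 <= s <= 1 ->
  (wallis s n / wallis 0 n) @[n --> \oo] --> (1 : R).
Proof.
move=> /andP[s0 s1].
have bnd n : 1 - n.+1%:R^-1 <= wallis s n / wallis 0 n <= 1.
  have wn := wallis_gt0 n.
  rewrite ler_pdivrMr// ler_pdivlMr// mul1r.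
  have n0 : 0 < n.+1%:R :> R by rewrite ltr0n.
  have -> : (1 - n.+1%:R^-1) * wallis 0 n = 2 * wallis 0 n.+1 - wallis 0 n.
    have := wallisS 0 n; rewrite expr0n subr0 => h.
    have -> : wallis 0 n.+1 = (n.+1%:R - 2^-1) * wallis 0 n / n.+1%:R.
      apply: (@mulfI _ (n.+1%:R ^+ 2)); first by rewrite expf_neq0// gt_eqF.
      by rewrite h; field; rewrite gt_eqF.
    by field; rewrite gt_eqF.
  rewrite /wallis -RintegralZl//; last exact: L1_wallisI.
  rewrite -RintegralB//; last 2 first.
  - by apply: L1_Zl => //; exact: L1_wallisI.
  - exact: L1_wallisI.
  have I1 : mu.-integrable `[0, pi / 2] (EFin \o (fun x : R =>
      2 * (cos (2 * 0 * x) * cos x ^+ n.+1.*2) - cos (2 * 0 * x) * cos x ^+ n.*2)).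
    by apply: L1_B => //; [apply: L1_Zl => //|]; exact: L1_wallisI.
  apply/andP; split; apply: le_Rintegral => //; try exact: L1_wallisI.
  - move=> x /=; rewrite in_itv/= => /andP[x0 x1].
    rewrite !mulr0 mul0r cos0 !mul1r doubleS !exprS.
    have c0 : 0 <= cos x ^+ n.*2.
      by rewrite -muln2 exprM exprn_even_ge0.
    have -> : cos (2 * s * x) = 1 - 2 * sin (s * x) ^+ 2.
      have -> : 2 * s * x = (s * x) *+ 2 by rewrite mulr2n; ring.
      by rewrite cos_mulr2n cos2sin2 mulr2n; ring.
    have ss : sin (s * x) ^+ 2 <= sin x ^+ 2.
      have sx : s * x <= x by rewrite ler_piMl.
      have sx0 : 0 <= s * x by rewrite mulr_ge0.
      have p0 := pihalf_gt0.
      rewrite ler_sqr ?nnegrE; last 2 first.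
      - by apply: sin_ge0_pi; apply/andP; split; lra.
      - by apply: sin_ge0_pi; apply/andP; split; lra.
      rewrite leNgt ltr_sin ?in_itv/= -?leNgt//; apply/andP; split; lra.
    have := sin2cos2 x => e; rewrite e in ss.
    nra.
  - move=> x /=; rewrite in_itv/= => /andP[x0 x1].
    rewrite ler_wpM2r//; first by rewrite -muln2 exprM exprn_even_ge0.
    by rewrite mulr0 mul0r cos0 cos_le1.
apply: (@squeeze_cvgr _ _ _ _ (fun n => 1 - n.+1%:R^-1) (cst 1)).
- by apply: nearW => n; exact: bnd.
- by rewrite -[X in _ --> X](subr0 1); apply: cvgB; [exact: cvg_cst|exact: cvg_invS_0].
- exact: cvg_cst.
Qed.

(** Four instances of Wendel's inequality. From N+1 by s and from N by 1-s they give the upper bound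
    (N+1)/N; from N+1-s by s and from N+1+s by 1-s they give the lower bound (N+1)/(N+1+s), which
    exceeds (N+1)/(N+2). *)
Lemma gamma_ratio_bounds N s : 1 <= N -> 0 <= s < 1 ->
  1 - N^-1 <= gamma (N + 1 + s) * gamma (N + 1 - s) / gamma (N + 1) ^+ 2 <= 1 + N^-1.
Proof.
move=> N1 /andP[s0 s1].
have s01 : 0 <= s <= 1 by rewrite s0 ltW.
have s01' : 0 <= 1 - s <= 1 by rewrite subr_ge0 ltW//= lerBlDr lerDl.
have N0 : 0 < N by lra.
have p1 : 0 < N + 1 by lra.
have p2 : 0 < N + 1 + s by lra.
have p3 : 0 < N + 1 - s by lra.
have p4 : (N + 1 + s) `^ (1 - s) * (N + 1 + s) `^ s = N + 1 + s.
  rewrite -powRD; last by rewrite (gt_eqF p2) implybT.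
  by rewrite subrK powRr1// ltW.
have p5 : (N + 1) `^ s * (N + 1) `^ (1 - s) = N + 1.
  rewrite -powRD; last by rewrite (gt_eqF p1) implybT.
  by rewrite (_ : s + (1 - s) = 1) ?powRr1 ?ltW//; ring.
have p6 : (N + 1 - s) `^ s <= (N + 1 + s) `^ s.
  by apply: ge0_ler_powR => //; rewrite ?nnegrE; lra.
have p7 : N `^ (1 - s) <= (N + 1) `^ (1 - s).
  by apply: ge0_ler_powR => //; rewrite ?nnegrE; lra.
have p8 : (1 - N^-1) * (N + 2) <= N + 1.
  rewrite -subr_ge0; have -> : N + 1 - (1 - N^-1) * (N + 2) = 2 * N^-1.
    by field; rewrite gt_eqF.
  by rewrite mulr_ge0// invr_ge0 ltW.
have g2 := gammaS N0.
have gN := gamma_gt0 N0; have gg := gamma_gt0 p1.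
have ga := gamma_gt0 p2; have gb := gamma_gt0 p3.
have h1 := gamma_le_powR p3 s01; rewrite subrK in h1.
have h2 := gamma_le_powR p2 s01'.
rewrite (_ : N + 1 + s + (1 - s) = N + 1 + 1) in h2; last by ring.
rewrite (gammaS p1) in h2.
have h3 := gamma_le_powR p1 s01.
have h4 := gamma_le_powR N0 s01'; rewrite addrA in h4.
rewrite ler_pdivlMr ?exprn_gt0// ler_pdivrMr ?exprn_gt0//.
move: (gamma (N + 1 + s)) (gamma (N + 1 - s)) (gamma (N + 1)) (gamma N) g2 gN gg ga gb h1 h2 h3 h4.
move=> A B G G' g2 gN gg ga gb h1 h2 h3 h4.
apply/andP; split.
- have h5 : (N + 1) * G * G <= (N + 1 + s) * (A * B).
    rewrite -p4; apply: (@le_trans _ _ ((N + 1 + s) `^ (1 - s) * A * ((N + 1 - s) `^ s * B))).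
      by apply: ler_pM => //; rewrite ?mulr_ge0 ?ltW.
    rewrite mulrACA ler_wpM2r// ?ler_wpM2l ?powR_ge0//.
    by rewrite mulr_ge0// ltW.
  have AB := mulr_gt0 ga gb; have GG := mulr_gt0 gg gg.
  rewrite -(@ler_pM2r _ (N + 2)); last by lra.
  rewrite expr2; nra.
- have h5 : A * B <= (N + 1) * (G * G').
    rewrite -p5 mulrACA; apply: ler_pM => //; [exact: ltW|exact: ltW|].
    by rewrite (le_trans h4)// ler_wpM2r// ltW.
  rewrite (le_trans h5)// g2 le_eqVlt; apply/orP; left; apply/eqP.
  by field; rewrite gt_eqF.
Qed.

Lemma gamma_ratio_cvg s : 0 <= s < 1 ->
  (gamma (n.+1%:R + s) * gamma (n.+1%:R - s) / gamma n.+1%:R ^+ 2) @[n --> \oo] --> (1 : R).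
Proof.
(* Dropping the first term provides N = n+1 >= 1, as the bounds require. *)
move=> s01; rewrite -(cvg_shiftS _ (nbhs (1 : R))).
apply: (@squeeze_cvgr _ _ _ _ (fun n => 1 - n.+1%:R^-1) (fun n => 1 + n.+1%:R^-1)).
- apply: nearW => n /=; rewrite -[n.+2%:R]natr1; apply: gamma_ratio_bounds => //.
  by rewrite ler1n.
- by rewrite -[X in _ --> X](subr0 1); apply: cvgB; [exact: cvg_cst|exact: cvg_invS_0].
- by rewrite -[X in _ --> X](addr0 1); apply: cvgD; [exact: cvg_cst|exact: cvg_invS_0].
Qed.

(** From n to n+1 the first ratio is multiplied by N^2/(N^2 - s^2), with N = n+1, and the second by
    the inverse of this. Their product is therefore constant: at n = 0 it is the left side divided
    by pi, and its limit is 1. *)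
Lemma gamma_reflection s : 0 < s < 1 ->
  gamma s * gamma (1 - s) * sin (pi * s) = pi.
Proof.
move=> /andP[s0 s1].
pose r n := wallis s n / wallis 0 n.
pose q n : R := gamma (n.+1%:R + s) * gamma (n.+1%:R - s) / gamma n.+1%:R ^+ 2.
have s0' : s != 0 by rewrite gt_eqF.
have p0 : pi != 0 :> R by rewrite gt_eqF// pi_gt0.
have rq n : r n * q n = gamma s * gamma (1 - s) * sin (pi * s) / pi.
  elim: n => [|n <-].
    rewrite /r /q wallis0// wallis00 gamma1 addrC gammaS//.
    move: (sin (pi * s)) => S; move: (pi : R) p0 => P P0.
    by field; rewrite P0 s0'.
  have n1 : 1 <= n.+1%:R :> R by rewrite ler1n.
  rewrite /r /q -[n.+2%:R]natr1; set N : R := n.+1%:R in n1 *.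
  rewrite (_ : N + 1 + s = N + s + 1); last by ring.
  rewrite (_ : N + 1 - s = N - s + 1); last by ring.
  rewrite !gammaS; [|lra|lra|lra].
  have hs := wallisS s n; have h0 := wallisS 0 n.
  rewrite -/N in hs h0; rewrite expr0n subr0 in h0.
  have NN : N ^+ 2 - s ^+ 2 != 0.
    by rewrite subr_sqr mulf_neq0//; lra.
  have N0 : N != 0 by lra.
  have -> : wallis s n.+1 = N * (N - 2^-1) * wallis s n / (N ^+ 2 - s ^+ 2).
    by apply: (mulfI NN); rewrite hs mulrCA mulfV ?mulr1.
  have -> : wallis 0 n.+1 = N * (N - 2^-1) * wallis 0 n / N ^+ 2.
    have N20 := expf_neq0 2 N0.
    by apply: (mulfI N20); rewrite h0 mulrCA mulfV ?mulr1.
  have w0 : wallis 0 n != 0 by rewrite gt_eqF// wallis_gt0.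
  have g0 : gamma N != 0 by rewrite gt_eqF// gamma_gt0//; lra.
  have Nm : N - s != 0 by lra.
  have Np : N + s != 0 by lra.
  have Nh : N - 2^-1 != 0 by lra.
  move: w0 g0 N0 Nm Np Nh; rewrite subr_sqr.
  move: (wallis 0 n) (wallis s n) (gamma (N + s)) (gamma (N - s)) (gamma N).
  move: (N - s) (N + s) (N - 2^-1) => Nm Np Nh w0 ws gp gm g w00 g00 N0 Nm0 Np0 Nh0.
  clearbody N; by field; rewrite ?w00 ?g00 ?N0 ?Nm0 ?Np0 ?Nh0.
have c1 : r n * q n @[n --> \oo] --> (1 : R) * 1.
  by apply: cvgM; [apply: wallis_ratio_cvg|apply: gamma_ratio_cvg]; rewrite !ltW.
suff : gamma s * gamma (1 - s) * sin (pi * s) / pi = 1.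
  by move/(congr1 ( *%R^~ pi)); rewrite divfK// mul1r.
rewrite -[RHS](mulr1 1); apply: cvg_unique c1 => //=.
by under eq_fun do rewrite rq; exact: cvg_cst.
Qed.

Lemma unlock_rgamma x : rgamma x = \prod_(i < `|Num.floor x|%N.+1) (x + i%:R) /
  gamma (x + `|Num.floor x|%N.+1%:R).
Proof. by []. Qed.

(** The shift is immaterial as long as it makes the argument positive: the functional equation
    compares a shift with any larger one, and two shifts are compared through their sum. *)
Lemma rgammaE x n : 0 < x + n%:R ->
  rgamma x = \prod_(i < n) (x + i%:R) / gamma (x + n%:R).
Proof.
pose f m := \prod_(i < m) (x + i%:R) / gamma (x + m%:R).
have step m k : 0 < x + m%:R -> f (m + k)%N = f m.
  move=> xm; elim: k => [|k ih]; first by rewrite addn0.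
  have xk : 0 < x + (m + k)%:R by rewrite (lt_le_trans xm)// lerD2l ler_nat leq_addr.
  rewrite -ih addnS /f big_ord_recr/= -natr1 addrA gammaS//.
  move: (x + (m + k)%:R) xk => u u0.
  by field; rewrite ?gt_eqF//= gamma_gt0.
move=> xn; rewrite [LHS]unlock_rgamma; set m := `|_|%N.+1.
have xm : 0 < x + m%:R.
  rewrite -ltrBlDl sub0r /m -natr1.
  have := floor_itv x => /andP[fx _].
  have : - (Num.floor x)%:~R <= `|Num.floor x|%N%:R :> R.
    by rewrite natr_absz -rmorphN ler_int -normrN ler_norm.
  by lra.
by rewrite -!/(f _) -(step _ n xm) -(step _ m xn) addnC.
Qed.

Lemma rgamma_recl x : rgamma x = x * rgamma (x + 1).
Proof.
pose n := `|Num.floor (x + 1)|%N.+1.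
have [m xm] : exists m : nat, 0 < x + 1 + m%:R.
  exists (Num.bound `|x|).+1; rewrite -natr1.
  have := archi_boundP (normr_ge0 x); have := ler_norm (- x); rewrite normrN.
  lra.
rewrite (@rgammaE (x + 1) m)// (@rgammaE x m.+1); last by rewrite -natr1; lra.
rewrite big_ord_recl/= addr0 -mulrA; congr (_ * (_ / gamma _)).
  by apply: eq_bigr => i _; rewrite /bump/= add1n -natr1; ring.
by rewrite -natr1; ring.
Qed.

Lemma rgamma_reflection s : 0 < s -> rgamma (1 - s) = sin (pi * s) * gamma s / pi.
Proof.
have p0 : pi != 0 :> R by rewrite gt_eqF// pi_gt0.
have base t : 0 < t <= 1 -> rgamma (1 - t) = sin (pi * t) * gamma t / pi.
  (* At t = 1 both sides vanish: 1/Gamma has a zero at 0 and sin(pi) = 0. *)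
  move=> /andP[t0]; rewrite le_eqVlt => /predU1P[->|t1].
    by rewrite subrr rgamma_recl mul0r mulr1 sinpi !mul0r.
  rewrite (@rgammaE _ 0); last by rewrite addr0 subr_gt0.
  rewrite big_ord0 addr0 mul1r.
  have := @gamma_reflection t; rewrite t0 t1 => /(_ isT) e.
  have g0 : gamma (1 - t) != 0 by rewrite gt_eqF// gamma_gt0 ?subr_gt0.
  by apply: (mulIf p0); rewrite divfK// -{1}e; field.
have rec n t : 0 < t <= 1 ->
    rgamma (1 - (t + n%:R)) = sin (pi * (t + n%:R)) * gamma (t + n%:R) / pi.
  move=> t01; elim: n => [|n ih]; first by rewrite addr0; exact: base.
  rewrite -natr1 addrA; set u := t + n%:R in ih *.
  have u0 : 0 < u by rewrite /u ltr_wpDr//; case/andP: t01.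
  rewrite rgamma_recl (_ : 1 - (u + 1) + 1 = 1 - u); last by ring.
  rewrite ih gammaS// (_ : pi * (u + 1) = pi * u + pi) ?sinDpi; last by ring.
  by ring.
(* Subtracting ceil(s) - 1 puts s into ]0, 1]; subtracting the floor would send integers to 0. *)
move=> s0; pose n := `|Num.ceil s|%N.-1.
have cs : 0 < Num.ceil s by rewrite ceil_gt0.
have cn : (Num.ceil s)%:~R = n%:R + 1 :> R.
  rewrite natr1 /n prednK ?absz_gt0 ?gt_eqF// natr_absz gtr0_norm//.
have := rec n (s - n%:R); rewrite subrK; apply.
have := ceil_itv s; rewrite intrD mulrNz cn => /andP[h1 h2].
by apply/andP; split; lra.
Qed.

End ReflectionFormula.

(** * Kummer's function *)

Section CauchyProduct.
Context {R : realType}.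
Implicit Types (u v : R^nat) (f : nat -> nat -> R).

Lemma sum_antidiagonals f N :
  \sum_(0 <= n < N) \sum_(0 <= k < n.+1) f k (n - k)%N =
  \sum_(0 <= i < N) \sum_(0 <= j < N - i) f i j.
Proof.
elim: N => [|N ih]; first by rewrite !big_nil.
rewrite big_nat_recr//= ih [RHS]big_nat_recr//= subSnn big_nat1.
rewrite [X in _ + X = _]big_nat_recr//= subnn addrA; congr (_ + _).
rewrite -big_split/=; apply: eq_big_nat => i /andP[_ iN].
by rewrite subSn 1?ltnW// big_nat_recr.
Qed.

(** The difference between the product of partial sums and the partial sum of the Cauchy product is
    a sum over the pairs i, j < N with i + j >= N; it can be majorised term by term. *)
Lemma series_antidiagonals_le u v U V N :
  (forall n, `|u n| <= U n) -> (forall n, `|v n| <= V n) ->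
  `|series u N * series v N - \sum_(0 <= n < N) \sum_(0 <= k < n.+1) u k * v (n - k)%N|
  <= series U N * series V N - \sum_(0 <= n < N) \sum_(0 <= k < n.+1) U k * V (n - k)%N.
Proof.
move=> uU vV.
have E (w z : R^nat) : series w N * series z N -
    \sum_(0 <= n < N) \sum_(0 <= k < n.+1) w k * z (n - k)%N =
    \sum_(0 <= i < N) \sum_(N - i <= j < N) w i * z j.
  rewrite (sum_antidiagonals (fun i j => w i * z j)) /series/= mulr_suml -sumrB.
  apply: eq_bigr => i _; rewrite mulr_sumr.
  by rewrite (@big_cat_nat _ _ _ (N - i) 0 N)//= ?leq_subr// addrAC subrr add0r.
rewrite !E (le_trans (ler_norm_sum _ _ _))//; apply: ler_sum => i _.
rewrite (le_trans (ler_norm_sum _ _ _))//; apply: ler_sum => j _.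
by rewrite normrM ler_pM.
Qed.

(** For the exponential majorants the difference of the previous lemma is a product of partial sums
    minus a partial sum of the binomial expansion, and it tends to e^X e^Y - e^(X+Y) = 0. *)
Lemma cvg_cauchy_product u v (X Y a b : R) : 0 <= X -> 0 <= Y ->
  (forall n, `|u n| <= exp_coeff X n) -> (forall n, `|v n| <= exp_coeff Y n) ->
  series u @ \oo --> a -> series v @ \oo --> b ->
  series (fun n => \sum_(0 <= k < n.+1) u k * v (n - k)%N) @ \oo --> a * b.
Proof.
move=> X0 Y0 uX vY ua vb.
have expc Z : series (exp_coeff Z) @ \oo --> expR Z.
  exact: is_cvg_series_exp_coeff.
have binom n : \sum_(0 <= k < n.+1) exp_coeff X k * exp_coeff Y (n - k)%N =
    exp_coeff (X + Y) n.
  rewrite /exp_coeff/= exprDn_comm; last exact: mulrC.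
  rewrite mulr_suml big_mkord (reindex_inj rev_ord_inj)/=; apply: eq_bigr => i _.
  have ni : (i <= n)%N by rewrite -ltnS.
  rewrite subSS subKn// -mulr_natr.
  have -> : n`!%:R = 'C(n, i)%:R * (i`!%:R * (n - i)`!%:R) :> R.
    by rewrite -!natrM bin_fact.
  field; rewrite !pnatr_eq0 -!lt0n !fact_gt0 bin_gt0 ni //.
have D0 : (series (exp_coeff X) N * series (exp_coeff Y) N - series (exp_coeff (X + Y)) N)
    @[N --> \oo] --> (0 : R).
  have -> : 0 = expR X * expR Y - expR (X + Y) by rewrite expRD subrr.
  by apply: cvgB; [apply: cvgM|]; exact: expc.
have D1 : (series u N * series v N -
    series (fun n => \sum_(0 <= k < n.+1) u k * v (n - k)%N) N) @[N --> \oo] --> (0 : R).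
  pose D N := series (exp_coeff X) N * series (exp_coeff Y) N - series (exp_coeff (X + Y)) N.
  apply: (@squeeze_cvgr _ _ _ _ (fun N => - D N) D); last exact: D0.
    apply: nearW => N /=; rewrite -ler_norml.
    rewrite (le_trans (series_antidiagonals_le N uX vY))//.
    by rewrite le_eqVlt; apply/orP; left; apply/eqP; congr (_ - _); apply: eq_bigr.
  by rewrite -oppr0; apply: cvgN; exact: D0.
have -> : a * b = a * b - 0 by rewrite subr0.
have -> : series (fun n => \sum_(0 <= k < n.+1) u k * v (n - k)%N) =
  (fun N => series u N * series v N - (series u N * series v N -
    series (fun n => \sum_(0 <= k < n.+1) u k * v (n - k)%N) N)).
  by apply/funext => N; rewrite opprB addrC subrK.
by apply: cvgB D1; apply: cvgM.
Qed.

End CauchyProduct.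

(** * Convergence, Vandermonde's sum and Kummer's transformation *)

Section Kummer.
Context {R : realType}.
Implicit Types a b c x z : R.

Definition kummer_coeff a b z : R^nat :=
  fun n => rising a n / rising b n * (z ^+ n / n`!%:R).

Lemma risingS a n : rising a n.+1 = a * rising (a + 1) n.
Proof.
rewrite /rising big_ord_recl/= addr0; congr (_ * _).
by apply: eq_bigr => i _; rewrite /bump/= add1n -natr1; ring.
Qed.

Lemma risingSr a n : rising a n.+1 = rising a n * (a + n%:R).
Proof. by rewrite /rising big_ord_recr. Qed.

Lemma rising_gt0 a n : 0 < a -> 0 < rising a n.
Proof. by move=> a0; apply: prodr_gt0 => i _; rewrite ltr_wpDr. Qed.

(** Each factor satisfies |a + k|/(b + k) <= |a|/b + 1, whence the base of the exponential
    majorant. *)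
Lemma kummer_coeff_le a b z n : 0 < b ->
  `|kummer_coeff a b z n| <= exp_coeff ((`|a| / b + 1) * `|z|) n.
Proof.
move=> b0; rewrite /kummer_coeff /exp_coeff/= exprMn -[leRHS]mulrA normrM.
rewrite [`|z ^+ n / _|]normrM normrX normfV normr_nat.
rewrite ler_wpM2r//.
elim: n => [|n ih]; first by rewrite /rising !big_ord0 divr1 normr1.
rewrite !risingSr exprSr invfM mulrACA normrM ler_pM//.
have bn : 0 < b + n%:R by rewrite ltr_wpDr.
rewrite normrM normfV (gtr0_norm bn) ler_pdivrMr//.
rewrite (le_trans (ler_normD _ _))// normr_nat.
have : 0 <= `|a| / b * n%:R by rewrite mulr_ge0// divr_ge0// ltW.
have -> : (`|a| / b + 1) * (b + n%:R) = `|a| + b + `|a| / b * n%:R + n%:R.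
  by field; rewrite gt_eqF.
by have := normr_ge0 a; lra.
Qed.

Lemma cvg_kummer a b z : 0 < b ->
  series (kummer_coeff a b z) @ \oo --> kummer a b z.
Proof.
move=> b0; apply: normed_cvg; apply: series_le_cvg;
  last exact: (is_cvg_series_exp_coeff ((`|a| / b + 1) * `|z|)).
- by move=> n /=.
- by move=> n; rewrite exp_coeff_ge0// mulr_ge0// addr_ge0// divr_ge0// ltW.
- by move=> n; exact: kummer_coeff_le.
Qed.

Lemma kummer_id (a z : R) : 0 < a -> kummer a a z = expR z.
Proof.
move=> a0; rewrite /kummer (_ : (fun n => _) = exp_coeff z)//.
by apply/funext => n; rewrite divff ?mul1r// gt_eqF// rising_gt0.
Qed.

(** The Chu-Vandermonde identity. Pascal's rule splits the sum S(n+1; b, c) into S(n; b, c) - (c/b)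
    S(n; b+1, c+1), and b - c is unchanged when both parameters are raised by 1. *)
Lemma vandermonde_rising n b c : 0 < b ->
  \sum_(0 <= k < n.+1) (-1) ^+ k * 'C(n, k)%:R * (rising c k / rising b k) =
  rising (b - c) n / rising b n.
Proof.
elim: n b c => [|n ih] b c b0.
  by rewrite big_nat1 /rising !big_ord0 expr0 bin0 !mul1r.
have b1 : 0 < b + 1 by rewrite ltr_wpDr.
have := ih b c b0; have := ih (b + 1) (c + 1) b1.
have -> : b + 1 - (c + 1) = b - c by ring.
move=> h1 h2.
rewrite big_nat_recl// bin0.
under eq_bigr do rewrite binS natrD mulrDr mulrDl.
rewrite big_split/= addrA.
have -> : (-1) ^+ 0 * 1 * (rising c 0 / rising b 0) +
  \sum_(0 <= i < n.+1) (-1) ^+ i.+1 * 'C(n, i.+1)%:R * (rising c i.+1 / rising b i.+1) =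
  \sum_(0 <= k < n.+1) (-1) ^+ k * 'C(n, k)%:R * (rising c k / rising b k).
  rewrite big_nat_recr//= bin_small// mulr0 mul0r addr0.
  by rewrite [RHS]big_nat_recl// bin0.
rewrite h2.
have -> : \sum_(0 <= i < n.+1) (-1) ^+ i.+1 * 'C(n, i)%:R * (rising c i.+1 / rising b i.+1)
  = - (c / b) * \sum_(0 <= k < n.+1) (-1) ^+ k * 'C(n, k)%:R *
      (rising (c + 1) k / rising (b + 1) k).
  rewrite mulr_sumr; apply: eq_bigr => i _.
  rewrite !risingS exprS invfM.
  move: (rising (c + 1) i) (rising (b + 1) i)^-1 ('C(n, i)%:R) ((-1) ^+ i) b^-1 => r1 r2 r3 r4 r5.
  by ring.
rewrite h1.
have e : b * rising (b + 1) n = rising b n * (b + n%:R) by rewrite -risingS risingSr.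
have r1 := rising_gt0 n b1; have r0 := rising_gt0 n b0.
have bn : 0 < b + n%:R by rewrite ltr_wpDr.
rewrite !risingSr.
have -> : rising (b + 1) n = rising b n * (b + n%:R) / b.
  by rewrite -e mulrAC mulfV ?mul1r// gt_eqF.
by field; rewrite !gt_eqF.
Qed.

(** Comparison of coefficients in the Cauchy product of the series for e^(-z) with that on the
    right; the resulting finite sum is Vandermonde's. *)
Lemma kummer_transformation a b z : 0 < b ->
  kummer a b (- z) = expR (- z) * kummer (b - a) b z.
Proof.
move=> b0.
have expc : series (exp_coeff (- z)) @ \oo --> expR (- z).
  exact: is_cvg_series_exp_coeff.
have c1 := @cvg_kummer a b (- z) b0.
have c2 := @cvg_kummer (b - a) b z b0.
have X0 : 0 <= (`|b - a| / b + 1) * `|z| by rewrite mulr_ge0// addr_ge0// divr_ge0// ltW.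
have c3 := @cvg_cauchy_product _ _ _ _ `|z| _ _ X0 (normr_ge0 z)
  (fun n => kummer_coeff_le (b - a) z n b0) _ c2 expc.
rewrite mulrC; apply: cvg_unique c1 _ => //.
rewrite (_ : series _ = series (fun n => \sum_(0 <= k < n.+1)
  kummer_coeff (b - a) b z k * exp_coeff (- z) (n - k)%N)).
  by apply: c3 => n; rewrite /exp_coeff/= normrM normrX normrN normfV normr_nat.
congr series; apply/funext => n; rewrite /kummer_coeff.
have := vandermonde_rising n (b - a) b0; rewrite subKr => <-.
rewrite mulr_suml; apply: eq_big_nat => k /andP[_ kn].
rewrite /exp_coeff/=.
have kn' : (k <= n)%N by rewrite -ltnS.
have -> : n`!%:R = 'C(n, k)%:R * (k`!%:R * (n - k)`!%:R) :> R.
  by rewrite -!natrM bin_fact.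
have -> : (- z) ^+ n = (- z) ^+ k * (- z) ^+ (n - k) by rewrite -exprD subnKC.
have -> : (- z) ^+ k = (-1) ^+ k * z ^+ k by rewrite -[- z]mulN1r exprMn.
have s2 : (-1) ^+ k * (-1) ^+ k = 1 :> R by rewrite -exprMn mulrNN mulr1 expr1n.
have rk : rising b k != 0 by rewrite gt_eqF// rising_gt0.
have f0 m : m`!%:R != 0 :> R by rewrite pnatr_eq0 -lt0n fact_gt0.
have C0 : 'C(n, k)%:R != 0 :> R by rewrite pnatr_eq0 -lt0n bin_gt0.
have f1 := f0 k; have f2 := f0 (n - k)%N.
move: s2 rk f1 f2 C0.
move: ((-1) ^+ k) (rising b k) (k`!%:R) ((n - k)`!%:R) ('C(n, k)%:R) (z ^+ k).
move: ((- z) ^+ (n - k)) (rising (b - a) k) => w r e rb f1 f2 C u s2 rb0 f10 f20 C0.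
transitivity ((e * e) * (r / rb * (u / f1) * (w / f2))).
  by field; rewrite rb0 f10 f20 C0.
by rewrite s2 mul1r.
Qed.

End Kummer.

(** * Cosine and sine transforms of Gaussians *)

Section GaussianTransforms.
Context {R : realType}.
Notation mu := (@lebesgue_measure R).
Implicit Types a b c s t x y X : R.

Local Opaque gamma rgamma.

Definition powgauss a c t := t `^ a * expR (- (c * t ^+ 2)).

Lemma powgauss_ge0 a c t : 0 <= powgauss a c t.
Proof. by rewrite mulr_ge0 ?powR_ge0 ?expR_ge0. Qed.

Lemma measurable_powgauss a c D : measurable_fun D (powgauss a c).
Proof.
apply: measurable_powR_expR.
by apply: measurable_funN; apply: measurable_funM => //; exact: measurable_funX.
Qed.

Definition gaussmom a c : R := 2^-1 * c `^ (- ((a + 1) / 2)) * gamma ((a + 1) / 2).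

Lemma L1_powgauss a c : -1 < a -> 0 < c ->
  mu.-integrable `]0, +oo[ (EFin \o powgauss a c).
Proof.
move=> a1 c0; apply/integrableP; split.
  by apply/measurable_EFinP; exact: measurable_powgauss.
under eq_integral do rewrite /= ger0_norm ?powgauss_ge0//.
by rewrite gaussian_moment// ltry.
Qed.

Lemma Rintegral_powgauss a c : -1 < a -> 0 < c ->
  \int[mu]_(t in `]0, +oo[) powgauss a c t = gaussmom a c.
Proof. by move=> a1 c0; rewrite /Rintegral gaussian_moment. Qed.

(** Completing the square, Xt - c t^2 <= X^2/(2c) - (c/2) t^2: half of the Gaussian absorbs the
    exponential. *)
Lemma L1_powgauss_exp a c X : -1 < a -> 0 < c ->
  mu.-integrable `]0, +oo[ (EFin \o (fun t : R => powgauss a c t * expR (X * t))).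
Proof.
move=> a1 c0.
have Ic : mu.-integrable `]0, +oo[ (EFin \o powgauss a (c / 2)).
  by apply: L1_powgauss => //; rewrite divr_gt0.
have bnd (t : R) : powgauss a c t * expR (X * t) <= expR (X ^+ 2 / (2 * c)) * powgauss a (c / 2) t.
  rewrite /powgauss [leRHS]mulrCA -[leLHS]mulrA ler_wpM2l ?powR_ge0// -!expRD ler_expR.
  have : 0 <= (X - c * t) ^+ 2 / (2 * c) by rewrite divr_ge0 ?sqr_ge0// mulr_ge0// ltW.
  have -> : (X - c * t) ^+ 2 / (2 * c) = X ^+ 2 / (2 * c) - X * t + c / 2 * t ^+ 2.
    by field; rewrite gt_eqF.
  by lra.
have mX : measurable_fun setT (fun t : R => X * t) by exact: mulrl_measurable.
apply: L1_le (L1_Zl (expR (X ^+ 2 / (2 * c))) _ Ic) => //.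
  apply: measurable_funM; first exact: measurable_powgauss.
  by apply: measurable_funTS; exact: measurableT_comp.
move=> t _; rewrite ger0_norm; first exact: bnd.
by apply: mulr_ge0; [exact: powgauss_ge0|exact: expR_ge0].
Qed.

Lemma powgaussMX a c t n : 0 < t -> powgauss a c t * t ^+ n = powgauss (a + n%:R) c t.
Proof.
move=> t0; rewrite /powgauss powRD; last by rewrite (gt_eqF t0) implybT.
by rewrite powR_mulrn ?ltW// mulrAC.
Qed.

(* The majorant $e^{Xt}$ of the partial sums makes term-by-term integration a
   case of dominated convergence. *)
Lemma cvg_gaussian_series a c X (u : R^nat) (p : nat -> nat) (F : R -> R) :
  -1 < a -> 0 < c ->
  (forall n t, 0 < t -> `|\sum_(0 <= k < n) u k * t ^+ p k| <= expR (X * t)) ->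
  (forall t, 0 < t -> series (fun k => u k * t ^+ p k) @ \oo --> F t) ->
  mu.-integrable `]0, +oo[ (EFin \o (fun t : R => powgauss a c t * F t)) /\
  series (fun k => u k * gaussmom (a + (p k)%:R) c) @ \oo -->
    \int[mu]_(t in `]0, +oo[) (powgauss a c t * F t).
Proof.
move=> a1 c0 uX uF.
pose f n t := powgauss a c t * \sum_(0 <= k < n) u k * t ^+ p k.
have mf n : measurable_fun (`]0, +oo[ : set R) (f n).
  apply: measurable_funM; first exact: measurable_powgauss.
  apply: measurable_funTS; apply: measurable_sum => k.
  by apply: measurable_funM => //; exact: measurable_funX.
have [||IF cF] := @Rintegral_dominated _ _ R mu `]0, +oo[%classic f
  (fun t => powgauss a c t * F t) _ (@measurable_itv R `]0, +oo[) mf (L1_powgauss_exp X a1 c0).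
- move=> n t /=; rewrite in_itv/= andbT => t0.
  by rewrite normrM (ger0_norm (powgauss_ge0 _ _ _)) ler_wpM2l ?powgauss_ge0// uX.
- by move=> t /=; rewrite in_itv/= andbT => t0; apply: cvgMr; exact: uF.
split => //; move: cF; apply: cvg_trans; apply: near_eq_cvg; apply: nearW => n /=.
have apk k : -1 < a + (p k)%:R by rewrite ltr_wpDr.
rewrite /series/=; elim: n => [|n ih].
  rewrite big_geq// /f; under eq_Rintegral do rewrite big_geq// mulr0.
  by rewrite Rintegral_cst// mul0r.
rewrite big_nat_recr//= -ih -Rintegral_powgauss// -RintegralZl//; last first.
  exact: L1_powgauss.
rewrite -RintegralD//.
- apply: eq_Rintegral => t /set_mem/=; rewrite in_itv/= andbT => t0.
  by rewrite /f big_nat_recr//= mulrDr -powgaussMX//; ring.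
- apply: L1_le (L1_powgauss_exp X a1 c0) => //; first exact: mf.
  move=> t /=; rewrite in_itv/= andbT => t0.
  by rewrite normrM (ger0_norm (powgauss_ge0 _ _ _)) ler_wpM2l ?powgauss_ge0// uX.
- apply: (@L1_Zl _ _ R mu _ (powgauss (a + (p n)%:R) c) (u n)) => //.
  exact: L1_powgauss.
Qed.

Lemma gamma_rising s n : 0 < s -> gamma (s + n%:R) = rising s n * gamma s.
Proof.
move=> s0; elim: n => [|n ih]; first by rewrite addr0 /rising big_ord0 mul1r.
have sn : 0 < s + n%:R by rewrite ltr_wpDr.
rewrite -natr1 addrA (gammaS sn) ih risingSr.
by move: (gamma s) => g; ring.
Qed.

Lemma gaussmomD a c n : -1 < a -> 0 < c ->
  gaussmom (a + n.*2%:R) c = gaussmom a c * rising ((a + 1) / 2) n / c ^+ n.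
Proof.
move=> a1 c0; rewrite /gaussmom.
have -> : (a + n.*2%:R + 1) / 2 = (a + 1) / 2 + n%:R.
  by rewrite -muln2 natrM; field.
have s0 : 0 < (a + 1) / 2 by lra.
rewrite gamma_rising// opprD powRD; last by rewrite (gt_eqF c0) implybT.
rewrite powR_invn ?ltW//.
by move: (gamma _) (c `^ _) (rising _ _) (c ^- n) => g r1 r2 r3; ring.
Qed.

Lemma fact_double n : n.*2`!%:R = 4 ^+ n * n`!%:R * rising 2^-1 n :> R.
Proof.
elim: n => [|n ih]; first by rewrite /rising big_ord0 !mulr1.
rewrite doubleS !factS !natrM ih risingSr exprS -[n.*2.+2%:R]natr1 -[n.*2.+1%:R]natr1.
rewrite -[n.+1%:R]natr1 -muln2 natrM.
by move: (n`!%:R) (rising _ _) => f r; field.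
Qed.

Lemma fact_doubleS n : n.*2.+1`!%:R = 4 ^+ n * n`!%:R * rising (3 / 2) n :> R.
Proof.
rewrite factS natrM fact_double -[n.*2.+1%:R]natr1 -muln2 natrM.
have h : rising 2^-1 n * (2^-1 + n%:R) = 2^-1 * rising (3 / 2) n :> R.
  by rewrite -risingSr risingS; congr (_ * rising _ _); field.
have -> : rising (3 / 2) n = 2 * (rising 2^-1 n * (2^-1 + n%:R)) :> R.
  by rewrite h mulrA mulfV ?mul1r.
by move: (n`!%:R) (rising _ _) => f r; field.
Qed.

Lemma sum_even_exp_coeff_le t n : 0 <= t ->
  \sum_(0 <= k < n) t ^+ k.*2 / k.*2`!%:R <= expR t.
Proof.
move=> t0; apply: (@le_trans _ _ (series (exp_coeff t) n.*2)).
  elim: n => [|n ih]; first by rewrite /series/= !big_geq.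
  rewrite big_nat_recr//= doubleS /series/= !big_nat_recr//= -addrA lerD//.
  by rewrite lerDl exp_coeff_ge0.
apply: nondecreasing_cvgn_le; last exact: is_cvg_series_exp_coeff.
by apply/nondecreasing_seqP => m; rewrite /series/= big_nat_recr//= lerDl exp_coeff_ge0.
Qed.

Lemma sum_odd_exp_coeff_le t n : 0 <= t ->
  \sum_(0 <= k < n) t ^+ k.*2.+1 / k.*2.+1`!%:R <= expR t.
Proof.
move=> t0; apply: (@le_trans _ _ (series (exp_coeff t) n.*2)).
  elim: n => [|n ih]; first by rewrite /series/= !big_geq.
  rewrite big_nat_recr//= doubleS /series/= !big_nat_recr//= -addrA lerD//.
  by rewrite lerDr exp_coeff_ge0.
apply: nondecreasing_cvgn_le; last exact: is_cvg_series_exp_coeff.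
by apply/nondecreasing_seqP => m; rewrite /series/= big_nat_recr//= lerDl exp_coeff_ge0.
Qed.

(** Moments raise the Pochhammer symbol of (a+1)/2, while (2k)! = 4^k k! (1/2)_k supplies the other
    parameter; this is why a Kummer series appears. *)
Lemma gaussian_cos_transform a c x : -1 < a -> 0 < c ->
  mu.-integrable `]0, +oo[ (EFin \o (fun t : R => powgauss a c t * cos (x * t))) /\
  \int[mu]_(t in `]0, +oo[) (powgauss a c t * cos (x * t)) =
  gaussmom a c * kummer ((a + 1) / 2) 2^-1 (- (x ^+ 2 / (4 * c))).
Proof.
move=> a1 c0.
pose u k : R := (-1) ^+ k * x ^+ k.*2 / k.*2`!%:R.
have ue t k : u k * t ^+ k.*2 = cos_coeff' (x * t) k.
  by rewrite /u /cos_coeff'/= exprMn mulrAC mulrA -mul2n.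
have [||I1 I2] := @cvg_gaussian_series a c `|x| u double (fun t => cos (x * t)) a1 c0.
- move=> n t t0; under eq_bigr do rewrite ue.
  rewrite (_ : `|x| * t = `|x * t|); last by rewrite normrM (gtr0_norm t0).
  apply: le_trans (sum_even_exp_coeff_le n (normr_ge0 (x * t))).
  rewrite (le_trans (ler_norm_sum _ _ _))// ler_sum// => k _.
  have -> : cos_coeff' (x * t) k = (-1) ^+ k * ((x * t) ^+ k.*2 / k.*2`!%:R).
    by rewrite mulrA.
  by rewrite normrM normrX normrN1 expr1n mul1r normrM normfV normr_nat normrX.
- move=> t t0; rewrite (_ : (fun k => _) = cos_coeff' (x * t)); first exact: cvg_cos_coeff'.
  by apply/funext => k; exact: ue.
split => //; apply: cvg_unique I2 _ => //.
have := @cvg_kummer R ((a + 1) / 2) 2^-1 (- (x ^+ 2 / (4 * c))) _.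
rewrite invr_gt0 ltr0n => /(_ isT) /(cvgMr (a := gaussmom a c)).
apply: cvg_trans; apply: near_eq_cvg; apply: nearW => n.
rewrite /series/= mulr_sumr; apply: eq_bigr => k _.
rewrite gaussmomD// /u fact_double /kummer_coeff.
rewrite (_ : (- (x ^+ 2 / (4 * c))) ^+ k = (-1) ^+ k * ((x ^+ 2) ^+ k / (4 ^+ k * c ^+ k))); last first.
  by rewrite [LHS]exprNn [(_ / _) ^+ k]expr_div_n [(4 * c) ^+ k]exprMn.
rewrite -mul2n exprM.
have f0 : k`!%:R != 0 :> R by rewrite pnatr_eq0 -lt0n fact_gt0.
have r0 : rising 2^-1 k != 0 :> R by rewrite gt_eqF// rising_gt0.
have c0' : c ^+ k != 0 by rewrite expf_neq0// gt_eqF.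
have n0 : 4 ^+ k != 0 :> R by rewrite expf_neq0.
move: f0 r0 c0' n0; move: (gaussmom a c) (rising ((a + 1) / 2) k) ((x ^+ 2) ^+ k) ((-1) ^+ k).
move: (k`!%:R) (rising 2^-1 k) (c ^+ k) (4 ^+ k) => f r d q G r' w e f0 r0 d0 q0.
by field; rewrite f0 r0 d0 q0.
Qed.

Lemma gaussian_sin_transform a c x : -1 < a -> 0 < c ->
  mu.-integrable `]0, +oo[ (EFin \o (fun t : R => powgauss a c t * sin (x * t))) /\
  \int[mu]_(t in `]0, +oo[) (powgauss a c t * sin (x * t)) =
  x * gaussmom (a + 1) c * kummer ((a + 2) / 2) (3 / 2) (- (x ^+ 2 / (4 * c))).
Proof.
move=> a1 c0.
have a1' : -1 < a + 1 by rewrite ltr_wpDr.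
pose u k : R := (-1) ^+ k * x ^+ k.*2.+1 / k.*2.+1`!%:R.
have ue t k : u k * t ^+ k.*2.+1 = sin_coeff' (x * t) k.
  by rewrite /u /sin_coeff'/= exprMn mulrAC mulrA -mul2n.
have [||I1 I2] := @cvg_gaussian_series a c `|x| u (fun k => k.*2.+1) (fun t => sin (x * t)) a1 c0.
- move=> n t t0; under eq_bigr do rewrite ue.
  rewrite (_ : `|x| * t = `|x * t|); last by rewrite normrM (gtr0_norm t0).
  apply: le_trans (sum_odd_exp_coeff_le n (normr_ge0 (x * t))).
  rewrite (le_trans (ler_norm_sum _ _ _))// ler_sum// => k _.
  have -> : sin_coeff' (x * t) k = (-1) ^+ k * ((x * t) ^+ k.*2.+1 / k.*2.+1`!%:R).
    by rewrite mulrA.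
  by rewrite normrM normrX normrN1 expr1n mul1r normrM normfV normr_nat normrX.
- move=> t t0; rewrite (_ : (fun k => _) = sin_coeff' (x * t)); first exact: cvg_sin_coeff'.
  by apply/funext => k; exact: ue.
split => //; apply: cvg_unique I2 _ => //.
have := @cvg_kummer R ((a + 2) / 2) (3 / 2) (- (x ^+ 2 / (4 * c))) _.
rewrite divr_gt0// => /(_ isT) /(cvgMr (a := x * gaussmom (a + 1) c)).
apply: cvg_trans; apply: near_eq_cvg; apply: nearW => n.
rewrite /series/= mulr_sumr; apply: eq_bigr => k _.
have -> : a + k.*2.+1%:R = a + 1 + k.*2%:R by rewrite -natr1; ring.
rewrite gaussmomD// (_ : (a + 1 + 1) / 2 = (a + 2) / 2); last by field.
rewrite /u fact_doubleS /kummer_coeff [x ^+ k.*2.+1]exprS.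
rewrite (_ : (- (x ^+ 2 / (4 * c))) ^+ k = (-1) ^+ k * ((x ^+ 2) ^+ k / (4 ^+ k * c ^+ k))); last first.
  by rewrite [LHS]exprNn [(_ / _) ^+ k]expr_div_n [(4 * c) ^+ k]exprMn.
rewrite -mul2n exprM.
have f0 : k`!%:R != 0 :> R by rewrite pnatr_eq0 -lt0n fact_gt0.
have r0 : rising (3 / 2) k != 0 :> R by rewrite gt_eqF// rising_gt0// divr_gt0.
have c0' : c ^+ k != 0 by rewrite expf_neq0// gt_eqF.
have n0 : 4 ^+ k != 0 :> R by rewrite expf_neq0.
move: f0 r0 c0' n0; move: (gaussmom (a + 1) c) (rising ((a + 2) / 2) k) ((x ^+ 2) ^+ k) ((-1) ^+ k).
move: (k`!%:R) (rising (3 / 2) k) (c ^+ k) (4 ^+ k) => f r d q G r' w e f0 r0 d0 q0.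
by field; rewrite f0 r0 d0 q0.
Qed.

Lemma powRE x a : 0 < x -> x `^ a = expR (a * ln x).
Proof. by move=> x0; rewrite /powR gt_eqF. Qed.

(** The right side is y^a/pi times the integral over t > 0 of t^a exp(- y t^2/2) cos(xt - pi a/2).
    The reflection formula turns 1/Gamma((1-a)/2) and 1/Gamma(-a/2) into cos(pi a/2)
    Gamma((a+1)/2)/pi and - sin(pi a/2) Gamma((a+2)/2)/pi, and Kummer's transformation gives the
    series of D_a. *)
Lemma heat_kernel_pcH a x y : -1 < a -> 0 < y ->
  heat_kernel y x * pcH a x y = y `^ a * (pi^-1 *
   (cos (pi * a / 2) * \int[mu]_(t in `]0, +oo[) (powgauss a (y / 2) t * cos (x * t)) +
    sin (pi * a / 2) * \int[mu]_(t in `]0, +oo[) (powgauss a (y / 2) t * sin (x * t)))).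
Proof.
move=> a1 y0; have y20 : 0 < y / 2 by rewrite divr_gt0.
rewrite (gaussian_cos_transform x a1 y20).2 (gaussian_sin_transform x a1 y20).2.
rewrite /heat_kernel /pcH /parabolic_cylinder.
have sy2 : (x / Num.sqrt y) ^+ 2 = x ^+ 2 / y.
  by rewrite expr_div_n sqr_sqrtr// ltW.
rewrite !sy2.
pose z := x ^+ 2 / (2 * y).
have y0' : y != 0 by rewrite gt_eqF.
have -> : x ^+ 2 / (4 * (y / 2)) = z by rewrite /z; field.
have -> : x ^+ 2 / y / 2 = z by rewrite /z; field.
have -> : x ^+ 2 / y / 4 = x ^+ 2 / (4 * y) by field.
rewrite -/z.
have h2 : 0 < 2^-1 :> R by rewrite invr_gt0.
have h3 : 0 < 3 / 2 :> R by rewrite divr_gt0.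
rewrite (@kummer_transformation _ ((a + 1) / 2) 2^-1 z h2).
rewrite (@kummer_transformation _ ((a + 2) / 2) (3 / 2) z h3).
rewrite (_ : 2^-1 - (a + 1) / 2 = - (a / 2)); last by field.
rewrite (_ : 3 / 2 - (a + 2) / 2 = (1 - a) / 2); last by field.
rewrite (_ : rgamma ((1 - a) / 2) = cos (pi * a / 2) * gamma ((a + 1) / 2) / pi); last first.
  have -> : (1 - a) / 2 = 1 - (a + 1) / 2 by field.
  rewrite rgamma_reflection; last by lra.
  by congr (_ * _ / _); rewrite -sinDpihalf; congr sin; field.
rewrite (_ : rgamma (- (a / 2)) = - sin (pi * a / 2) * gamma ((a + 1 + 1) / 2) / pi); last first.
  have -> : - (a / 2) = 1 - (a + 1 + 1) / 2 by field.
  rewrite rgamma_reflection; last by lra.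
  by congr (_ * _ / _); rewrite -sinDpi; congr sin; field.
rewrite /gaussmom.
have p0 : 0 < pi :> R by exact: pi_gt0.
move: (kummer (- (a / 2)) 2^-1 z) (kummer ((1 - a) / 2) (3 / 2) z).
move: (gamma ((a + 1) / 2)) (gamma ((a + 1 + 1) / 2)) (cos _) (sin _).
move=> G1 G2 C S M1 M2.
have e4 : expR (x ^+ 2 / (4 * y)) * expR (- (x ^+ 2 / (4 * y))) = 1.
  by rewrite -expRD subrr expR0.
(* What remains is to match the constants of the even and of the odd part; in [k1] and [k2] this is
   done by comparing logarithms. *)
have k1 : (2 * pi * y) `^ (- 2^-1) * y `^ (a / 2) * (Num.sqrt pi * 2 `^ (a / 2)) =
   y `^ a * (2^-1 * (y / 2) `^ (- ((a + 1) / 2))).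
  rewrite -[Num.sqrt pi]powR12_sqrt ?pi_ge0// !powRE ?mulr_gt0//.
  rewrite !lnM ?posrE ?mulr_gt0// lnV ?posrE//.
  have -> : 2^-1 * expR (- ((a + 1) / 2) * (ln y + - ln 2)) =
     expR (- ln 2 - ((a + 1) / 2) * (ln y + - ln 2)) :> R.
    by rewrite expRD -lnV ?posrE// lnK ?posrE// mulNr.
  by rewrite -!expRD; congr expR; field.
have k2 : (2 * pi * y) `^ (- 2^-1) * y `^ (a / 2) * (Num.sqrt pi * 2 `^ (a / 2)) *
   (Num.sqrt 2 / Num.sqrt y) = y `^ a * (2^-1 * (y / 2) `^ (- ((a + 1 + 1) / 2))).
  rewrite -[Num.sqrt pi]powR12_sqrt ?pi_ge0// -[Num.sqrt 2]powR12_sqrt//.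
  rewrite -[Num.sqrt y]powR12_sqrt ?ltW// -powRN !powRE ?mulr_gt0//.
  rewrite !lnM ?posrE ?mulr_gt0// lnV ?posrE//.
  have -> : 2^-1 * expR (- ((a + 1 + 1) / 2) * (ln y + - ln 2)) =
     expR (- ln 2 - ((a + 1 + 1) / 2) * (ln y + - ln 2)) :> R.
    by rewrite expRD -lnV ?posrE// lnK ?posrE// mulNr.
  by rewrite -!expRD; congr expR; field.
move: k1 k2.
move: ((2 * pi * y) `^ (- 2^-1)) (y `^ (a / 2)) (Num.sqrt pi) (2 `^ (a / 2)) => A1 A2 A3 A4.
move: ((y / 2) `^ (- ((a + 1) / 2))) ((y / 2) `^ (- ((a + 1 + 1) / 2))) (y `^ a) => B1 B2 Y.
move: e4; move: (expR (x ^+ 2 / _)) (expR (- (x ^+ 2 / _))) (expR (- z)) => E1 E2 E3 e4 k1 k2.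
move: k2; move: (Num.sqrt 2) ((Num.sqrt y)^-1) (pi^-1) => Q Y' P k2.
transitivity ((A1 * A2 * (A3 * A4)) * (E1 * E2) * E3 * (C * G1 * P * M1) +
  (A1 * A2 * (A3 * A4) * (Q * Y')) * (E1 * E2) * E3 * (x * S * G2 * P * M2)); first by ring.
by rewrite k2 k1 e4; ring.
Qed.

End GaussianTransforms.

(** * The Hartley transform and the heat kernel *)

Section Gaussians.
Context {R : realType}.
Notation mu := (@lebesgue_measure R).
Implicit Types b c e t x y : R.

Local Opaque gamma rgamma.

Definition gauss y x := expR (- (y / 2 * x ^+ 2)).

Lemma gauss_gt0 y x : 0 < gauss y x. Proof. exact: expR_gt0. Qed.

Lemma gauss_ge0 y x : 0 <= gauss y x. Proof. exact: expR_ge0. Qed.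

Lemma gauss_le1 y x : 0 < y -> gauss y x <= 1.
Proof.
by move=> y0; rewrite -expR0 ler_expR oppr_le0 mulr_ge0 ?sqr_ge0// divr_ge0// ltW.
Qed.

Lemma gaussN y x : gauss y (- x) = gauss y x.
Proof. by rewrite /gauss sqrrN. Qed.

Lemma measurable_gauss y D : measurable_fun D (gauss y).
Proof.
apply: measurable_funTS; apply: measurableT_comp => //.
by apply: measurable_funN; apply: measurable_funM => //; exact: measurable_funX.
Qed.

Lemma gauss_powgauss y x : gauss y x = powgauss 0 (y / 2) x.
Proof. by rewrite /powgauss powRr0 mul1r. Qed.

Lemma heat_kernel_gt0 y x : 0 < y -> 0 < heat_kernel y x.
Proof. by move=> y0; rewrite mulr_gt0 ?expR_gt0// powR_gt0// !mulr_gt0// pi_gt0. Qed.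

Lemma heat_kernel_ge0 y x : 0 <= heat_kernel y x.
Proof. by rewrite mulr_ge0 ?expR_ge0// powR_ge0. Qed.

Lemma heat_kernelN y x : heat_kernel y (- x) = heat_kernel y x.
Proof. by rewrite /heat_kernel sqrrN. Qed.

Lemma heat_kernelE y x : heat_kernel y x = (2 * pi * y) `^ (- 2^-1) * gauss y^-1 x.
Proof. by rewrite /heat_kernel /gauss invfM; congr (_ * expR (- _)); ring. Qed.

Lemma heat_kernel_le y x : 0 < y -> heat_kernel y x <= (2 * pi * y) `^ (- 2^-1).
Proof.
by move=> y0; rewrite heat_kernelE ler_piMr ?powR_ge0// gauss_le1// invr_gt0.
Qed.

Lemma measurable_heat_kernel y D : measurable_fun D (heat_kernel y).
Proof.
rewrite (_ : heat_kernel y = fun x => (2 * pi * y) `^ (- 2^-1) * gauss y^-1 x); last first.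
  by apply/funext => x; exact: heat_kernelE.
by apply: measurable_funM => //; exact: measurable_gauss.
Qed.

Lemma heat_kernel_normal_pdf y b x : 0 < y ->
  heat_kernel y (x - b) = normal_pdf b (Num.sqrt y) x.
Proof.
move=> y0; rewrite normal_pdfE ?gt_eqF ?sqrtr_gt0// /normal_peak /normal_fun /heat_kernel.
rewrite sqr_sqrtr ?ltW//; congr (_ * expR _); last first.
  by rewrite -mulNr -[y *+ 2]mulr_natl.
rewrite [LHS]powRN powR12_sqrt; last by rewrite !mulr_ge0 ?pi_ge0 ?ltW.
by rewrite -[y * pi *+ 2]mulr_natl -mulrA [pi * y]mulrC.
Qed.

Lemma heat_kernel_L1 y b : 0 < y ->
  mu.-integrable setT (EFin \o (fun x : R => heat_kernel y (x - b))) /\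
  \int[mu]_x heat_kernel y (x - b) = 1.
Proof.
move=> y0; have s0 : Num.sqrt y != 0 by rewrite gt_eqF ?sqrtr_gt0.
rewrite (_ : (fun x => _) = normal_pdf b (Num.sqrt y)); last first.
  by apply/funext => x; exact: heat_kernel_normal_pdf.
split; first exact: integrable_normal_pdf.
by rewrite /Rintegral integral_normal_pdf.
Qed.

Lemma measurable_cos : measurable_fun setT (@cos R).
Proof. by apply: continuous_measurable_fun; exact: continuous_cos. Qed.

Lemma measurable_sin : measurable_fun setT (@sin R).
Proof. by apply: continuous_measurable_fun; exact: continuous_sin. Qed.

Lemma measurable_cos_linear b D : measurable_fun D (fun x : R => cos (b * x)).
Proof.
apply: measurable_funTS; apply: measurableT_comp; first exact: measurable_cos.
exact: mulrl_measurable.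
Qed.

Lemma measurable_sin_linear b D : measurable_fun D (fun x : R => sin (b * x)).
Proof.
apply: measurable_funTS; apply: measurableT_comp; first exact: measurable_sin.
exact: mulrl_measurable.
Qed.

(** For exponent 0 both parameters of the Kummer series equal 1/2, and the series is the
    exponential. *)
Lemma gauss_cos y b : 0 < y ->
  mu.-integrable setT (EFin \o (fun x : R => gauss y x * cos (b * x))) /\
  \int[mu]_x (gauss y x * cos (b * x)) = 2 * pi * heat_kernel y b.
Proof.
move=> y0; have y2 : 0 < y / 2 by rewrite divr_gt0.
have [] := @gaussian_cos_transform R 0 (y / 2) b _ y2; first by rewrite ltrN10.
rewrite (_ : (fun t => powgauss 0 (y / 2) t * _) = (fun x => gauss y x * cos (b * x))); last first.
  by apply/funext => t; rewrite gauss_powgauss.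
move=> I E.
have [||] := @L1_fold R (fun x => gauss y x * cos (b * x)) _ I.
- apply: measurable_funM; first exact: measurable_gauss.
  exact: measurable_cos_linear.
- by apply: eq_integrable I => // x _ /=; rewrite gaussN mulrN cosN.
move=> IT ->; split => //.
under eq_Rintegral do rewrite gaussN mulrN cosN -mulr2n -mulr_natl.
rewrite RintegralZl// E /gaussmom add0r mul1r gamma_half kummer_id ?invr_gt0//.
have -> : b ^+ 2 / (4 * (y / 2)) = b ^+ 2 / (2 * y) by field; rewrite gt_eqF.
rewrite /heat_kernel [RHS]mulrA !mulrA; congr (_ * _).
rewrite mulfV// mul1r -powR12_sqrt ?pi_ge0// !powRE ?mulr_gt0 ?pi_gt0//.
rewrite !lnM ?posrE ?mulr_gt0 ?pi_gt0// lnV ?posrE//.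
have -> : 2 * pi = expR (ln 2 + ln pi) :> R by rewrite expRD !lnK ?posrE ?pi_gt0.
by rewrite -!expRD; congr expR; move: (ln pi) => p; field.
Qed.

Lemma gauss_sin y b : 0 < y ->
  mu.-integrable setT (EFin \o (fun x : R => gauss y x * sin (b * x))) /\
  \int[mu]_x (gauss y x * sin (b * x)) = 0.
Proof.
move=> y0; have y2 : 0 < y / 2 by rewrite divr_gt0.
have [] := @gaussian_sin_transform R 0 (y / 2) b _ y2; first by rewrite ltrN10.
rewrite (_ : (fun t => powgauss 0 (y / 2) t * _) = (fun x => gauss y x * sin (b * x))); last first.
  by apply/funext => t; rewrite gauss_powgauss.
move=> I _.
have [||] := @L1_fold R (fun x => gauss y x * sin (b * x)) _ I.
- apply: measurable_funM; first exact: measurable_gauss.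
  exact: measurable_sin_linear.
- apply: eq_integrable (L1_Zl (-1) _ I) => // x _ /=.
  by rewrite gaussN mulrN sinN mulrN mulN1r.
move=> IT ->; split => //.
under eq_Rintegral do rewrite gaussN mulrN sinN mulrN subrr.
by rewrite Rintegral_cst// mul0r.
Qed.

Lemma gauss_L1 y : 0 < y -> mu.-integrable setT (EFin \o gauss y).
Proof.
move=> y0; have [+ _] := @gauss_cos y 0 y0.
rewrite (_ : (fun x => _) = gauss y)//.
by apply/funext => x; rewrite mul0r cos0 mulr1.
Qed.

Definition cas t := cos t + sin t.

Lemma cas0 : cas 0 = 1. Proof. by rewrite /cas cos0 sin0 addr0. Qed.

Lemma cas_le2 t : `|cas t| <= 2.
Proof.
rewrite (le_trans (ler_normD _ _))// -[leRHS]/(1 + 1) lerD// ler_norml.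
  by rewrite cos_geN1 cos_le1.
by rewrite sin_geN1 sin_le1.
Qed.

Lemma measurable_cas d (T : measurableType d) (D : set T) (f : T -> R) :
  measurable_fun D f -> measurable_fun D (fun z => cas (f z)).
Proof.
move=> mf; apply: measurable_funD; apply: measurableT_comp => //.
  exact: measurable_cos.
exact: measurable_sin.
Qed.

Lemma measurable_cas_linear b D : measurable_fun D (fun x : R => cas (b * x)).
Proof. by apply: measurable_cas; apply: measurable_funTS; exact: mulrl_measurable. Qed.

Lemma measurable_casT : measurable_fun setT cas.
Proof. exact: measurable_cas. Qed.

Lemma casM s t : cas s * cas t = cos (s - t) + sin (s + t).
Proof. by rewrite /cas cosB sinD; ring. Qed.

(** By [casM] the product of kernels is cos of the difference plus sin of the sum; the sine is odd
    and integrates to 0 against the Gaussian, so only a translated heat kernel survives. *)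
Lemma gauss_cas y s t : 0 < y ->
  mu.-integrable setT (EFin \o (fun x : R => cas (x * s) * cas (x * t) * gauss y x)) /\
  \int[mu]_x (cas (x * s) * cas (x * t) * gauss y x) = 2 * pi * heat_kernel y (s - t).
Proof.
move=> y0.
have [I1 E1] := @gauss_cos y (s - t) y0; have [I2 E2] := @gauss_sin y (s + t) y0.
have e (x : R) : cas (x * s) * cas (x * t) * gauss y x =
    gauss y x * cos ((s - t) * x) + gauss y x * sin ((s + t) * x).
  by rewrite casM -mulrBr -mulrDr mulrC [x * (s - t)]mulrC [x * (s + t)]mulrC mulrDr.
split; first by apply: eq_integrable (L1_D _ I1 I2) => // x _ /=; rewrite e.
under eq_Rintegral do rewrite e.
by rewrite RintegralD// E1 E2 addr0.
Qed.

End Gaussians.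

(** For a convolution kernel no majorant of product form is at hand, but the norm of each section in
    the first variable is known exactly and is integrable in the second. *)
Lemma Rintegral_Fubini21 d1 d2 (T1 : measurableType d1) (T2 : measurableType d2)
    (R : realType) (m1 : {sigma_finite_measure set T1 -> \bar R})
    (m2 : {sigma_finite_measure set T2 -> \bar R})
    (F : T1 * T2 -> R) (G : T2 -> R) :
  measurable_fun setT F ->
  (forall x, m2.-integrable setT (EFin \o (fun y => F (x, y)))) ->
  (forall y, m1.-integrable setT (EFin \o (fun x => F (x, y)))) ->
  (forall y, \int[m1]_x `|F (x, y)| = G y) ->
  m2.-integrable setT (EFin \o G) ->
  m1.-integrable setT (EFin \o (fun x => \int[m2]_y F (x, y))) /\
  \int[m1]_x \int[m2]_y F (x, y) = \int[m2]_y \int[m1]_x F (x, y).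
Proof.
move=> mF Ix Iy EG IG.
have IF : (m1 \x m2)%E.-integrable setT (EFin \o F).
  apply/integrable21ltyP; first exact/measurable_EFinP.
  have /integrableP[_] := IG; apply: le_lt_trans.
  apply: ge0_le_integral => //=.
  - by move=> y _; exact: integral_ge0.
  - apply: (@measurable_fun_fubini_tonelli_G _ _ _ _ _ m1 (fun z => `|F z|%:E)) => //.
    by apply/measurable_EFinP; exact: measurableT_comp.
  - by have /integrable_norm/measurable_int := IG.
  - move=> y _; rewrite -[leLHS]fineK.
      by rewrite lee_fin -EG /Rintegral ler_norm.
    exact: integrable_fin_num (integrable_norm (Iy y)).
have eF x : fubini_F m2 (EFin \o F) x = (\int[m2]_y F (x, y))%:E.
  by rewrite /fubini_F fineK//; exact: (integrable_fin_num _ (Ix x)).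
have eG y : fubini_G m1 (EFin \o F) y = (\int[m1]_x F (x, y))%:E.
  by rewrite /fubini_G fineK//; exact: (integrable_fin_num _ (Iy y)).
split.
  by apply: eq_integrable (integrable_fubini_F IF) => // x _; rewrite eF.
rewrite /Rintegral; congr fine; transitivity (\int[m1]_x \int[m2]_y (F (x, y))%:E)%E.
  by apply: eq_integral => x _; rewrite -eF.
by rewrite (Fubini IF); apply: eq_integral => y _; rewrite -eG.
Qed.

(** * Gaussian regularisation of Hartley inversion, and Plancherel's inequality *)

Section Hartley.
Context {R : realType}.
Notation mu := (@lebesgue_measure R).
Implicit Types (m u f : R -> R) (e x xi eta : R).

Definition hartley m (x : R) : R := \int[mu]_t (cas (x * t) * m t).

Definition heat_conv e m (x : R) : R := \int[mu]_t (heat_kernel e (x - t) * m t).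

Lemma Rintegral_FubiniR (F : R * R -> R) (f g : R -> R) : measurable_fun setT F ->
  mu.-integrable setT (EFin \o f) -> mu.-integrable setT (EFin \o g) ->
  (forall x y, `|F (x, y)| <= f x * g y) ->
  [/\ mu.-integrable setT (EFin \o (fun x : R => \int[mu]_y F (x, y))),
      mu.-integrable setT (EFin \o (fun y : R => \int[mu]_x F (x, y))) &
      \int[mu]_x \int[mu]_y F (x, y) = \int[mu]_y \int[mu]_x F (x, y)].
Proof.
by move=> mF If Ig Ffg; have := @Rintegral_Fubini _ _ _ _ R mu mu F f g mF If Ig Ffg.
Qed.

Lemma L1_cas m x : mu.-integrable setT (EFin \o m) ->
  mu.-integrable setT (EFin \o (fun t : R => cas (x * t) * m t)).
Proof.
move=> Im; apply: (L1_mulM (M := 2)) => // [|t _]; last exact: cas_le2.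
exact: measurable_cas_linear.
Qed.

Lemma measurable_heat_kernel_sub e (x : R) : measurable_fun setT (fun t : R => heat_kernel e (x - t)).
Proof.
apply: measurableT_comp; first exact: measurable_heat_kernel.
exact: measurable_funB.
Qed.

Lemma heat_conv_integrand_L1 e m x : 0 < e -> mu.-integrable setT (EFin \o m) ->
  mu.-integrable setT (EFin \o (fun t : R => heat_kernel e (x - t) * m t)).
Proof.
move=> e0 Im; apply: (L1_mulM (M := (2 * pi * e) `^ (- 2^-1))) => //.
  exact: measurable_heat_kernel_sub.
by move=> t _; rewrite ger0_norm ?heat_kernel_ge0 ?heat_kernel_le.
Qed.

(** A regularised inversion formula: the damped transform, transformed once more, is 2 pi times the
    heat flow of [m] at time e. The Gaussian factor makes Fubini's theorem applicable, and the inner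
    integral is [gauss_cas]. *)
Lemma hartley_gauss e m : 0 < e -> mu.-integrable setT (EFin \o m) ->
  mu.-integrable setT (EFin \o (fun x : R => hartley m x * gauss e x)) /\
  forall xi, hartley (fun x => hartley m x * gauss e x) xi = 2 * pi * heat_conv e m xi.
Proof.
move=> e0 Im.
have mm := L1_measurable Im.
have IG := gauss_L1 e0.
have I2m : mu.-integrable setT (EFin \o (fun t : R => 4 * `|m t|)).
  by apply: (L1_Zl 4) => //; exact: integrable_norm.
pose F xi (z : R * R) := cas (xi * z.1) * gauss e z.1 * (cas (z.1 * z.2) * m z.2).
have mF xi : measurable_fun setT (F xi).
  apply: measurable_funM; apply: measurable_funM.
  - by apply: measurable_cas; apply: measurable_funM.
  - by apply: measurableT_comp; [exact: measurable_gauss|].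
  - by apply: measurable_cas; exact: measurable_funM.
  - exact: measurableT_comp.
have FG xi x t : `|F xi (x, t)| <= gauss e x * (4 * `|m t|).
  rewrite /F/= !normrM (gtr0_norm (gauss_gt0 _ _)).
  have := cas_le2 (xi * x); have := cas_le2 (x * t).
  have := normr_ge0 (cas (xi * x)); have := normr_ge0 (cas (x * t)).
  have := normr_ge0 (m t); have := gauss_ge0 e x.
  move: `|cas (xi * x)| `|cas (x * t)| `|m t| (gauss _ _) => q r s w w0 s0 r0 q0 r2 q2.
  have -> : q * w * (r * s) = (q * r) * (w * s) by ring.
  have -> : w * (4 * s) = 2 * 2 * (w * s) by ring.
  by rewrite ler_wpM2r ?mulr_ge0// ler_pM.
have E xi x : \int[mu]_t F xi (x, t) = cas (xi * x) * (hartley m x * gauss e x).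
  by rewrite /F/= RintegralZl//; [rewrite -mulrA [gauss _ _ * _]mulrC|exact: L1_cas].
split.
  (* Since cas(0) = 1, the case xi = 0 is the integrability of the damped transform. *)
  have [+ _ _] := Rintegral_FubiniR (mF 0) IG I2m (FG 0).
  by apply: eq_integrable => // x _ /=; rewrite E mul0r cas0 mul1r.
move=> xi; have [_ _] := Rintegral_FubiniR (mF xi) IG I2m (FG xi).
under eq_Rintegral do rewrite E.
move=> h; transitivity (\int[mu]_y \int[mu]_x F xi (x, y)); first exact: h.
rewrite /heat_conv -RintegralZl//; last exact: heat_conv_integrand_L1.
apply: eq_Rintegral => t _ /=; have [I E'] := @gauss_cas R e xi t e0.
rewrite mulrA -E' -RintegralZr//; apply: eq_Rintegral => x _ /=.
by rewrite /F/= [xi * x]mulrC; ring.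
Qed.

(** The kernel is a parameter because [cas], cos and sin all occur later; 2 bounds all three. *)
Definition trig_transform (c : R -> R) m (x : R) : R := \int[mu]_t (c (x * t) * m t).

Lemma trig_integrand_L1 (c : R -> R) m x : measurable_fun setT c -> (forall t, `|c t| <= 2) ->
  mu.-integrable setT (EFin \o m) ->
  mu.-integrable setT (EFin \o (fun t : R => c (x * t) * m t)).
Proof.
move=> mc c2 Im; have mcx : measurable_fun setT (fun t : R => c (x * t)).
  by apply: measurableT_comp => //; exact: mulrl_measurable.
exact: (L1_mulM (M := 2)).
Qed.

Lemma trig_transform_sym (c : R -> R) f m : measurable_fun setT c -> (forall t, `|c t| <= 2) ->
  mu.-integrable setT (EFin \o f) -> mu.-integrable setT (EFin \o m) ->
  mu.-integrable setT (EFin \o (fun x : R => f x * trig_transform c m x)) /\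
  \int[mu]_x (f x * trig_transform c m x) = \int[mu]_x (m x * trig_transform c f x).
Proof.
move=> mc c2 If Im.
have mf := L1_measurable If; have mm := L1_measurable Im.
have I2 : mu.-integrable setT (EFin \o (fun t : R => 2 * `|m t|)).
  by apply: (L1_Zl 2) => //; exact: integrable_norm.
pose F (z : R * R) := f z.1 * (c (z.1 * z.2) * m z.2).
have mF : measurable_fun setT F.
  apply: measurable_funM; first exact: measurableT_comp.
  apply: measurable_funM; last exact: measurableT_comp.
  by apply: measurableT_comp => //; exact: measurable_funM.
have FG x t : `|F (x, t)| <= `|f x| * (2 * `|m t|).
  by rewrite /F/= !normrM ler_wpM2l// ler_wpM2r// c2.
have E x : \int[mu]_t F (x, t) = f x * trig_transform c m x.
  by rewrite /F/= RintegralZl//; exact: trig_integrand_L1.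
have E' t : \int[mu]_x F (x, t) = m t * trig_transform c f t.
  rewrite /trig_transform -RintegralZl//; last exact: trig_integrand_L1.
  by apply: eq_Rintegral => x _; rewrite /F/= [t * x]mulrC; ring.
have [I1 _] := Rintegral_FubiniR mF (integrable_norm If) I2 FG.
under eq_Rintegral do rewrite E; under [in RHS]eq_Rintegral do rewrite E'.
by split => //; apply: eq_integrable I1 => // x _ /=; rewrite E.
Qed.

(** Fubini's theorem makes the product with a Gaussian integrable, hence measurable, and a Gaussian
    can be divided out as it never vanishes. *)
Lemma measurable_trig_transform (c : R -> R) m : measurable_fun setT c -> (forall t, `|c t| <= 2) ->
  mu.-integrable setT (EFin \o m) -> measurable_fun setT (trig_transform c m).
Proof.
move=> mc c2 Im.
have /L1_measurable mg := (trig_transform_sym mc c2 (gauss_L1 ltr01) Im).1.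
rewrite (_ : trig_transform c m = fun x => gauss 1 x * trig_transform c m x * expR (1 / 2 * x ^+ 2)); last first.
  by apply/funext => x; rewrite mulrAC -expRD addNr expR0 mul1r.
apply: measurable_funM => //; apply: measurableT_comp => //.
by apply: measurable_funM => //; exact: measurable_funX.
Qed.

Lemma hartley_sym f m : mu.-integrable setT (EFin \o f) -> mu.-integrable setT (EFin \o m) ->
  mu.-integrable setT (EFin \o (fun x : R => f x * hartley m x)) /\
  \int[mu]_x (f x * hartley m x) = \int[mu]_x (m x * hartley f x).
Proof. by apply: trig_transform_sym; [exact: measurable_casT|exact: cas_le2]. Qed.

Lemma heat_kernel_sub_L1 e (x : R) : 0 < e ->
  mu.-integrable setT (EFin \o (fun t : R => heat_kernel e (x - t))) /\
  \int[mu]_t heat_kernel e (x - t) = 1.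
Proof.
move=> e0; rewrite (_ : (fun t => _) = (fun t => heat_kernel e (t - x))).
  exact: heat_kernel_L1.
by apply/funext => t; rewrite -heat_kernelN opprB.
Qed.

Lemma heat_conv_L1 e m : 0 < e -> mu.-integrable setT (EFin \o m) ->
  mu.-integrable setT (EFin \o heat_conv e m) /\
  \int[mu]_x heat_conv e m x = \int[mu]_x m x.
Proof.
move=> e0 Im; have mm := L1_measurable Im.
pose F (z : R * R) := heat_kernel e (z.1 - z.2) * m z.2.
have mF : measurable_fun setT F.
  apply: measurable_funM; last exact: measurableT_comp.
  apply: measurableT_comp; first exact: measurable_heat_kernel.
  exact: measurable_funB.
have [||||I1 ->] := @Rintegral_Fubini21 _ _ _ _ R mu mu F (fun t => `|m t|) mF.
- by move=> x; exact: heat_conv_integrand_L1.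
- move=> t; rewrite /F/=; apply: eq_integrable (L1_Zl (m t) _ (heat_kernel_L1 t e0).1) => //.
  by move=> x _ /=; rewrite mulrC.
- move=> t; rewrite /F/=; under eq_Rintegral do rewrite normrM (ger0_norm (heat_kernel_ge0 _ _)).
  by rewrite RintegralZr ?(heat_kernel_L1 t e0).2 ?mul1r//; exact: (heat_kernel_L1 t e0).1.
- exact: integrable_norm.
split => //; apply: eq_Rintegral => t _; rewrite /F/=.
by rewrite RintegralZr ?(heat_kernel_L1 t e0).2 ?mul1r//; exact: (heat_kernel_L1 t e0).1.
Qed.

(** Jensen's inequality for the probability density t -> w_e(x - t): expand the variance, the
    integral of the density times (m(t) - a)^2 with a the mean, which is nonnegative. *)
Lemma heat_conv_sqr_le e m x : 0 < e -> mu.-integrable setT (EFin \o m) ->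
  mu.-integrable setT (EFin \o (fun x : R => m x ^+ 2)) ->
  heat_conv e m x ^+ 2 <= heat_conv e (fun t => m t ^+ 2) x.
Proof.
move=> e0 Im Im2; set a := heat_conv e m x.
have [Ik Ek] := heat_kernel_sub_L1 x e0.
have I1 := heat_conv_integrand_L1 x e0 Im; have I2 := heat_conv_integrand_L1 x e0 Im2.
have : 0 <= \int[mu]_t (heat_kernel e (x - t) * (m t - a) ^+ 2).
  by apply: Rintegral_ge0 => // t _; rewrite mulr_ge0 ?heat_kernel_ge0 ?sqr_ge0.
rewrite (_ : \int[mu]_t _ = \int[mu]_t (heat_kernel e (x - t) * m t ^+ 2 +
  (- (2 * a) * (heat_kernel e (x - t) * m t) + a ^+ 2 * heat_kernel e (x - t)))); last first.
  by apply: eq_Rintegral => t _; ring.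
have J1 := L1_Zl (- (2 * a)) measurableT I1; have J2 := L1_Zl (a ^+ 2) measurableT Ik.
rewrite RintegralD//; last exact: L1_D.
rewrite RintegralD// (RintegralZl _ measurableT I1) (RintegralZl _ measurableT Ik) Ek mulr1.
rewrite -/(heat_conv e m x) -/a -/(heat_conv e (fun t => m t ^+ 2) x).
by move: (heat_conv _ _ _) => b; nra.
Qed.

Lemma heat_conv_L2 e m : 0 < e -> mu.-integrable setT (EFin \o m) ->
  mu.-integrable setT (EFin \o (fun x : R => m x ^+ 2)) ->
  mu.-integrable setT (EFin \o (fun x : R => heat_conv e m x ^+ 2)) /\
  \int[mu]_x (heat_conv e m x ^+ 2) <= \int[mu]_x (m x ^+ 2).
Proof.
move=> e0 Im Im2.
have [I1 _] := heat_conv_L1 e0 Im; have [I2 E2] := heat_conv_L1 e0 Im2.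
have I : mu.-integrable setT (EFin \o (fun x : R => heat_conv e m x ^+ 2)).
  apply: L1_le I2 => //; first by apply: measurable_funX; exact: L1_measurable I1.
  by move=> x _; rewrite ger0_norm ?sqr_ge0// heat_conv_sqr_le.
by split => //; rewrite -E2 le_Rintegral// => x _; exact: heat_conv_sqr_le.
Qed.

Lemma normrM_le_sqr (p q : R) : `|p * q| <= p ^+ 2 + q ^+ 2.
Proof.
have := sqr_ge0 (`|p| - `|q|); have := mulr_ge0 (normr_ge0 p) (normr_ge0 q).
by rewrite sqrrB !real_normK ?num_real// normrM; lra.
Qed.

Lemma mulr2_le_sqr (p q : R) : 2 * (p * q) <= p ^+ 2 + q ^+ 2.
Proof. by have := sqr_ge0 (p - q); rewrite sqrrB; lra. Qed.

(** By symmetry of the kernel the left side equals 2 pi times the pairing of [m] with its heat flow,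
    and 2pq <= p^2 + q^2 together with the contraction [heat_conv_L2] bounds this pairing. *)
Lemma hartley_gauss_sqr e m : 0 < e -> mu.-integrable setT (EFin \o m) ->
  mu.-integrable setT (EFin \o (fun x : R => m x ^+ 2)) ->
  mu.-integrable setT (EFin \o (fun x : R => hartley m x ^+ 2 * gauss e x)) /\
  \int[mu]_x (hartley m x ^+ 2 * gauss e x) <= 2 * pi * \int[mu]_x (m x ^+ 2).
Proof.
move=> e0 Im Im2.
have [Iu Hu] := hartley_gauss e0 Im; have [I E] := hartley_sym Iu Im.
have eu (x : R) : hartley m x ^+ 2 * gauss e x = hartley m x * gauss e x * hartley m x.
  by rewrite mulrAC.
split; first by apply: eq_integrable I => // x _ /=; rewrite eu.
under eq_Rintegral do rewrite eu.
have [IC LC] := heat_conv_L2 e0 Im Im2.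
rewrite E; under eq_Rintegral do rewrite Hu mulrCA.
have IS := L1_D measurableT Im2 IC.
have Imc : mu.-integrable setT (EFin \o (fun x : R => m x * heat_conv e m x)).
  apply: L1_le IS => //.
    apply: measurable_funM; first exact: L1_measurable Im.
    exact: L1_measurable (heat_conv_L1 e0 Im).1.
  by move=> x _; exact: normrM_le_sqr.
rewrite (RintegralZl _ measurableT Imc) ler_wpM2l ?mulr_ge0 ?pi_ge0//.
have h1 := RintegralZl 2 measurableT Imc; have h2 := RintegralD measurableT Im2 IC.
rewrite -(ler_pM2l (ltr0Sn R 1)) -h1.
apply: (@le_trans _ _ (\int[mu]_x (m x ^+ 2 + heat_conv e m x ^+ 2))).
  apply: le_Rintegral => //; first exact: L1_Zl.
  by move=> x _; exact: mulr2_le_sqr.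
by rewrite h2 [leRHS]mulr_natl mulr2n lerD2l.
Qed.

End Hartley.

(** The lower limit of K - c_n is K minus the upper limit of c_n, so the hypothesis says that the
    upper limit of a nonnegative sequence is at most 0. *)
Lemma cvg0_of_le_limn_einf (R : realType) (K : R) (c : R^nat) :
  (forall n, 0 <= c n) -> (K%:E <= limn_einf (fun n => (K - c n)%:E))%E ->
  c n @[n --> \oo] --> (0 : R).
Proof.
move=> c0; rewrite limn_einf_lim (_ : limn _ = ereal_sup (range (einfs (fun n => (K - c n)%:E)))); last first.
  by apply/cvg_lim => //; exact: cvg_einfs_sup.
move=> KL.
apply/cvgrPdist_lt => d d0.
have : ((K - d)%:E < ereal_sup (range (einfs (fun n => (K - c n)%:E))))%E.
  by apply: lt_le_trans KL; rewrite lte_fin ltrBlDr ltrDl.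
move=> /ereal_sup_gt[_ [N _ <-]] KN; exists N => // n /= Nn.
rewrite sub0r normrN ger0_norm//.
have : ((K - d)%:E < (K - c n)%:E)%E.
  apply: lt_le_trans KN _; apply: ereal_inf_lbound; exists n => //=.
by rewrite lte_fin ltrD2l ltrN2.
Qed.

(* Fatou's lemma for [(f_n + f)^2] and the parallelogram identity. *)
Lemma L2_cvg_of_norm_le d (T : measurableType d) (R : realType)
    (mu : {measure set T -> \bar R}) (D : set T) (f_ : nat -> T -> R) (f : T -> R) :
  measurable D -> (forall n, measurable_fun D (f_ n)) -> measurable_fun D f ->
  mu.-integrable D (EFin \o (fun x => f x ^+ 2)) ->
  (forall n, mu.-integrable D (EFin \o (fun x => f_ n x ^+ 2))) ->
  (forall n, \int[mu]_(x in D) (f_ n x ^+ 2) <= \int[mu]_(x in D) (f x ^+ 2)) ->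
  (forall x, D x -> f_ n x @[n --> \oo] --> f x) ->
  (\int[mu]_(x in D) ((f_ n x - f x) ^+ 2)) @[n --> \oo] --> (0 : R).
Proof.
move=> mD mf_ mf If If_ le_ cf.
have fin n : mu.-integrable D (EFin \o (fun x => 2 * f_ n x ^+ 2 + 2 * f x ^+ 2)).
  by apply: L1_D => //; [exact: (L1_Zl 2 mD (If_ n))|exact: (L1_Zl 2 mD If)].
have Ib n : mu.-integrable D (EFin \o (fun x => (f_ n x - f x) ^+ 2)).
  apply: L1_le (fin n) => //; first by apply: measurable_funX; exact: measurable_funB.
  by move=> x _; rewrite ger0_norm ?sqr_ge0//; have := sqr_ge0 (f_ n x + f x); nra.
have Id n : mu.-integrable D (EFin \o (fun x => (f_ n x + f x) ^+ 2)).
  apply: L1_le (fin n) => //; first by apply: measurable_funX; exact: measurable_funD.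
  by move=> x _; rewrite ger0_norm ?sqr_ge0//; have := sqr_ge0 (f_ n x - f x); nra.
set M := \int[mu]_(x in D) (f x ^+ 2).
have E n : \int[mu]_(x in D) ((f_ n x + f x) ^+ 2) <= 4 * M - \int[mu]_(x in D) ((f_ n x - f x) ^+ 2).
  have : \int[mu]_(x in D) ((f_ n x + f x) ^+ 2) + \int[mu]_(x in D) ((f_ n x - f x) ^+ 2) =
     2 * \int[mu]_(x in D) (f_ n x ^+ 2) + 2 * M.
    rewrite -(RintegralD mD (Id n) (Ib n)) -(RintegralZl 2 mD (If_ n)) -(RintegralZl 2 mD If).
    rewrite -(RintegralD mD (L1_Zl 2 mD (If_ n)) (L1_Zl 2 mD If)).
    by apply: eq_Rintegral => x _; ring.
  by have := le_ n; rewrite -/M; lra.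
apply: (@cvg0_of_le_limn_einf R (4 * M)).
  by move=> n; apply: Rintegral_ge0 => x _; exact: sqr_ge0.
have mg n : measurable_fun D (fun x => ((f_ n x + f x) ^+ 2)%:E).
  by apply/measurable_EFinP; apply: measurable_funX; exact: measurable_funD.
have := @fatou _ _ _ mu D mD (fun n x => ((f_ n x + f x) ^+ 2)%:E) mg _.
move=> /(_ (fun n x _ => sqr_ge0 (f_ n x + f x))).
rewrite (@eq_integral _ _ _ mu D (fun x => (4 * f x ^+ 2)%:E)); last first.
  move=> x /set_mem Dx.
  have c : ((f_ n x + f x) ^+ 2)%:E @[n --> \oo] --> (4 * f x ^+ 2)%:E.
    apply: cvg_EFin; first exact: nearW.
    have -> : 4 * f x ^+ 2 = (f x + f x) * (f x + f x) by ring.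
    have h : f_ n x + f x @[n --> \oo] --> f x + f x by apply: cvgD; [exact: cf|exact: cvg_cst].
    by apply: cvgM.
  by rewrite is_cvg_limn_einfE ?(cvg_lim _ c)//; apply/cvg_ex; eexists; exact: c.
have -> : (\int[mu]_(x in D) (4 * f x ^+ 2)%:E)%E = (4 * M)%:E.
  rewrite -(RintegralZl 4 mD If) /Rintegral fineK//.
  exact: (integrable_fin_num mD (L1_Zl 4 mD If)).
move=> h; apply: (le_trans h).
rewrite !limn_einf_lim; apply: lee_lim; try exact: is_cvg_einfs.
apply: nearW => n; apply: le_ereal_inf_tmp => _ /= [k nk <-].
apply: (@le_trans _ _ (\int[mu]_(x in D) ((f_ k x + f x) ^+ 2)%:E)%E).
  by apply: ereal_inf_lbound; exists k.
have := E k; rewrite -lee_fin [X in (X%:E <= _)%E]/Rintegral fineK//.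
exact: (integrable_fin_num mD (Id k)).
Qed.

(** * The heat kernel as an approximate identity at points of continuity *)

Section ApproximateIdentity.
Context {R : realType}.
Notation mu := (@lebesgue_measure R).
Implicit Types (m u f : R -> R) (e x xi eta t : R).

(** Write x^2/(2e) = 2v. One factor e^(-v) is at most 1/v <= 4e/d^2; the other forms the kernel at
    time 2e up to the factor 2^(1/2) <= 2, whence the 8. A bound by a kernel, unlike a uniform one,
    can still be integrated over the line. *)
Lemma heat_kernel_away e (d x : R) : 0 < e -> 0 < d -> d <= `|x| ->
  heat_kernel e x <= 8 / d ^+ 2 * e * heat_kernel (2 * e) x.
Proof.
move=> e0 d0 dx; rewrite /heat_kernel.
have p0 : 0 <= 2 * pi * e by rewrite !mulr_ge0 ?pi_ge0 ?ltW.
have -> : 2 * pi * (2 * e) = 2 * (2 * pi * e) by ring.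
rewrite [(2 * (2 * pi * e)) `^ _]powRM//.
have s2 : 2^-1 <= 2 `^ (- 2^-1) :> R.
  rewrite -[leLHS](@powR_inv1 _ 2)// ler_powR ?ler1n// lerN2.
  by rewrite invf_le1 ?ler1n.
set P := (2 * pi * e) `^ _; have P0 : 0 <= P by exact: powR_ge0.
set Q := 2 `^ _ in s2 *; clearbody P Q.
set v := x ^+ 2 / (4 * e).
have -> : x ^+ 2 / (2 * (2 * e)) = v by rewrite /v; congr (_ / _); ring.
have -> : x ^+ 2 / (2 * e) = v + v by rewrite /v; field; rewrite gt_eqF.
have e40 : 0 < 4 * e by rewrite mulr_gt0.
have x20 : 0 < x ^+ 2 by rewrite -(real_normK (num_real x)) exprn_gt0// (lt_le_trans d0).
have v0 : 0 < v by exact: divr_gt0.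
have vd : d ^+ 2 / (4 * e) <= v.
  rewrite /v ler_wpM2r ?invr_ge0 ?(ltW e40)// -(real_normK (num_real x)).
  by rewrite ler_pXn2r ?nnegrE// ltW.
have ev : expR (- v) <= 4 / d ^+ 2 * e.
  rewrite expRN (@le_trans _ _ v^-1)//.
    rewrite lef_pV2 ?posrE ?expR_gt0// (le_trans _ (expR_ge1Dx v))// lerDr//.
  have -> : 4 / d ^+ 2 * e = (d ^+ 2 / (4 * e))^-1 by field; rewrite !gt_eqF.
  by rewrite lef_pV2 ?posrE// divr_gt0// exprn_gt0.
rewrite opprD expRD.
move: ev; have := expR_ge0 (- v); move: (expR (- v)) => E E0 ev.
have -> : 8 / d ^+ 2 * e * (Q * P * E) = P * (2 * Q * (4 / d ^+ 2 * e) * E) by ring.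
rewrite ler_wpM2l// ler_wpM2r// (le_trans ev)// ler_peMl//.
  by apply: mulr_ge0; [apply: divr_ge0 => //; exact: sqr_ge0|exact: ltW].
by rewrite -ler_pdivrMl// mulr1.
Qed.

Lemma heat_kernel_double_le e x : 0 < e -> heat_kernel (2 * e) x <= (Num.sqrt e)^-1.
Proof.
move=> e0; rewrite (le_trans (heat_kernel_le _ _)) ?mulr_gt0//.
rewrite powRN powR12_sqrt; last by rewrite !mulr_ge0 ?pi_ge0 ?ltW.
rewrite lef_pV2 ?posrE ?sqrtr_gt0 ?mulr_gt0 ?pi_gt0// ler_sqrt; last first.
  by rewrite !mulr_ge0 ?pi_ge0 ?ltW.
have := pi_ge2 R; move: pi => p p2.
by have := ler_wpM2r (ltW e0) p2; lra.
Qed.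

(** As [m] may be unbounded, smallness away from x has to come from the kernel: its sup bound meets
    the L^1 norm of [m], its integral meets the constant m(x). The term q accounts for the points
    near x. *)
Lemma heat_conv_dist e m x (d q : R) : 0 < e -> 0 < d -> 0 < q ->
  mu.-integrable setT (EFin \o m) ->
  (forall t, `|x - t| < d -> `|m t - m x| <= q) ->
  `|heat_conv e m x - m x| <= q + 8 / d ^+ 2 * (Num.sqrt e * \int[mu]_t `|m t| + `|m x| * e).
Proof.
move=> e0 d0 q0 Im mq.
have [Ik Ek] := heat_kernel_sub_L1 x e0.
have e20 : 0 < 2 * e by rewrite mulr_gt0.
have [Ik2 Ek2] := heat_kernel_sub_L1 x e20.
have I1 := heat_conv_integrand_L1 x e0 Im.
have Ix := L1_Zl (m x) measurableT Ik.
have -> : heat_conv e m x - m x = \int[mu]_t (heat_kernel e (x - t) * m t - m x * heat_kernel e (x - t)).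
  by rewrite (RintegralB measurableT I1 Ix) (RintegralZl _ measurableT Ik) Ek mulr1.
set A := 8 / d ^+ 2.
have A0 : 0 <= A by rewrite divr_ge0 ?sqr_ge0.
have away t : d <= `|x - t| -> heat_kernel e (x - t) <= A * e * heat_kernel (2 * e) (x - t).
  exact: heat_kernel_away.
clearbody A.
have bnd t : `|heat_kernel e (x - t) * m t - m x * heat_kernel e (x - t)| <=
  (q * heat_kernel e (x - t) + A * Num.sqrt e * `|m t|) +
   A * `|m x| * e * heat_kernel (2 * e) (x - t).
  have k0 := heat_kernel_ge0 e (x - t); have k20 := heat_kernel_ge0 (2 * e) (x - t).
  have -> : heat_kernel e (x - t) * m t - m x * heat_kernel e (x - t) =
    heat_kernel e (x - t) * (m t - m x) by ring.
  rewrite normrM ger0_norm//.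
  have t2 : 0 <= A * Num.sqrt e * `|m t| by apply: mulr_ge0 => //; apply: mulr_ge0 => //; exact: sqrtr_ge0.
  have t3 : 0 <= A * `|m x| * e * heat_kernel (2 * e) (x - t) 
    by apply: mulr_ge0 => //; apply: mulr_ge0; [exact: mulr_ge0|exact: ltW].
  have [xtd|xtd] := ltrP (`|x - t|) d.
    have := ler_wpM2l k0 (mq _ xtd); lra.
  have ha := away _ xtd.
  have h1 := ler_wpM2l k0 (ler_normB (m t) (m x)); rewrite mulrDr in h1.
  have h2 := ler_wpM2r (normr_ge0 (m x)) ha.
  have h3 : heat_kernel e (x - t) * `|m t| <= A * Num.sqrt e * `|m t|.
    rewrite ler_wpM2r// (le_trans ha)// -mulrA ler_wpM2l//.
    rewrite (le_trans (ler_wpM2l (ltW e0) (heat_kernel_double_le _ e0)))//.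
    by rewrite -{1}(sqr_sqrtr (ltW e0)) expr2 mulfK// gt_eqF// sqrtr_gt0.
  have h4 : A * e * heat_kernel (2 * e) (x - t) * `|m x| = A * `|m x| * e * heat_kernel (2 * e) (x - t) by ring.
  by rewrite h4 in h2; have := mulr_ge0 (ltW q0) k0; lra.
have J1 := L1_Zl q measurableT Ik.
have J2 := L1_Zl (A * Num.sqrt e) measurableT (integrable_norm Im).
have J3 := L1_Zl (A * `|m x| * e) measurableT Ik2.
have J12 := L1_D measurableT J1 J2; have J := L1_D measurableT J12 J3.
apply: (@le_trans _ _ (\int[mu]_t ((q * heat_kernel e (x - t) + A * Num.sqrt e * `|m t|) +
   A * `|m x| * e * heat_kernel (2 * e) (x - t)))); last first.
  rewrite (RintegralD measurableT J12 J3) (RintegralD measurableT J1 J2).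
  rewrite (RintegralZl _ measurableT Ik) (RintegralZl _ measurableT Ik2) Ek Ek2.
  rewrite (RintegralZl (A * Num.sqrt e) measurableT (integrable_norm Im)).
  by rewrite /= !mulr1 mulrDr !mulrA addrA.
apply: (le_trans (le_normr_Rintegral _ (L1_B measurableT I1 Ix))) => //.
by apply: le_Rintegral => //; exact: integrable_norm (L1_B measurableT I1 Ix).
Qed.

Lemma cvg_heat_conv (e : R^nat) m x : (forall n, 0 < e n) -> e n @[n --> \oo] --> (0 : R) ->
  mu.-integrable setT (EFin \o m) -> {for x, continuous m} ->
  heat_conv (e n) m x @[n --> \oo] --> m x.
Proof.
move=> e0 ecv Im cm; apply/cvgrPdist_le => q q0.
have q20 : 0 < q / 2 by rewrite divr_gt0.
have [d d0 dq] : exists2 d : R, 0 < d & forall t, `|x - t| < d -> `|m t - m x| <= q / 2.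
  have /cvgrPdist_le/(_ _ q20)/nbhs_ballP[d /= d0 dm] := cm.
  by exists d => // t xt; rewrite distrC; exact: dm.
pose M := \int[mu]_t `|m t|.
have c : 8 / d ^+ 2 * (Num.sqrt (e n) * M + `|m x| * e n) @[n --> \oo] --> (0 : R).
  rewrite -[X in _ --> X](mulr0 (8 / d ^+ 2)); apply: cvgMr.
  rewrite -[X in _ --> X](addr0 0); apply: cvgD.
    have -> : 0 = Num.sqrt 0 * M :> R by rewrite sqrtr0 mul0r.
    have h : Num.sqrt (e n) @[n --> \oo] --> Num.sqrt (0 : R).
      exact: (cvg_comp e _ ecv (@sqrt_continuous R 0)).
    exact: cvgM h (cvg_cst _).
  have -> : 0 = `|m x| * 0 :> R by rewrite mulr0.
  exact: cvgM (cvg_cst _) ecv.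
have /cvgrPdist_le/(_ _ q20) := c; apply: filterS => n /=.
rewrite sub0r normrN => /(le_trans (ler_norm _)) h.
rewrite distrC (le_trans (heat_conv_dist (e0 n) d0 q20 Im dq))// -/M.
by rewrite [leRHS](splitr q) lerD2l.
Qed.

End ApproximateIdentity.

Local Open Scope complex_scope.

(** * Fourier pairs *)

Section Existence.
Context {R : realType}.
Notation mu := (@lebesgue_measure R).
Implicit Types (m u f p q : R -> R) (e x xi eta t : R).

Lemma measurable_hartley m : mu.-integrable setT (EFin \o m) ->
  measurable_fun setT (hartley m).
Proof. by apply: measurable_trig_transform; [exact: measurable_casT|exact: cas_le2]. Qed.

Lemma cvg_gauss1 x : gauss n.+1%:R^-1 x @[n --> \oo] --> (1 : R).
Proof.
have h : - (n.+1%:R^-1 / 2 * x ^+ 2) @[n --> \oo] --> - (0 / 2 * x ^+ 2).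
  apply: cvgN; apply: cvgM; last exact: cvg_cst.
  by apply: cvgM; [exact: cvg_invS_0|exact: cvg_cst].
have := cvg_comp _ _ h (@continuous_expR R _).
by rewrite !mul0r oppr0 expR0.
Qed.

(** Fatou's lemma removes the Gaussian from [hartley_gauss_sqr], whose bound does not depend on
    e. *)
Lemma hartley_sqr_L1 m : mu.-integrable setT (EFin \o m) ->
  mu.-integrable setT (EFin \o (fun x : R => m x ^+ 2)) ->
  mu.-integrable setT (EFin \o (fun x : R => hartley m x ^+ 2)).
Proof.
move=> Im Im2; have mh := measurable_hartley Im.
have m2 : measurable_fun setT (fun x : R => hartley m x ^+ 2) by exact: measurable_funX.
apply/integrableP; split; first exact/measurable_EFinP.
have e0 n : 0 < n.+1%:R^-1 :> R by rewrite invr_gt0.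
pose f n (x : R) := (hartley m x ^+ 2 * gauss n.+1%:R^-1 x)%:E.
have mf n : measurable_fun setT (f n).
  by apply/measurable_EFinP; exact: L1_measurable (hartley_gauss_sqr (e0 n) Im Im2).1.
have f0 n x : setT x -> (0 <= f n x)%E.
  by move=> _; rewrite lee_fin mulr_ge0 ?sqr_ge0 ?gauss_ge0.
have := @fatou _ _ _ mu setT measurableT f mf f0.
rewrite (@eq_integral _ _ _ mu setT (fun x => `|(hartley m x ^+ 2)%:E|%E)); last first.
  move=> x _.
  have c : f n x @[n --> \oo] --> (hartley m x ^+ 2)%:E.
    apply: cvg_EFin; first exact: nearW.
    rewrite -[X in _ --> X]mulr1; apply: cvgM; [exact: cvg_cst|exact: cvg_gauss1].
  rewrite is_cvg_limn_einfE; last by apply/cvg_ex; eexists; exact: c.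
  by rewrite (cvg_lim _ c)//= ger0_norm ?sqr_ge0.
move=> /le_lt_trans; apply.
apply: (@le_lt_trans _ _ (2 * pi * \int[mu]_x (m x ^+ 2))%:E); last exact: ltry.
rewrite limn_einf_lim; apply: lime_le; first exact: is_cvg_einfs.
apply: nearW => n; apply: (@le_trans _ _ (\int[mu]_x f n x)%E).
  by apply: ereal_inf_lbound; exists n => //=.
have [I le_] := hartley_gauss_sqr (e0 n) Im Im2.
rewrite -lee_fin in le_; apply: le_trans le_.
by rewrite /Rintegral fineK//; exact: (integrable_fin_num _ I).
Qed.

(* The Fourier transform of a real function is [even_odd] of its Hartley
   transform: its real part is the even part, its imaginary part minus the odd
   part. *)
Definition even_odd m xi : R[i] := ((m xi + m (- xi)) / 2) +i* ((m (- xi) - m xi) / 2).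

Lemma fourier_integral_real u xi : mu.-integrable setT (EFin \o u) ->
  fourier_integral (fun x => (u x)%:C) xi = even_odd (hartley u) xi.
Proof.
move=> Iu.
have I1 := L1_cas xi Iu; have I2 := L1_cas (- xi) Iu.
congr (_ +i* _).
  rewrite -(RintegralD measurableT I1 I2) -RintegralZr//; last exact: L1_D.
  apply: eq_Rintegral => t _ /=; rewrite mulNr /cas !cosN !sinN mulr0 subr0 [t * xi]mulrC.
  by field.
rewrite -(RintegralB measurableT I2 I1) -RintegralZr//; last exact: L1_B.
apply: eq_Rintegral => t _ /=; rewrite mulNr /cas !cosN !sinN mulr0 add0r [t * xi]mulrC.
by field.
Qed.

Lemma sqmod_even_oddB p q xi : sqmod (even_odd p xi - even_odd q xi) =
  2^-1 * ((p xi - q xi) ^+ 2 + (p (- xi) - q (- xi)) ^+ 2).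
Proof. by rewrite /sqmod /even_odd /=; field. Qed.

Lemma half_adde (I : \bar R) : (0 <= I)%E -> ((2^-1)%:E * (I + I))%E = I.
Proof.
case: I => [r _||]//; first by rewrite -EFinD -EFinM; congr EFin; field.
by rewrite addye// gt0_muley// lte_fin invr_gt0.
Qed.

(** The squared modulus at xi is the mean of the squares at xi and -xi, and the reflection of the
    line equates their integrals. Values may be infinite, hence [half_adde]. *)
Lemma sqdist_even_odd p q : measurable_fun setT p -> measurable_fun setT q ->
  sqdist (even_odd p) (even_odd q) = (\int[mu]_x ((p x - q x) ^+ 2)%:E)%E.
Proof.
move=> mp mq; rewrite /sqdist; under eq_integral do rewrite sqmod_even_oddB EFinM EFinD.
have mpq : measurable_fun setT (fun x => ((p x - q x) ^+ 2)%:E).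
  by apply/measurable_EFinP; apply: measurable_funX; exact: measurable_funB.
have mpqN : measurable_fun setT (fun x => ((p (- x) - q (- x)) ^+ 2)%:E).
  apply/measurable_EFinP; apply: measurable_funX.
  by apply: measurable_funB; exact: measurableT_comp.
rewrite ge0_integralZl//; last 2 first.
- exact: emeasurable_funD.
- by move=> x _; rewrite -EFinD lee_fin addr_ge0 ?sqr_ge0.
rewrite ge0_integralD//; last 2 first.
- by move=> x _; rewrite lee_fin sqr_ge0.
- by move=> x _; rewrite lee_fin sqr_ge0.
rewrite (_ : \int[mu]_x ((p (- x) - q (- x)) ^+ 2)%:E = \int[mu]_x ((p x - q x) ^+ 2)%:E)%E; last first.
  rewrite -(@ge0_integral_oppr _ (fun x => ((p x - q x) ^+ 2)%:E) setT)//.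
  by move=> x _; rewrite lee_fin sqr_ge0.
rewrite half_adde//; apply: integral_ge0 => x _; rewrite lee_fin sqr_ge0//.
Qed.

Lemma cmeasurable_even_odd m : measurable_fun setT m -> cmeasurable (even_odd m).
Proof.
move=> mm; have mN : measurable_fun setT (fun x : R => m (- x)) by exact: measurableT_comp.
by split; apply: measurable_funM => //; [exact: measurable_funD|exact: measurable_funB].
Qed.

Lemma cmeasurable_real u : measurable_fun setT u -> cmeasurable (fun x => (u x)%:C).
Proof. by move=> mu_; split => //=; exact: measurable_cst. Qed.

Lemma sqdist_real p q :
  sqdist (fun x => (p x)%:C) (fun x => (q x)%:C) = (\int[mu]_x ((p x - q x) ^+ 2)%:E)%E.
Proof.
by apply: eq_integral => x _; rewrite /sqmod /= subrr expr0n addr0.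
Qed.

Lemma inL2_real u : measurable_fun setT u ->
  mu.-integrable setT (EFin \o (fun x : R => u x ^+ 2)) -> inL2 (fun x => (u x)%:C).
Proof.
move=> mu_ Iu; split; first exact: cmeasurable_real.
rewrite (_ : (fun=> 0) = (fun=> (0 : R)%:C)) // sqdist_real.
under eq_integral do rewrite subr0.
have /(integrable_fin_num measurableT) := Iu.
by rewrite ge0_fin_numE//; apply: integral_ge0 => x _; rewrite lee_fin sqr_ge0.
Qed.

Lemma inL2_even_odd m : measurable_fun setT m ->
  mu.-integrable setT (EFin \o (fun x : R => m x ^+ 2)) -> inL2 (even_odd m).
Proof.
move=> mm Im; split; first exact: cmeasurable_even_odd.
rewrite (_ : (fun=> 0) = even_odd (cst 0)); last first.
  by apply/funext => x; rewrite /even_odd /= addr0 subr0 mul0r.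
rewrite sqdist_even_odd//=.
under eq_integral do rewrite subr0.
have /(integrable_fin_num measurableT) := Im.
by rewrite ge0_fin_numE//; apply: integral_ge0 => x _; rewrite lee_fin sqr_ge0.
Qed.

Lemma sqr_int_cvg0 (f_ : nat -> R -> R) f :
  (forall n, mu.-integrable setT (EFin \o (fun x => (f_ n x - f x) ^+ 2))) ->
  \int[mu]_x ((f_ n x - f x) ^+ 2) @[n --> \oo] --> (0 : R) ->
  (\int[mu]_x ((f_ n x - f x) ^+ 2)%:E)%E @[n --> \oo] --> 0%E.
Proof.
move=> I c.
rewrite (_ : (fun n => _) = (fun n => (\int[mu]_x ((f_ n x - f x) ^+ 2))%:E)).
  by apply: cvg_EFin => //; exact: nearW.
by apply/funext => n; rewrite /Rintegral fineK//; exact: (integrable_fin_num _ (I n)).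
Qed.

Lemma sqrB_L1 p q : measurable_fun setT p -> measurable_fun setT q ->
  mu.-integrable setT (EFin \o (fun x : R => p x ^+ 2)) ->
  mu.-integrable setT (EFin \o (fun x : R => q x ^+ 2)) ->
  mu.-integrable setT (EFin \o (fun x : R => (p x - q x) ^+ 2)).
Proof.
move=> mp mq Ip Iq.
have I := L1_D measurableT (L1_Zl 2 measurableT Ip) (L1_Zl 2 measurableT Iq).
apply: L1_le I => //; first by apply: measurable_funX; exact: measurable_funB.
have bnd (s t : R) : `|(s - t) ^+ 2| <= 2 * s ^+ 2 + 2 * t ^+ 2.
  by rewrite ger0_norm ?sqr_ge0//; have := sqr_ge0 (s + t); rewrite sqrrB sqrrD; lra.
by move=> x _; exact: bnd.
Qed.

(** The approximants are Gaussian multiples of the first function, and converge to it by domination.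
    Their Hartley transforms are the heat flows of [m]: these have norm at most that of [m] and
    converge at every point of continuity, so [L2_cvg_of_norm_le] applies. Continuity is not asked
    at 0, where |xi|^a and the sign are singular. *)
Theorem is_fourier_hartley m : mu.-integrable setT (EFin \o m) ->
  mu.-integrable setT (EFin \o (fun x : R => m x ^+ 2)) ->
  (forall x, x != 0 -> {for x, continuous m}) ->
  is_fourier (fun x => ((2 * pi)^-1 * hartley m x)%:C) (even_odd m).
Proof.
move=> Im Im2 cm; have mm := L1_measurable Im.
set k := (2 * pi)^-1; pose h x := k * hartley m x.
have k0 : k * (2 * pi) = 1 by rewrite mulVf// gt_eqF// mulr_gt0// pi_gt0.
pose e n : R := n.+1%:R^-1; have e0 n : 0 < e n by rewrite invr_gt0.
pose u n x := h x * gauss (e n) x.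
have mh : measurable_fun setT h by apply: measurable_funM => //; exact: measurable_hartley.
have mu_ n : measurable_fun setT (u n).
  by apply: measurable_funM => //; exact: measurable_gauss.
have Iu n : mu.-integrable setT (EFin \o u n).
  apply: eq_integrable (L1_Zl k measurableT (hartley_gauss (e0 n) Im).1) => // x _ /=.
  by rewrite mulrA.
have Hu n xi : hartley (u n) xi = heat_conv (e n) m xi.
  have [I E] := hartley_gauss (e0 n) Im.
  transitivity (k * hartley (fun x => hartley m x * gauss (e n) x) xi); last by rewrite E mulrA k0 mul1r.
  rewrite -[LHS]/(\int[mu]_t (cas (xi * t) * u n t)).
  rewrite -[X in k * X]/(\int[mu]_t (cas (xi * t) * (hartley m t * gauss (e n) t))).
  rewrite -RintegralZl//; last exact: L1_cas.
  by apply: eq_Rintegral => t _; rewrite /u /h -(mulrA k) mulrCA.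
have Ih2 : mu.-integrable setT (EFin \o (fun x : R => h x ^+ 2)).
  apply: eq_integrable (L1_Zl (k ^+ 2) measurableT (hartley_sqr_L1 Im Im2)) => // x _ /=.
  by rewrite exprMn.
have Iu2 n : mu.-integrable setT (EFin \o (fun x : R => u n x ^+ 2)).
  have m2 : measurable_fun setT (fun x : R => u n x ^+ 2) by exact: measurable_funX (mu_ n).
  apply: L1_le Ih2 => //.
  move=> x _; rewrite ger0_norm ?sqr_ge0// exprMn ler_piMr ?sqr_ge0// exprn_ile1 ?gauss_ge0//.
  exact: gauss_le1.
have IH2 n := (heat_conv_L2 (e0 n) Im Im2).1.
have mC n : measurable_fun setT (heat_conv (e n) m).
  exact: L1_measurable (heat_conv_L1 (e0 n) Im).1.
split.
- exact: inL2_real.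
- exact: inL2_even_odd.
exists (fun n x => (u n x)%:C); split.
- move=> n; split; last exact: inL2_real.
  split; first exact: Iu.
  by apply: eq_integrable (integrable0 _ _).
- rewrite (_ : (fun n => _) = (fun n => (\int[mu]_x ((u n x - h x) ^+ 2)%:E)%E)); last first.
    by apply/funext => n; rewrite sqdist_real.
  apply: sqr_int_cvg0; first by move=> n; exact: sqrB_L1.
  have md n : measurable_fun setT (fun x : R => (u n x - h x) ^+ 2).
    by apply: measurable_funX; exact: measurable_funB.
  have bnd n (x : R) : `|(u n x - h x) ^+ 2| <= h x ^+ 2.
    rewrite ger0_norm ?sqr_ge0// /u -[X in _ - X]mulr1 -mulrBr exprMn.
    rewrite ler_piMr ?sqr_ge0// -sqrrN opprB exprn_ile1 ?subr_ge0 ?gauss_le1//.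
    by rewrite lerBlDr lerDl gauss_ge0.
  have [||_] := @Rintegral_dominated _ _ R mu setT (fun n x => (u n x - h x) ^+ 2)
    (cst 0) (fun x => h x ^+ 2) measurableT md Ih2.
  + by move=> n x _; exact: bnd.
  + move=> x _; have c : u n x - h x @[n --> \oo] --> h x * 1 - h x.
      by apply: cvgB; [apply: cvgM; [exact: cvg_cst|exact: cvg_gauss1]|exact: cvg_cst].
    rewrite /= (_ : 0 = (h x * 1 - h x) * (h x * 1 - h x)); last by rewrite mulr1 subrr mulr0.
    exact: (cvgM c c).
  + by rewrite Rintegral_cst// mul0r.
- rewrite (_ : (fun n => _) = (fun n => (\int[mu]_x ((heat_conv (e n) m x - m x) ^+ 2)%:E)%E)); last first.
    apply/funext => n; rewrite -sqdist_even_odd//; congr (sqdist _ _).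
    apply/funext => xi; rewrite fourier_integral_real//.
    by rewrite /even_odd !Hu.
  apply: sqr_int_cvg0; first by move=> n; exact: sqrB_L1.
  (* Removing the null point 0 leaves pointwise convergence at every point of the domain. *)
  pose D := [set: R] `\ (0 : R).
  have mD : measurable D by exact: measurableD.
  have setD (f : R -> R) : mu.-integrable setT (EFin \o f) ->
      \int[mu]_(x in D) f x = \int[mu]_x f x.
    move=> If; rewrite /Rintegral integral_setD1//.
    by have /measurable_int := If; exact: measurable_funTS.
  have IS (f : R -> R) : mu.-integrable setT (EFin \o f) -> mu.-integrable D (EFin \o f).
    by move=> If; apply: integrableS If.
  rewrite (_ : (fun n => _) = (fun n => \int[mu]_(x in D) ((heat_conv (e n) m x - m x) ^+ 2))); last first.
    by apply/funext => n; rewrite setD//; exact: sqrB_L1.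
  have mCD n : measurable_fun D (heat_conv (e n) m) by exact: measurable_funTS (mC n).
  have mD' : measurable_fun D m by exact: measurable_funTS.
  apply: L2_cvg_of_norm_le => //.
  + exact: (IS _ Im2).
  + by move=> n; exact: (IS _ (IH2 n)).
  + by move=> n; rewrite !setD//; exact: (heat_conv_L2 (e0 n) Im Im2).2.
  + move=> x [_ /= /eqP x0]; apply: cvg_heat_conv => //; first exact: cvg_invS_0.
    exact: cm.
Qed.

End Existence.

(** * The real spectrum of h_a and its Hartley transform *)

Section WeberPair.
Context {R : realType}.
Notation mu := (@lebesgue_measure R).
Implicit Types (a y x xi t : R).

Local Opaque gamma rgamma.

(* The real function which [even_odd] turns into [(- i xi)^a exp (- y xi^2 / 2)] *)
Definition weber a y xi : R := `|xi| `^ a * gauss y xi * cas (pi * a * Num.sg xi / 2).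

Lemma even_odd_weber a y xi : even_odd (weber a y) xi = symbol a xi * (gauss y xi)%:C.
Proof.
rewrite /even_odd /weber /symbol /expi /cas normrN gaussN sgrN.
have -> : pi * a * - Num.sg xi / 2 = - (pi * a * Num.sg xi / 2) by ring.
rewrite !cosN !sinN; apply/eqP; rewrite eq_complex /=; apply/andP; split; apply/eqP; by field.
Qed.

Lemma measurable_sgr : measurable_fun setT (@Num.sg R).
Proof.
rewrite (_ : Num.sg = fun x : R => if x == 0 then 0 else if x < 0 then -1 else 1)//.
apply: measurable_fun_ifT => //; first exact: measurable_fun_eqr.
by apply: measurable_fun_ifT => //; exact: measurable_fun_ltr.
Qed.

Lemma measurable_weber a y : measurable_fun setT (weber a y).
Proof.
apply: measurable_funM; first apply: measurable_funM.
- exact: (measurableT_comp (@measurable_powR R a) (@normr_measurable R setT)).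
- exact: measurable_gauss.
- apply: measurable_cas; apply: measurable_funM => //.
  by apply: measurable_funM => //; exact: measurable_sgr.
Qed.

Lemma weber_pos a y t : 0 < t -> weber a y t = cas (pi * a / 2) * powgauss a (y / 2) t.
Proof.
by move=> t0; rewrite /weber gtr0_norm// gtr0_sg// mulr1 mulrC.
Qed.

Lemma weber_neg a y t : 0 < t -> weber a y (- t) = cas (- (pi * a / 2)) * powgauss a (y / 2) t.
Proof.
move=> t0; rewrite /weber normrN gaussN sgrN gtr0_norm// gtr0_sg// mulrC; congr (cas _ * _).
by ring.
Qed.

Lemma weber_L1 a y : -1 < a -> 0 < y -> mu.-integrable setT (EFin \o weber a y).
Proof.
move=> a1 y0; have Ip : mu.-integrable `]0, +oo[ (EFin \o powgauss a (y / 2)).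
  by apply: L1_powgauss => //; rewrite divr_gt0.
apply: (L1_fold (@measurable_weber a y) _ _).1.
- apply: eq_integrable (L1_Zl (cas (pi * a / 2)) _ Ip) => // t.
  by rewrite inE/= in_itv/= andbT => t0; rewrite weber_pos.
- apply: eq_integrable (L1_Zl (cas (- (pi * a / 2))) _ Ip) => // t.
  by rewrite inE/= in_itv/= andbT => t0; rewrite weber_neg.
Qed.

Lemma powgauss_sqr a c t : 0 < t -> powgauss a c t ^+ 2 = powgauss (2 * a) (2 * c) t.
Proof.
move=> t0; rewrite /powgauss exprMn [expR _ ^+ 2]expr2 -expRD -[(t `^ a) ^+ 2]powR_mulrn ?powR_ge0//.
by rewrite -powRrM [a * 2]mulrC; congr (_ * expR _); ring.
Qed.

(** On each half-line the square is a Gaussian moment integrand of exponent 2a, integrable at 0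
    because 2a > -1. *)
Lemma weber_L2 a y : - 2^-1 < a -> 0 < y ->
  mu.-integrable setT (EFin \o (fun x : R => weber a y x ^+ 2)).
Proof.
move=> a1 y0; have Ip : mu.-integrable `]0, +oo[ (EFin \o powgauss (2 * a) (2 * (y / 2))).
  by apply: L1_powgauss; [lra|rewrite mulr_gt0// divr_gt0].
apply: (L1_fold _ _ _).1.
- by apply: measurable_funX; exact: measurable_weber.
- apply: eq_integrable (L1_Zl (cas (pi * a / 2) ^+ 2) _ Ip) => // t.
  by rewrite inE/= in_itv/= andbT => t0; rewrite weber_pos// exprMn powgauss_sqr.
- apply: eq_integrable (L1_Zl (cas (- (pi * a / 2)) ^+ 2) _ Ip) => // t.
  by rewrite inE/= in_itv/= andbT => t0; rewrite weber_neg// exprMn powgauss_sqr.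
Qed.

Lemma continuous_weber a y xi : xi != 0 -> {for xi, continuous (weber a y)}.
Proof.
move=> xi0; pose s := cas (pi * a * Num.sg xi / 2).
have nx : 0 < `|xi| by rewrite normr_gt0.
have c1 : {for xi, continuous (fun t : R => `|t| `^ a)}.
  apply: (@continuous_comp _ _ _ _ (fun t : R => t `^ a)); first exact: norm_continuous.
  exact: is_derive_continuous (is_derive1_powR _ nx).
have c2 : {for xi, continuous (gauss y)}.
  apply: (@continuous_comp _ _ _ _ expR); last exact: continuous_expR.
  apply: continuousN; apply: continuousM; first exact: cst_continuous.
  exact: exprn_continuous.
have c : {for xi, continuous (fun t => `|t| `^ a * gauss y t * s)}.
  by apply: continuousM; [exact: continuousM|exact: cst_continuous].
rewrite /continuous_at; apply: cvg_trans c; apply: near_eq_cvg.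
have sg : \forall t \near xi, Num.sg t = Num.sg xi.
  have [x0|x0|x0] := ltgtP xi 0; last by rewrite x0 eqxx in xi0.
    near=> t; rewrite !ltr0_sg//; near: t; exact: lt_nbhsl.
  near=> t; rewrite !gtr0_sg//; near: t; exact: lt_nbhsr.
by apply: filterS sg => t st; rewrite /weber st.
Unshelve. all: by end_near. Qed.

(** Folding onto t > 0 adds cas(xt) cas(u) and cas(-xt) cas(-u) with u = pi a/2; the mixed terms
    cancel, and what is left is the combination of integrals in [heat_kernel_pcH]. *)
Lemma hartley_weber a y x : -1 < a -> 0 < y ->
  (2 * pi)^-1 * hartley (weber a y) x = y `^ (- a) * (heat_kernel y x * pcH a x y).
Proof.
move=> a1 y0; have y2 : 0 < y / 2 by rewrite divr_gt0.
rewrite (heat_kernel_pcH x a1 y0) mulrA -powRD; last by rewrite (gt_eqF y0) implybT.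
rewrite addNr powRr0 mul1r.
have [Ic _] := gaussian_cos_transform x a1 y2; have [Is _] := gaussian_sin_transform x a1 y2.
have Iw := L1_cas x (weber_L1 a1 y0).
have mI := L1_measurable Iw.
have Ip : mu.-integrable `]0, +oo[ (EFin \o (fun t : R => cas (x * t) * weber a y t)).
  exact: integrableS Iw.
have Ipg : mu.-integrable `]0, +oo[ (EFin \o powgauss a (y / 2)) by exact: L1_powgauss.
have In : mu.-integrable `]0, +oo[ (EFin \o (fun t : R => cas (x * - t) * weber a y (- t))).
  apply: (L1_mulM (M := 2)) => //.
  - apply: eq_integrable (L1_Zl (cas (- (pi * a / 2))) _ Ipg) => // t.
    by rewrite inE/= in_itv/= andbT => t0; rewrite weber_neg.
  - by apply: measurable_cas; apply: measurable_funM => //; exact: measurable_funTS.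
  - by move=> t _; exact: cas_le2.
rewrite /hartley (L1_fold mI Ip In).2.
have e (t : R) : 0 < t -> cas (x * t) * weber a y t + cas (x * - t) * weber a y (- t) =
  2 * cos (pi * a / 2) * (powgauss a (y / 2) t * cos (x * t)) +
  2 * sin (pi * a / 2) * (powgauss a (y / 2) t * sin (x * t)).
  move=> t0; rewrite weber_pos// weber_neg// /cas mulrN !cosN !sinN.
  by move: (powgauss _ _ _) => p; ring.
have -> : \int[mu]_(t in `]0, +oo[) (cas (x * t) * weber a y t + cas (x * - t) * weber a y (- t)) =
  \int[mu]_(t in `]0, +oo[) (2 * cos (pi * a / 2) * (powgauss a (y / 2) t * cos (x * t)) +
  2 * sin (pi * a / 2) * (powgauss a (y / 2) t * sin (x * t))).
  by apply: eq_Rintegral => t; rewrite inE/= in_itv/= andbT => t0; rewrite e.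
rewrite RintegralD//; last 2 first.
- exact: (@L1_Zl _ _ R mu _ _ (2 * cos (pi * a / 2)) _ Ic).
- exact: (@L1_Zl _ _ R mu _ _ (2 * sin (pi * a / 2)) _ Is).
rewrite (@RintegralZl _ _ R mu _ _ (2 * cos (pi * a / 2)) _ Ic)//.
rewrite (@RintegralZl _ _ R mu _ _ (2 * sin (pi * a / 2)) _ Is)//.
have p0 : pi != 0 :> R by rewrite gt_eqF// pi_gt0.
move: (\int[mu]_(_ in _) _) (\int[mu]_(_ in _) _) (cos _) (sin _) p0; move: pi => p A B C S p0.
by field.
Qed.

End WeberPair.

(** * Uniqueness *)

Section Determination.
Context {R : realType}.
Notation mu := (@lebesgue_measure R).
Implicit Types (m f p q phi : R -> R) (b c d e x xi t : R).

Lemma Rintegral_setD1 f (r : R) (D : set R) : measurable D ->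
  mu.-integrable D (EFin \o f) -> \int[mu]_(x in D `\ r) f x = \int[mu]_(x in D) f x.
Proof.
move=> mD If; rewrite /Rintegral integral_setD1//; first exact: measurableD.
by have /measurable_int := If; apply: measurable_funS => //; exact: subDsetl.
Qed.

Lemma continuous_indic_itv c d x : x != c -> x != d ->
  {for x, continuous (\1_`]c, d] : R -> R)}.
Proof.
move=> xc xd; pose m : R -> R := \1_`]c, d].
have mE (t : R) : m t = ((c < t) && (t <= d))%:R by rewrite /m indicE mem_setE in_itv.
have loc (v : R) : (\forall t \near x, m t = v) -> m x = v -> {for x, continuous m}.
  move=> h hx; apply/cvgrPdist_lt => q q0; apply: filterS h => t.
  by move=> ->; rewrite hx subrr normr0.
have [xc'|xc'|xc'] := ltgtP x c; last by rewrite xc' eqxx in xc.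
  apply: (loc 0); last by rewrite mE ltNge (ltW xc').
  by apply: filterS (lt_nbhsl xc') => t tc; rewrite mE ltNge (ltW tc).
have [xd'|xd'|xd'] := ltgtP x d; last by rewrite xd' eqxx in xd.
  apply: (loc 1); last by rewrite mE xc' (ltW xd').
  by apply: filterS2 (lt_nbhsl xd') (lt_nbhsr xc') => t td tc; rewrite mE tc (ltW td).
apply: (loc 0); last by rewrite mE leNgt xd' andbF.
by apply: filterS (lt_nbhsr xd') => t td; rewrite mE leNgt td andbF.
Qed.

Lemma L1_indic c d : mu.-integrable setT (EFin \o (\1_`]c, d] : R -> R)).
Proof.
exact: integrable_indic_itv.
Qed.

Lemma heat_conv_indic_bound e c d x : 0 < e -> `|heat_conv e (\1_`]c, d] : R -> R) x| <= 1.
Proof.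
move=> e0; have I := heat_conv_integrand_L1 x e0 (L1_indic c d).
have [Ik Ek] := heat_kernel_sub_L1 x e0.
apply: (le_trans (le_normr_Rintegral _ I)) => //; rewrite -Ek.
apply: le_Rintegral => //; first exact: integrable_norm I.
move=> t _; rewrite normrM ger0_norm ?heat_kernel_ge0// ler_piMr ?heat_kernel_ge0//.
by rewrite indicE normr_nat; case: (_ \in _).
Qed.

Lemma heat_conv_sym e f m : 0 < e -> mu.-integrable setT (EFin \o f) ->
  mu.-integrable setT (EFin \o m) ->
  \int[mu]_x (f x * heat_conv e m x) = \int[mu]_x (m x * heat_conv e f x).
Proof.
move=> e0 If Im; have mf := L1_measurable If; have mm := L1_measurable Im.
pose K := (2 * pi * e) `^ (- 2^-1).
have I2 : mu.-integrable setT (EFin \o (fun t : R => K * `|m t|)).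
  by apply: (L1_Zl K) => //; exact: integrable_norm.
pose F (z : R * R) := f z.1 * (heat_kernel e (z.1 - z.2) * m z.2).
have mF : measurable_fun setT F.
  apply: measurable_funM; first exact: measurableT_comp.
  apply: measurable_funM; last exact: measurableT_comp.
  apply: measurableT_comp; first exact: measurable_heat_kernel.
  exact: measurable_funB.
have FG x t : `|F (x, t)| <= `|f x| * (K * `|m t|).
  rewrite /F/= [leLHS]normrM ler_wpM2l// normrM ler_wpM2r// ger0_norm ?heat_kernel_ge0//.
  exact: heat_kernel_le.
have E x : \int[mu]_t F (x, t) = f x * heat_conv e m x.
  by rewrite /F/= RintegralZl//; exact: heat_conv_integrand_L1.
have E' t : \int[mu]_x F (x, t) = m t * heat_conv e f t.
  rewrite /heat_conv -RintegralZl//; last exact: heat_conv_integrand_L1.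
  by apply: eq_Rintegral => x _; rewrite /F/= -heat_kernelN opprB; ring.
have [_ _] := Rintegral_FubiniR mF (integrable_norm If) I2 FG.
by under eq_Rintegral do rewrite E; under [in RHS]eq_Rintegral do rewrite E'.
Qed.

(** The heat flow of an integrable [f] need not converge at a given point, so it is moved to the
    indicator of the interval, which is continuous off the two end points; these are removed from
    the domain. *)
Lemma Rintegral_itv_eq0 f c d : mu.-integrable setT (EFin \o f) ->
  (forall n x, heat_conv n.+1%:R^-1 f x = 0) -> \int[mu]_(x in `]c, d]) f x = 0.
Proof.
move=> If f0; have mf := L1_measurable If.
pose m : R -> R := \1_`]c, d].
have Im : mu.-integrable setT (EFin \o m) by exact: L1_indic.
pose D := ([set: R] `\ c) `\ d.
have e0 n : 0 < n.+1%:R^-1 :> R by rewrite invr_gt0.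
have mD : measurable D by apply: measurableD => //; exact: measurableD.
have IS g : mu.-integrable setT (EFin \o g) -> mu.-integrable D (EFin \o g).
  by move=> Ig; apply: integrableS Ig.
have intD g : mu.-integrable setT (EFin \o g) -> \int[mu]_(x in D) g x = \int[mu]_x g x.
  move=> Ig; rewrite /D Rintegral_setD1; first exact: Rintegral_setD1.
    exact: measurableD.
  by apply: integrableS Ig => //; exact: measurableD.
have mc n : measurable_fun setT (heat_conv n.+1%:R^-1 m).
  exact: L1_measurable (heat_conv_L1 (e0 n) Im).1.
have Ifc n : mu.-integrable setT (EFin \o (fun x : R => f x * heat_conv n.+1%:R^-1 m x)).
  apply: eq_integrable (L1_mulM (M := 1) measurableT If (mc n) _) => //.
    by move=> x _ /=; rewrite mulrC.
  by move=> x _; exact: heat_conv_indic_bound.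
have z n : \int[mu]_(x in D) (f x * heat_conv n.+1%:R^-1 m x) = 0.
  rewrite intD// heat_conv_sym//.
  by under eq_Rintegral do rewrite f0 mulr0; rewrite Rintegral_cst// mul0r.
have [||||If' cv] := @Rintegral_dominated _ _ R mu D (fun n x => f x * heat_conv n.+1%:R^-1 m x)
   (fun x => f x * m x) (fun x => `|f x|) mD.
- by move=> n; exact: L1_measurable (IS _ (Ifc n)).
- exact: IS (integrable_norm If).
- by move=> n x _; rewrite normrM ler_piMr// heat_conv_indic_bound.
- move=> x [[_ /= /eqP xc] /eqP xd]; apply: cvgM; first exact: cvg_cst.
  by apply: cvg_heat_conv => //; [exact: cvg_invS_0|exact: continuous_indic_itv].
have : \int[mu]_(x in D) (f x * m x) = 0.
  apply: cvg_unique cv _ => //.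
  rewrite (_ : (fun n => _) = cst 0); first exact: cvg_cst.
  by apply/funext => n; rewrite z.
rewrite intD; last first.
  apply: eq_integrable (L1_mulM (M := 1) measurableT If (L1_measurable Im) _) => //.
    by move=> x _ /=; rewrite mulrC.
  by move=> x _; rewrite /m indicE normr_nat; case: (_ \in _).
by rewrite [\int[mu]_(x in `]c, d]) _]Rintegral_mkcond patch_indic.
Qed.

(** The primitive of [f] is constant by the previous lemma, and its derivative is [f] almost
    everywhere by Lebesgue's differentiation theorem. *)
Lemma heat_conv_eq0 f : mu.-integrable setT (EFin \o f) ->
  (forall n x, heat_conv n.+1%:R^-1 f x = 0) -> {ae mu, forall x, f x = 0}.
Proof.
move=> If f0.
have IS (D : set R) : measurable D -> mu.-integrable D (EFin \o f).
  by move=> mD; apply: integrableS If.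
pose F x := \int[mu]_(t in [set` `]-oo, x]]) f t.
have F0 : F = cst (F 0).
  have le_eq c d : c <= d -> F c = F d.
    move=> cd; apply/eqP; rewrite eq_sym -subr_eq0; apply/eqP.
    rewrite /F Rintegral_itvB//; [exact: Rintegral_itv_eq0|exact: IS].
  by apply/funext => x /=; have [/le_eq|/ltW/le_eq] := leP x 0.
have := @FTC1Ny R f (fun y => IS _ (measurable_itv _)) _.
have loc : locally_integrable [set: R] f by exact: open_integrable_locally openT If.
move=> /(_ loc); apply: filterS; first exact: (ae_filter_ringOfSetsType mu).
move=> x [_ <-]; by rewrite -/F F0 derive1_cst.
Qed.

(** The regularised inversion [hartley_gauss] recovers every heat flow of [f] from its Hartley
    transform. *)
Lemma hartley_eq0 f : mu.-integrable setT (EFin \o f) -> (forall x, hartley f x = 0) ->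
  {ae mu, forall x, f x = 0}.
Proof.
move=> If f0; apply: heat_conv_eq0 => // n x.
have e0 : 0 < n.+1%:R^-1 :> R by rewrite invr_gt0.
have p0 : 2 * pi != 0 :> R by rewrite gt_eqF// mulr_gt0// pi_gt0.
apply: (mulfI p0); rewrite mulr0 -(hartley_gauss e0 If).2 {1}/hartley.
under eq_Rintegral do rewrite f0 mul0r mulr0.
by rewrite Rintegral_cst// mul0r.
Qed.

(* Completing the square: multiplying an $L^2$ function by a Gaussian puts it in
   $L^1$ and only changes the parameters of its averages. *)
Lemma gauss_heat_kernel e b x : 0 < e ->
  gauss 1 x * heat_kernel e (x - b) =
  ((2 * pi * e) `^ (- 2^-1) / (2 * pi * (e / (1 + e))) `^ (- 2^-1) * gauss (1 + e)^-1 b) *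
  heat_kernel (e / (1 + e)) (x - b / (1 + e)).
Proof.
move=> e0; have e1 : 0 < 1 + e by rewrite addr_gt0.
rewrite !heat_kernelE.
have : (2 * pi * (e / (1 + e))) `^ (- 2^-1) != 0.
  by rewrite gt_eqF// powR_gt0// !mulr_gt0 ?pi_gt0// invr_gt0.
have : gauss 1 x * gauss e^-1 (x - b) = gauss (1 + e)^-1 b * gauss (e / (1 + e))^-1 (x - b / (1 + e)).
  rewrite /gauss -!expRD; congr expR; field.
  by rewrite !gt_eqF.
move: (_ `^ _) (_ `^ _) (gauss _ _) (gauss _ _) (gauss _ _) (gauss _ _) => P1 P2 g1 g2 g3 g4 h h2.
have -> : P1 / P2 * g2 * (P2 * g1) = P1 * (g2 * g1) by field.
by rewrite -h; ring.
Qed.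

End Determination.

(** * Pairing L^2 Fourier transforms with test functions *)

Section Pairing.
Context {R : realType}.
Notation mu := (@lebesgue_measure R).
Implicit Types (m f phi : R -> R) (b c d e x xi t p q : R).

Lemma L2_mulM f phi : measurable_fun setT f -> measurable_fun setT phi ->
  mu.-integrable setT (EFin \o (fun x : R => f x ^+ 2)) ->
  mu.-integrable setT (EFin \o (fun x : R => phi x ^+ 2)) ->
  mu.-integrable setT (EFin \o (fun x : R => f x * phi x)).
Proof.
move=> mf mp If Ip.
have mfp : measurable_fun setT (fun x : R => f x * phi x) by exact: measurable_funM.
apply: L1_le (L1_D measurableT If Ip) => //.
by move=> x _; exact: normrM_le_sqr.
Qed.

Lemma young_sqr t p q : 0 < t -> 2 * `|p * q| <= t * p ^+ 2 + t^-1 * q ^+ 2.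
Proof.
move=> t0; have : 0 <= t^-1 * (t * `|p| - `|q|) ^+ 2.
  by rewrite mulr_ge0 ?sqr_ge0// invr_ge0 ltW.
rewrite -[p ^+ 2]real_normK ?num_real// -[q ^+ 2]real_normK ?num_real// normrM.
have -> : t^-1 * (t * `|p| - `|q|) ^+ 2 = t * `|p| ^+ 2 + t^-1 * `|q| ^+ 2 - 2 * (`|p| * `|q|).
  by field; rewrite gt_eqF.
by rewrite subr_ge0.
Qed.

(** The weighted Young inequality plays the part of the Cauchy-Schwarz inequality and needs no
    square roots of integrals. *)
Lemma cvg_L2_pairing (f_ : nat -> R -> R) f phi :
  (forall n, measurable_fun setT (f_ n)) -> measurable_fun setT f ->
  measurable_fun setT phi ->
  mu.-integrable setT (EFin \o (fun x : R => phi x ^+ 2)) ->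
  mu.-integrable setT (EFin \o (fun x : R => f x * phi x)) ->
  (forall n, mu.-integrable setT (EFin \o (fun x : R => f_ n x * phi x))) ->
  (\int[mu]_x ((f_ n x - f x) ^+ 2)%:E)%E @[n --> \oo] --> 0%E ->
  \int[mu]_x (f_ n x * phi x) @[n --> \oo] --> \int[mu]_x (f x * phi x).
Proof.
move=> mf_ mf mp Ip2 If If_ cv; apply/cvgrPdist_le => q q0.
set K := \int[mu]_x (phi x ^+ 2).
have K0 : 0 <= K by apply: Rintegral_ge0 => x _; exact: sqr_ge0.
(* With this weight K/t <= q, and the other term is at most q once the squared distance is below
   q/t. The summand 1 keeps t positive when K = 0. *)
pose t := (K + 1) / q; have t0 : 0 < t by rewrite divr_gt0// ltr_wpDl.
have qt : 0 < q / t by rewrite divr_gt0.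
have : \forall n \near \oo, (\int[mu]_x ((f_ n x - f x) ^+ 2)%:E < (q / t)%:E)%E.
  have /fine_cvgP[fn /cvgrPdist_lt/(_ _ qt)] := cv; apply: filterS2 fn => n fn.
  by rewrite sub0r normrN => /(le_lt_trans (ler_norm _)); rewrite -lte_fin /= fineK.
apply: filterS => n cn.
have mD : measurable_fun setT (fun x : R => (f_ n x - f x) ^+ 2).
  by apply: measurable_funX; exact: measurable_funB.
have ID : mu.-integrable setT (EFin \o (fun x : R => (f_ n x - f x) ^+ 2)).
  apply/integrableP; split; first exact/measurable_EFinP.
  under eq_integral do rewrite /= ger0_norm ?sqr_ge0//.
  by apply: lt_trans cn _; exact: ltry.
have {}cn : \int[mu]_x ((f_ n x - f x) ^+ 2) <= q / t.
  rewrite -lee_fin /Rintegral fineK; first exact: ltW.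
  exact: (integrable_fin_num _ ID).
rewrite -(RintegralB measurableT If (If_ n)).
have IB := L1_B measurableT If (If_ n).
apply: (le_trans (le_normr_Rintegral measurableT IB)).
have J1 := L1_Zl t measurableT ID; have J2 := L1_Zl t^-1 measurableT Ip2.
rewrite -(ler_pM2l (ltr0Sn R 1)).
have bnd (x : R) : 2 * `|f x * phi x - f_ n x * phi x| <= t * (f_ n x - f x) ^+ 2 + t^-1 * phi x ^+ 2.
  by rewrite -mulrBl normrM distrC -normrM; exact: young_sqr.
have IN : mu.-integrable setT (EFin \o (fun x : R => `|f x * phi x - f_ n x * phi x|)).
  exact: integrable_norm IB.
rewrite -(RintegralZl 2 measurableT IN).
apply: (@le_trans _ _ (\int[mu]_x (t * (f_ n x - f x) ^+ 2 + t^-1 * phi x ^+ 2))).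
  by apply: le_Rintegral => //; [exact: (L1_Zl 2 measurableT IN)|exact: L1_D].
rewrite (RintegralD measurableT J1 J2) (RintegralZl t measurableT ID).
rewrite (RintegralZl t^-1 measurableT Ip2) -/K [leRHS]mulr_natl mulr2n lerD//.
  by rewrite -ler_pdivlMl// mulrC.
by rewrite mulrC /t invf_div mulrA ler_pdivrMr ?ltr_wpDl// mulrC ler_pM2l// lerDl.
Qed.

Lemma sqmodB (z w : R[i]) : sqmod (z - w) =
  (complex.Re z - complex.Re w) ^+ 2 + (complex.Im z - complex.Im w) ^+ 2.
Proof. by case: z w => [? ?] [? ?]. Qed.

Lemma inL2_sqr (h : R -> R[i]) : inL2 h ->
  mu.-integrable setT (EFin \o (fun x : R => complex.Re (h x) ^+ 2)) /\
  mu.-integrable setT (EFin \o (fun x : R => complex.Im (h x) ^+ 2)).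
Proof.
move=> [[mr mi] fin].
have ms : measurable_fun setT (fun x : R => complex.Re (h x) ^+ 2 + complex.Im (h x) ^+ 2).
  by apply: measurable_funD; exact: measurable_funX.
have I : mu.-integrable setT (EFin \o (fun x : R => complex.Re (h x) ^+ 2 + complex.Im (h x) ^+ 2)).
  apply/integrableP; split; first exact/measurable_EFinP.
  apply: le_lt_trans fin; rewrite le_eqVlt; apply/orP; left; apply/eqP.
  by apply: eq_integral => x _; rewrite sqmodB /= !subr0 ger0_norm// addr_ge0 ?sqr_ge0.
have mr2 : measurable_fun setT (fun x : R => complex.Re (h x) ^+ 2) by exact: measurable_funX.
have mi2 : measurable_fun setT (fun x : R => complex.Im (h x) ^+ 2) by exact: measurable_funX.
split; apply: L1_le I => //= x _.
  by rewrite ger0_norm ?sqr_ge0// lerDl sqr_ge0.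
by rewrite ger0_norm ?sqr_ge0// lerDr sqr_ge0.
Qed.

Lemma cvg_sqdist_ReIm (u : nat -> R -> R[i]) h : (forall n, cmeasurable (u n)) -> cmeasurable h ->
  sqdist (u n) h @[n --> \oo] --> 0%E ->
  (\int[mu]_x ((complex.Re (u n x) - complex.Re (h x)) ^+ 2)%:E)%E @[n --> \oo] --> 0%E /\
  (\int[mu]_x ((complex.Im (u n x) - complex.Im (h x)) ^+ 2)%:E)%E @[n --> \oo] --> 0%E.
Proof.
move=> mu_ [mhr mhi] c.
have mR n : measurable_fun setT (fun x : R => ((complex.Re (u n x) - complex.Re (h x)) ^+ 2)%:E).
  apply/measurable_EFinP; apply: measurable_funX.
  by apply: measurable_funB => //; case: (mu_ n).
have mI n : measurable_fun setT (fun x : R => ((complex.Im (u n x) - complex.Im (h x)) ^+ 2)%:E).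
  apply/measurable_EFinP; apply: measurable_funX.
  by apply: measurable_funB => //; case: (mu_ n).
have E n : sqdist (u n) h = (\int[mu]_x (((complex.Re (u n x) - complex.Re (h x)) ^+ 2)%:E +
    ((complex.Im (u n x) - complex.Im (h x)) ^+ 2)%:E))%E.
  by apply: eq_integral => x _; rewrite sqmodB EFinD.
have ge0R n (x : R) : setT x -> (0 <= ((complex.Re (u n x) - complex.Re (h x)) ^+ 2)%:E)%E.
  by move=> _; rewrite lee_fin sqr_ge0.
have ge0I n (x : R) : setT x -> (0 <= ((complex.Im (u n x) - complex.Im (h x)) ^+ 2)%:E)%E.
  by move=> _; rewrite lee_fin sqr_ge0.
split.
  apply: (@squeeze_cvge _ _ _ _ (cst 0%E) _ (fun n => sqdist (u n) h)) => //.
    apply: nearW => n; apply/andP; split; first by apply: integral_ge0 => x _; exact: ge0R.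
    by rewrite E (ge0_integralD mu measurableT (ge0R n) (mR n) (ge0I n) (mI n)) leeDl//; apply: integral_ge0 => x _; exact: ge0I.
  exact: cvg_cst.
apply: (@squeeze_cvge _ _ _ _ (cst 0%E) _ (fun n => sqdist (u n) h)) => //.
  apply: nearW => n; apply/andP; split; first by apply: integral_ge0 => x _; exact: ge0I.
  by rewrite E (ge0_integralD mu measurableT (ge0R n) (mR n) (ge0I n) (mI n)) leeDr//; apply: integral_ge0 => x _; exact: ge0R.
exact: cvg_cst.
Qed.

Definition cos_transform := trig_transform (@cos R).
Definition sin_transform := trig_transform (@sin R).

Lemma norm_cos_le2 t : `|cos t| <= 2.
Proof. by rewrite ler_norml; apply/andP; split; [have := cos_geN1 t|have := cos_le1 t]; lra. Qed.

Lemma norm_sin_le2 t : `|sin t| <= 2.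
Proof. by rewrite ler_norml; apply/andP; split; [have := sin_geN1 t|have := sin_le1 t]; lra. Qed.

Lemma fourier_integralE (u : R -> R[i]) xi : inL1 u ->
  fourier_integral u xi =
  (cos_transform (fun x => complex.Re (u x)) xi + sin_transform (fun x => complex.Im (u x)) xi) +i*
  (cos_transform (fun x => complex.Im (u x)) xi - sin_transform (fun x => complex.Re (u x)) xi).
Proof.
move=> [Ir Ii].
have I1 := trig_integrand_L1 xi (@measurable_cos R) norm_cos_le2 Ir.
have I2 := trig_integrand_L1 xi (@measurable_sin R) norm_sin_le2 Ii.
have I3 := trig_integrand_L1 xi (@measurable_cos R) norm_cos_le2 Ii.
have I4 := trig_integrand_L1 xi (@measurable_sin R) norm_sin_le2 Ir.
rewrite /fourier_integral /cintegral /cos_transform /sin_transform /trig_transform.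
rewrite -(RintegralD measurableT I1 I2) -(RintegralB measurableT I3 I4).
congr (_ +i* _); apply: eq_Rintegral => x _ /=; case: (u x) => ? ? /=;
  by rewrite cosN sinN [x * xi]mulrC; ring.
Qed.

Lemma measurable_cos_transform f : mu.-integrable setT (EFin \o f) ->
  measurable_fun setT (cos_transform f).
Proof. exact: measurable_trig_transform (@measurable_cos R) norm_cos_le2. Qed.

Lemma measurable_sin_transform f : mu.-integrable setT (EFin \o f) ->
  measurable_fun setT (sin_transform f).
Proof. exact: measurable_trig_transform (@measurable_sin R) norm_sin_le2. Qed.

Lemma cmeasurable_fourier_integral (u : R -> R[i]) : inL1 u -> cmeasurable (fourier_integral u).
Proof.
move=> Lu; have [I1 I2] := Lu.
rewrite (_ : fourier_integral u = fun xi =>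
  (cos_transform (fun x => complex.Re (u x)) xi + sin_transform (fun x => complex.Im (u x)) xi) +i*
  (cos_transform (fun x => complex.Im (u x)) xi - sin_transform (fun x => complex.Re (u x)) xi)); last first.
  by apply/funext => xi; exact: fourier_integralE.
by split; [apply: measurable_funD|apply: measurable_funB];
  [exact: measurable_cos_transform|exact: measurable_sin_transform|
   exact: measurable_cos_transform|exact: measurable_sin_transform].
Qed.

(** Square integrability of the two transforms is required outright; for the Gaussian tests it is
    read off explicit formulas. *)
Definition nice_test phi := [/\ mu.-integrable setT (EFin \o phi),
  mu.-integrable setT (EFin \o (fun x : R => phi x ^+ 2)),
  mu.-integrable setT (EFin \o (fun x : R => cos_transform phi x ^+ 2)) &
  mu.-integrable setT (EFin \o (fun x : R => sin_transform phi x ^+ 2))].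

(** The transform can be moved onto the test function. For the approximants this is Fubini's
    theorem, and each pairing passes to the L^2 limit; real and imaginary parts are kept apart. *)
Lemma is_fourier_pairing (h g : R -> R[i]) phi : is_fourier h g -> nice_test phi ->
  \int[mu]_x (complex.Re (g x) * phi x) =
   \int[mu]_x (complex.Re (h x) * cos_transform phi x) +
   \int[mu]_x (complex.Im (h x) * sin_transform phi x) /\
  \int[mu]_x (complex.Im (g x) * phi x) =
   \int[mu]_x (complex.Im (h x) * cos_transform phi x) -
   \int[mu]_x (complex.Re (h x) * sin_transform phi x).
Proof.
move=> [Lh Lg [u [Lu ch cg]]] [Ip Ip2 Ic2 Is2].
have mp := L1_measurable Ip.
have mcp := measurable_cos_transform Ip; have msp := measurable_sin_transform Ip.
have [[mhr mhi] _] := Lh; have [[mgr mgi] _] := Lg.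
have [Ihr Ihi] := inL2_sqr Lh; have [Igr Igi] := inL2_sqr Lg.
pose u1 n x := complex.Re (u n x); pose u2 n x := complex.Im (u n x).
have Iu1 n : mu.-integrable setT (EFin \o u1 n) by have [[]] := Lu n.
have Iu2 n : mu.-integrable setT (EFin \o u2 n) by have [[]] := Lu n.
have mu1 n := L1_measurable (Iu1 n); have mu2 n := L1_measurable (Iu2 n).
have [c1 c2] := cvg_sqdist_ReIm (fun n => (Lu n).2.1) Lh.1 ch.
have mF n := cmeasurable_fourier_integral (Lu n).1.
have [c3 c4] := cvg_sqdist_ReIm mF Lg.1 cg.
have symc f : mu.-integrable setT (EFin \o f) ->
    mu.-integrable setT (EFin \o (fun x : R => cos_transform f x * phi x)) /\
    \int[mu]_x (cos_transform f x * phi x) = \int[mu]_x (f x * cos_transform phi x).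
  move=> If; have [I E] := trig_transform_sym (@measurable_cos R) norm_cos_le2 Ip If.
  split; first by apply: eq_integrable I => // x _ /=; rewrite mulrC.
  by rewrite -E; apply: eq_Rintegral => x _; rewrite mulrC.
have syms f : mu.-integrable setT (EFin \o f) ->
    mu.-integrable setT (EFin \o (fun x : R => sin_transform f x * phi x)) /\
    \int[mu]_x (sin_transform f x * phi x) = \int[mu]_x (f x * sin_transform phi x).
  move=> If; have [I E] := trig_transform_sym (@measurable_sin R) norm_sin_le2 Ip If.
  split; first by apply: eq_integrable I => // x _ /=; rewrite mulrC.
  by rewrite -E; apply: eq_Rintegral => x _; rewrite mulrC.
have Iu1p n := inL2_sqr (Lu n).2.
have uc1 : \int[mu]_x (u1 n x * cos_transform phi x) @[n --> \oo] -->
    \int[mu]_x (complex.Re (h x) * cos_transform phi x).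
  exact: (cvg_L2_pairing mu1 mhr mcp Ic2 (L2_mulM mhr mcp Ihr Ic2)
    (fun n => L2_mulM (mu1 n) mcp (Iu1p n).1 Ic2) c1).
have us1 : \int[mu]_x (u1 n x * sin_transform phi x) @[n --> \oo] -->
    \int[mu]_x (complex.Re (h x) * sin_transform phi x).
  exact: (cvg_L2_pairing mu1 mhr msp Is2 (L2_mulM mhr msp Ihr Is2)
    (fun n => L2_mulM (mu1 n) msp (Iu1p n).1 Is2) c1).
have uc2 : \int[mu]_x (u2 n x * cos_transform phi x) @[n --> \oo] -->
    \int[mu]_x (complex.Im (h x) * cos_transform phi x).
  exact: (cvg_L2_pairing mu2 mhi mcp Ic2 (L2_mulM mhi mcp Ihi Ic2)
    (fun n => L2_mulM (mu2 n) mcp (Iu1p n).2 Ic2) c2).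
have us2 : \int[mu]_x (u2 n x * sin_transform phi x) @[n --> \oo] -->
    \int[mu]_x (complex.Im (h x) * sin_transform phi x).
  exact: (cvg_L2_pairing mu2 mhi msp Is2 (L2_mulM mhi msp Ihi Is2)
    (fun n => L2_mulM (mu2 n) msp (Iu1p n).2 Is2) c2).
have FR n : (fun x => complex.Re (fourier_integral (u n) x) * phi x) =
    (fun x => cos_transform (u1 n) x * phi x + sin_transform (u2 n) x * phi x).
  by apply/funext => x; rewrite fourier_integralE ?mulrDl//; case: (Lu n).
have FI n : (fun x => complex.Im (fourier_integral (u n) x) * phi x) =
    (fun x => cos_transform (u2 n) x * phi x - sin_transform (u1 n) x * phi x).
  by apply/funext => x; rewrite fourier_integralE ?mulrBl//; case: (Lu n).
have gR : \int[mu]_x (complex.Re (fourier_integral (u n) x) * phi x) @[n --> \oo] -->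
    \int[mu]_x (complex.Re (g x) * phi x).
  apply: cvg_L2_pairing => // [n||n]; first by case: (mF n).
    exact: L2_mulM.
  by rewrite FR; apply: L1_D => //; [exact: (symc _ (Iu1 n)).1|exact: (syms _ (Iu2 n)).1].
have gI : \int[mu]_x (complex.Im (fourier_integral (u n) x) * phi x) @[n --> \oo] -->
    \int[mu]_x (complex.Im (g x) * phi x).
  apply: cvg_L2_pairing => // [n||n]; first by case: (mF n).
    exact: L2_mulM.
  by rewrite FI; apply: L1_B => //; [exact: (symc _ (Iu2 n)).1|exact: (syms _ (Iu1 n)).1].
have ER : (fun n => \int[mu]_x (complex.Re (fourier_integral (u n) x) * phi x)) =
    (fun n => \int[mu]_x (u1 n x * cos_transform phi x) +
      \int[mu]_x (u2 n x * sin_transform phi x)).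
  apply/funext => n; rewrite FR -(symc _ (Iu1 n)).2 -(syms _ (Iu2 n)).2.
  by rewrite (RintegralD measurableT (symc _ (Iu1 n)).1 (syms _ (Iu2 n)).1).
have EI : (fun n => \int[mu]_x (complex.Im (fourier_integral (u n) x) * phi x)) =
    (fun n => \int[mu]_x (u2 n x * cos_transform phi x) -
      \int[mu]_x (u1 n x * sin_transform phi x)).
  apply/funext => n; rewrite FI -(symc _ (Iu2 n)).2 -(syms _ (Iu1 n)).2.
  by rewrite (RintegralB measurableT (symc _ (Iu2 n)).1 (syms _ (Iu1 n)).1).
rewrite ER in gR; rewrite EI in gI.
by split; [exact: (cvg_unique (@Rhausdorff R) gR (cvgD uc1 us2))
          |exact: (cvg_unique (@Rhausdorff R) gI (cvgB uc2 us1))].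
Qed.

End Pairing.

(** * Gaussian test functions and the two uniqueness statements *)

Section Uniqueness.
Context {R : realType}.
Notation mu := (@lebesgue_measure R).
Implicit Types (f p q phi : R -> R) (b e x xi t : R) (h g : R -> R[i]).

Definition gauss_cosine e b t := gauss e t * cos (b * t).
Definition gauss_sine e b t := gauss e t * sin (b * t).

Lemma cos_transform_gauss_cosine e b x : 0 < e ->
  cos_transform (gauss_cosine e b) x = pi * (heat_kernel e (x - b) + heat_kernel e (x - - b)).
Proof.
move=> e0; have [I1 E1] := @gauss_cos R e (x - b) e0; have [I2 E2] := @gauss_cos R e (x - - b) e0.
transitivity (\int[mu]_t (2^-1 * (gauss e t * cos ((x - b) * t) + gauss e t * cos ((x - - b) * t)))).
  apply: eq_Rintegral => t _; rewrite /gauss_cosine opprK mulrBl mulrDl cosB cosD.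
  by field.
rewrite (RintegralZl _ measurableT (L1_D measurableT I1 I2)) (RintegralD measurableT I1 I2) E1 E2.
by move: pi => w; field.
Qed.

Lemma sin_transform_gauss_cosine e b x : 0 < e -> sin_transform (gauss_cosine e b) x = 0.
Proof.
move=> e0; have [I1 E1] := @gauss_sin R e (x - b) e0; have [I2 E2] := @gauss_sin R e (x + b) e0.
transitivity (\int[mu]_t (2^-1 * (gauss e t * sin ((x - b) * t) + gauss e t * sin ((x + b) * t)))).
  apply: eq_Rintegral => t _; rewrite /gauss_cosine mulrBl mulrDl sinB sinD.
  by field.
rewrite (RintegralZl _ measurableT (L1_D measurableT I1 I2)) (RintegralD measurableT I1 I2) E1 E2.
by rewrite addr0 mulr0.
Qed.

Lemma cos_transform_gauss_sine e b x : 0 < e -> cos_transform (gauss_sine e b) x = 0.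
Proof.
move=> e0; have [I1 E1] := @gauss_sin R e (b - x) e0; have [I2 E2] := @gauss_sin R e (b + x) e0.
transitivity (\int[mu]_t (2^-1 * (gauss e t * sin ((b - x) * t) + gauss e t * sin ((b + x) * t)))).
  apply: eq_Rintegral => t _; rewrite /gauss_sine mulrBl mulrDl sinB sinD.
  by field.
rewrite (RintegralZl _ measurableT (L1_D measurableT I1 I2)) (RintegralD measurableT I1 I2) E1 E2.
by rewrite addr0 mulr0.
Qed.

Lemma sin_transform_gauss_sine e b x : 0 < e ->
  sin_transform (gauss_sine e b) x = pi * (heat_kernel e (x - b) - heat_kernel e (x - - b)).
Proof.
move=> e0; have [I1 E1] := @gauss_cos R e (x - b) e0; have [I2 E2] := @gauss_cos R e (x - - b) e0.
transitivity (\int[mu]_t (2^-1 * (gauss e t * cos ((x - b) * t) - gauss e t * cos ((x - - b) * t)))).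
  apply: eq_Rintegral => t _; rewrite /gauss_sine opprK mulrBl mulrDl cosB cosD.
  by field.
rewrite (RintegralZl _ measurableT (L1_B measurableT I1 I2)) (RintegralB measurableT I1 I2) E1 E2.
by move: pi => w; field.
Qed.

Lemma L1_sqr f (M : R) : mu.-integrable setT (EFin \o f) -> (forall x, `|f x| <= M) ->
  mu.-integrable setT (EFin \o (fun x : R => f x ^+ 2)).
Proof.
by move=> If fM; apply: eq_integrable (L1_mulM (M := M) measurableT If (L1_measurable If) _) => //.
Qed.

Lemma norm_gauss_le1 e t : 0 < e -> `|gauss e t| <= 1.
Proof. by move=> e0; rewrite ger0_norm ?gauss_ge0 ?gauss_le1. Qed.

Lemma heat_kernel_L2 e b : 0 < e ->
  mu.-integrable setT (EFin \o (fun x : R => heat_kernel e (x - b) ^+ 2)).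
Proof.
move=> e0; apply: (@L1_sqr _ ((2 * pi * e) `^ (- 2^-1)) (heat_kernel_L1 b e0).1) => x.
by rewrite ger0_norm ?heat_kernel_ge0 ?heat_kernel_le.
Qed.

Lemma heat_kernels_L2 e b (k : R) : 0 < e -> `|k| <= 1 ->
  mu.-integrable setT (EFin \o (fun x : R => (pi * (heat_kernel e (x - b) + k * heat_kernel e (x - - b))) ^+ 2)).
Proof.
move=> e0 k1; have [I1 _] := heat_kernel_L1 b e0; have [I2 _] := heat_kernel_L1 (- b) e0.
have I := L1_Zl pi measurableT (L1_D measurableT I1 (L1_Zl k measurableT I2)).
apply: (@L1_sqr _ (pi * (2 * (2 * pi * e) `^ (- 2^-1))) I) => x.
rewrite normrM ger0_norm ?pi_ge0// ler_wpM2l ?pi_ge0// mulr_natl mulr2n.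
rewrite (le_trans (ler_normD _ _))// lerD//.
  by rewrite ger0_norm ?heat_kernel_ge0 ?heat_kernel_le.
rewrite normrM [`|heat_kernel _ _|]ger0_norm ?heat_kernel_ge0//.
by rewrite (le_trans (ler_piMl (heat_kernel_ge0 _ _) k1))// heat_kernel_le.
Qed.

Lemma nice_gauss_cosine e b : 0 < e -> nice_test (gauss_cosine e b).
Proof.
move=> e0; have [I _] := @gauss_cos R e b e0; split => //.
- apply: (@L1_sqr _ 1 I) => x; rewrite normrM mulr_ile1//; first exact: norm_gauss_le1.
  by rewrite ler_norml cos_geN1 cos_le1.
- apply: eq_integrable (@heat_kernels_L2 e b 1 e0 _) => //; last by rewrite normr1.
  by move=> x _ /=; rewrite cos_transform_gauss_cosine// mul1r.
- apply: eq_integrable (integrable0 _ _) => // x _ /=.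
  by rewrite sin_transform_gauss_cosine// expr0n.
Qed.

Lemma nice_gauss_sine e b : 0 < e -> nice_test (gauss_sine e b).
Proof.
move=> e0; have [I _] := @gauss_sin R e b e0; split => //.
- apply: (@L1_sqr _ 1 I) => x; rewrite normrM mulr_ile1//; first exact: norm_gauss_le1.
  by rewrite ler_norml sin_geN1 sin_le1.
- apply: eq_integrable (integrable0 _ _) => // x _ /=.
  by rewrite cos_transform_gauss_sine// expr0n.
- apply: eq_integrable (@heat_kernels_L2 e b (-1) e0 _) => //; last by rewrite normrN1.
  by move=> x _ /=; rewrite sin_transform_gauss_sine// mulN1r.
Qed.

(** Up to the symmetry of the kernel this is [heat_conv]; the separate name serves functions known
    to be in L^2 only. *)
Definition heat_average e f b := \int[mu]_x (f x * heat_kernel e (x - b)).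

Lemma heat_average_pm e f b : 0 < e -> measurable_fun setT f ->
  mu.-integrable setT (EFin \o (fun x : R => f x ^+ 2)) ->
  \int[mu]_x (f x * (pi * (heat_kernel e (x - b) + heat_kernel e (x - - b)))) =
    pi * (heat_average e f b + heat_average e f (- b)) /\
  \int[mu]_x (f x * (pi * (heat_kernel e (x - b) - heat_kernel e (x - - b)))) =
    pi * (heat_average e f b - heat_average e f (- b)).
Proof.
move=> e0 mf If.
have I c : mu.-integrable setT (EFin \o (fun x : R => f x * heat_kernel e (x - c))).
  apply: L2_mulM => //; last exact: heat_kernel_L2.
  exact: L1_measurable (heat_kernel_L1 c e0).1.
have IA := L1_D measurableT (I b) (I (- b)); have IB := L1_B measurableT (I b) (I (- b)).
rewrite /heat_average -(RintegralD measurableT (I b) (I (- b))) -(RintegralB measurableT (I b) (I (- b))).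
rewrite -(RintegralZl pi measurableT IA) -(RintegralZl pi measurableT IB).
by split; apply: eq_Rintegral => x _; move: pi => w; ring.
Qed.

Lemma is_fourier_gauss_tests h g e b : 0 < e -> is_fourier h g ->
  [/\ \int[mu]_x (complex.Re (g x) * gauss_cosine e b x) =
        pi * (heat_average e (fun x => complex.Re (h x)) b + heat_average e (fun x => complex.Re (h x)) (- b)),
      \int[mu]_x (complex.Re (g x) * gauss_sine e b x) =
        pi * (heat_average e (fun x => complex.Im (h x)) b - heat_average e (fun x => complex.Im (h x)) (- b)),
      \int[mu]_x (complex.Im (g x) * gauss_cosine e b x) =
        pi * (heat_average e (fun x => complex.Im (h x)) b + heat_average e (fun x => complex.Im (h x)) (- b)) &
      \int[mu]_x (complex.Im (g x) * gauss_sine e b x) =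
        - (pi * (heat_average e (fun x => complex.Re (h x)) b - heat_average e (fun x => complex.Re (h x)) (- b)))].
Proof.
move=> e0 hg; have [[[mr mi] _] _ _] := hg; have [Lh _ _] := hg; have [Ir Ii] := inL2_sqr Lh.
have [Er1 Er2] := heat_average_pm b e0 mr Ir; have [Ei1 Ei2] := heat_average_pm b e0 mi Ii.
have zero f phi : (forall x, phi x = 0) -> \int[mu]_x (f x * phi x) = 0.
  move=> p0; under eq_Rintegral do rewrite p0 mulr0.
  by rewrite Rintegral_cst// mul0r.
have [c1 c2] := is_fourier_pairing hg (nice_gauss_cosine b e0).
have [s1 s2] := is_fourier_pairing hg (nice_gauss_sine b e0).
have Ecc : cos_transform (gauss_cosine e b) = (fun x => pi * (heat_kernel e (x - b) + heat_kernel e (x - - b))).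
  by apply/funext => x; exact: cos_transform_gauss_cosine.
have Ess : sin_transform (gauss_sine e b) = (fun x => pi * (heat_kernel e (x - b) - heat_kernel e (x - - b))).
  by apply/funext => x; exact: sin_transform_gauss_sine.
have zc f : \int[mu]_x (f x * sin_transform (gauss_cosine e b) x) = 0.
  by apply: zero => x; exact: sin_transform_gauss_cosine.
have zs f : \int[mu]_x (f x * cos_transform (gauss_sine e b) x) = 0.
  by apply: zero => x; exact: cos_transform_gauss_sine.
split.
- by rewrite c1 zc addr0 Ecc Er1.
- by rewrite s1 zs add0r Ess Ei2.
- by rewrite c2 zc subr0 Ecc Ei1.
- by rewrite s2 zs sub0r Ess Er2.
Qed.

Lemma L2_mul_gauss_L1 f : measurable_fun setT f ->
  mu.-integrable setT (EFin \o (fun x : R => f x ^+ 2)) ->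
  mu.-integrable setT (EFin \o (fun x : R => f x * gauss 1 x)).
Proof.
move=> mf If; apply: L2_mulM => //; first exact: measurable_gauss.
by apply: (@L1_sqr _ 1 (gauss_L1 ltr01)) => x; exact: norm_gauss_le1.
Qed.

Lemma mul_gauss_eq0 f : {ae mu, forall x, f x * gauss 1 x = 0} -> {ae mu, forall x, f x = 0}.
Proof.
apply: filterS; first exact: (ae_filter_ringOfSetsType mu).
by move=> x /eqP; rewrite mulf_eq0 (gt_eqF (gauss_gt0 _ _)) orbF => /eqP.
Qed.

Lemma sub_ae_eq0 p q : {ae mu, forall x, p x - q x = 0} -> {ae mu, forall x, p x = q x}.
Proof.
apply: filterS; first exact: (ae_filter_ringOfSetsType mu).
by move=> x /eqP; rewrite subr_eq0 => /eqP.
Qed.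

(** The difference times a Gaussian is in L^1, and by [gauss_heat_kernel] its heat flow at time e
    and point b is a multiple of the difference of averages at time e/(1+e) and point b/(1+e). Hence
    averages at all times are compared. *)
Lemma eq_heat_average p q : measurable_fun setT p -> measurable_fun setT q ->
  mu.-integrable setT (EFin \o (fun x : R => p x ^+ 2)) ->
  mu.-integrable setT (EFin \o (fun x : R => q x ^+ 2)) ->
  (forall e b, 0 < e -> heat_average e p b = heat_average e q b) ->
  {ae mu, forall x, p x = q x}.
Proof.
move=> mp mq Ip Iq pq; apply: sub_ae_eq0; apply: mul_gauss_eq0.
have mpq : measurable_fun setT (fun x : R => p x - q x) by exact: measurable_funB.
apply: heat_conv_eq0 => [|n b]; first by apply: L2_mul_gauss_L1 => //; exact: sqrB_L1.
have e0 : 0 < n.+1%:R^-1 :> R by rewrite invr_gt0.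
move: (n.+1%:R^-1) e0 => e e0.
have e1 : 0 < e / (1 + e) by rewrite divr_gt0// addr_gt0.
set k := (2 * pi * e) `^ (- 2^-1) / (2 * pi * (e / (1 + e))) `^ (- 2^-1) * gauss (1 + e)^-1 b.
have I f : measurable_fun setT f -> mu.-integrable setT (EFin \o (fun x : R => f x ^+ 2)) ->
    mu.-integrable setT (EFin \o (fun x : R => f x * heat_kernel (e / (1 + e)) (x - b / (1 + e)))).
  move=> mf If; apply: L2_mulM => //; last exact: heat_kernel_L2.
  exact: L1_measurable (heat_kernel_L1 _ e1).1.
have IB := L1_B measurableT (I _ mp Ip) (I _ mq Iq).
have key (t : R) : heat_kernel e (b - t) * ((p t - q t) * gauss 1 t) =
    k * (p t * heat_kernel (e / (1 + e)) (t - b / (1 + e)) -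
      q t * heat_kernel (e / (1 + e)) (t - b / (1 + e))).
  have := gauss_heat_kernel b t e0; rewrite -/k -(heat_kernelN e (t - b)) opprB.
  move: (heat_kernel e (b - t)) (heat_kernel (e / _) _) => H1 H2 h.
  rewrite (_ : H1 * _ = (p t - q t) * (gauss 1 t * H1)); last by ring.
  by rewrite h; ring.
transitivity (\int[mu]_t (k * (p t * heat_kernel (e / (1 + e)) (t - b / (1 + e)) -
   q t * heat_kernel (e / (1 + e)) (t - b / (1 + e))))).
  by apply: eq_Rintegral => t _; exact: key.
rewrite (RintegralZl k measurableT IB) (RintegralB measurableT (I _ mp Ip) (I _ mq Iq)).
by have := pq _ (b / (1 + e)) e1; rewrite /heat_average => ->; rewrite subrr mulr0.
Qed.

(** Cosine plus sine test at frequency b is the Hartley transform at b of the difference times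
    [gauss 1], an integrable function; one width of Gaussian is therefore enough. *)
Lemma eq_gauss_tests p q : measurable_fun setT p -> measurable_fun setT q ->
  mu.-integrable setT (EFin \o (fun x : R => p x ^+ 2)) ->
  mu.-integrable setT (EFin \o (fun x : R => q x ^+ 2)) ->
  (forall b, \int[mu]_x (p x * gauss_cosine 1 b x) = \int[mu]_x (q x * gauss_cosine 1 b x)) ->
  (forall b, \int[mu]_x (p x * gauss_sine 1 b x) = \int[mu]_x (q x * gauss_sine 1 b x)) ->
  {ae mu, forall x, p x = q x}.
Proof.
move=> mp mq Ip Iq pqc pqs; apply: sub_ae_eq0; apply: mul_gauss_eq0.
have mpq : measurable_fun setT (fun x : R => p x - q x) by exact: measurable_funB.
apply: hartley_eq0 => [|b]; first by apply: L2_mul_gauss_L1 => //; exact: sqrB_L1.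
have I f phi : measurable_fun setT f -> mu.-integrable setT (EFin \o (fun x : R => f x ^+ 2)) ->
    nice_test phi -> mu.-integrable setT (EFin \o (fun x : R => f x * phi x)).
  by move=> mf If [Ip1 Ip2 _ _]; apply: L2_mulM => //; exact: L1_measurable Ip1.
have nc := nice_gauss_cosine b ltr01; have ns := nice_gauss_sine b ltr01.
have IC := L1_B measurableT (I _ _ mp Ip nc) (I _ _ mq Iq nc).
have IS := L1_B measurableT (I _ _ mp Ip ns) (I _ _ mq Iq ns).
transitivity (\int[mu]_t ((p t * gauss_cosine 1 b t - q t * gauss_cosine 1 b t) +
  (p t * gauss_sine 1 b t - q t * gauss_sine 1 b t))).
  by apply: eq_Rintegral => t _; rewrite /gauss_cosine /gauss_sine /cas; ring.
rewrite (RintegralD measurableT IC IS).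
rewrite (RintegralB measurableT (I _ _ mp Ip nc) (I _ _ mq Iq nc)).
rewrite (RintegralB measurableT (I _ _ mp Ip ns) (I _ _ mq Iq ns)).
by rewrite pqc pqs !subrr addr0.
Qed.

Lemma aeq_ReIm h g :
  {ae mu, forall x, complex.Re (h x) = complex.Re (g x)} ->
  {ae mu, forall x, complex.Im (h x) = complex.Im (g x)} -> aeq h g.
Proof.
apply: filterS2; first exact: (ae_filter_ringOfSetsType mu).
by move=> x; case: (h x) (g x) => [? ?] [? ?] /= -> ->.
Qed.

(** All Gaussian tests of the transform are expressed through averages of [h] alone. *)
Lemma is_fourier_unique h g g' : is_fourier h g -> is_fourier h g' -> aeq g g'.
Proof.
move=> hg hg'; have [_ Lg _] := hg; have [_ Lg' _] := hg'.
have [[mr mi] _] := Lg; have [[mr' mi'] _] := Lg'.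
have [Ir Ii] := inL2_sqr Lg; have [Ir' Ii'] := inL2_sqr Lg'.
apply: aeq_ReIm; apply: eq_gauss_tests => // b;
  have [E1 E2 E3 E4] := is_fourier_gauss_tests b ltr01 hg;
  have [F1 F2 F3 F4] := is_fourier_gauss_tests b ltr01 hg'.
- by rewrite E1 F1.
- by rewrite E2 F2.
- by rewrite E3 F3.
- by rewrite E4 F4.
Qed.

(** The tests of [g] give the sum and the difference of the averages of [h] at b and -b; together
    they isolate the average at b. *)
Lemma is_fourier_inj h h' g : is_fourier h g -> is_fourier h' g -> aeq h h'.
Proof.
move=> hg hg'; have [Lh _ _] := hg; have [Lh' _ _] := hg'.
have [[mr mi] _] := Lh; have [[mr' mi'] _] := Lh'.
have [Ir Ii] := inL2_sqr Lh; have [Ir' Ii'] := inL2_sqr Lh'.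
have p0 : pi != 0 :> R by rewrite gt_eqF// pi_gt0.
have cancel (u v u' v' : R) : pi * (u + v) = pi * (u' + v') -> pi * (u - v) = pi * (u' - v') -> u = u'.
  by move=> /(mulfI p0) h1 /(mulfI p0) h2; lra.
apply: aeq_ReIm; apply: eq_heat_average => // e b e0;
  have [E1 E2 E3 E4] := is_fourier_gauss_tests b e0 hg;
  have [F1 F2 F3 F4] := is_fourier_gauss_tests b e0 hg'.
- by apply: (cancel _ _ _ _ (etrans (esym E1) F1)); apply: oppr_inj; rewrite -E4 -F4.
- exact: (cancel _ _ _ _ (etrans (esym E3) F3) (etrans (esym E2) F2)).
Qed.

End Uniqueness.

(** * The Rodrigues operator *)

Section AlmostEverywhere.
Context {R : realType}.
Notation mu := (@lebesgue_measure R).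
Implicit Types (f g h u : R -> R[i]).

Lemma ae_impl (P Q : R -> Prop) : {ae mu, forall x, P x} -> (forall x, P x -> Q x) ->
  {ae mu, forall x, Q x}.
Proof. by move=> aeP PQ; apply: filterS aeP => //; exact: (ae_filter_ringOfSetsType mu). Qed.

Lemma ae_impl2 (P Q S : R -> Prop) : {ae mu, forall x, P x} -> {ae mu, forall x, Q x} ->
  (forall x, P x -> Q x -> S x) -> {ae mu, forall x, S x}.
Proof.
by move=> aeP aeQ PQS; apply: filterS2 aeP aeQ => //; exact: (ae_filter_ringOfSetsType mu).
Qed.

Lemma aeq_refl f : aeq f f. Proof. exact: aeW. Qed.

Lemma aeq_sym f g : aeq f g -> aeq g f.
Proof. by move=> fg; apply: (ae_impl fg) => x ->. Qed.

Lemma aeq_trans f g h : aeq f g -> aeq g h -> aeq f h.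
Proof. by move=> fg gh; apply: (ae_impl2 fg gh) => x -> ->. Qed.

Lemma ae_neq0 : {ae mu, forall x : R, x != 0}.
Proof.
exists [set (0 : R)]; split => //; first exact: lebesgue_measure_set1.
by move=> x /= /negP; rewrite negbK => /eqP.
Qed.

Lemma measurable_sqmodB u h : cmeasurable u -> cmeasurable h ->
  measurable_fun setT (fun x => (sqmod (u x - h x))%:E).
Proof.
move=> [ur ui] [hr hi]; apply/measurable_EFinP.
rewrite (_ : (fun x => _) = (fun x => (complex.Re (u x) - complex.Re (h x)) ^+ 2 +
  (complex.Im (u x) - complex.Im (h x)) ^+ 2)); last by apply/funext => x; exact: sqmodB.
by apply: measurable_funD; apply: measurable_funX; exact: measurable_funB.
Qed.

Lemma sqmod_ge0 (z : R[i]) : 0 <= sqmod z.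
Proof. by rewrite addr_ge0 ?sqr_ge0. Qed.

Lemma sqdist_aeq u h u' h' : cmeasurable u -> cmeasurable h -> cmeasurable u' -> cmeasurable h' ->
  aeq u u' -> aeq h h' -> sqdist u h = sqdist u' h'.
Proof.
move=> mu_ mh mu' mh' uu hh; apply: ge0_ae_eq_integral => //.
- exact: measurable_sqmodB.
- exact: measurable_sqmodB.
- by move=> x _; rewrite lee_fin sqmod_ge0.
- by move=> x _; rewrite lee_fin sqmod_ge0.
- by apply: (ae_impl2 uu hh) => x ux hx _; rewrite ux hx.
Qed.

Lemma cmeasurable0 : cmeasurable (fun=> 0 : R[i]).
Proof. by split => /=; exact: measurable_cst. Qed.

Lemma inL2_aeq h h' : cmeasurable h' -> aeq h h' -> inL2 h -> inL2 h'.
Proof.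
move=> mh' hh [mh fin]; split => //.
by rewrite -(sqdist_aeq mh cmeasurable0 mh' cmeasurable0 hh (aeq_refl _)).
Qed.

Lemma is_fourier_aeq h g h' g' : is_fourier h g -> aeq h h' -> aeq g g' ->
  cmeasurable h' -> cmeasurable g' -> is_fourier h' g'.
Proof.
move=> [Lh Lg [u [Lu ch cg]]] hh gg mh' mg'; split; [exact: inL2_aeq Lh|exact: inL2_aeq Lg|].
exists u; split => //.
- rewrite (_ : (fun n => _) = (fun n => sqdist (u n) h))//.
  apply/funext => n; have mun := (Lu n).2.1.
  by apply: sqdist_aeq => //; [exact: Lh.1|exact: aeq_refl|exact: aeq_sym].
- rewrite (_ : (fun n => _) = (fun n => sqdist (fourier_integral (u n)) g))//.
  apply/funext => n; have mF := cmeasurable_fourier_integral (Lu n).1.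
  by apply: sqdist_aeq => //; [exact: Lg.1|exact: aeq_refl|exact: aeq_sym].
Qed.

Lemma cmeasurableM f g : cmeasurable f -> cmeasurable g -> cmeasurable (fun x => f x * g x).
Proof.
move=> [fr fi] [gr gi]; split.
  rewrite (_ : (fun x => _) = (fun x => complex.Re (f x) * complex.Re (g x) - complex.Im (f x) * complex.Im (g x))).
    by apply: measurable_funB; exact: measurable_funM.
  by apply/funext => x; case: (f x) (g x) => [? ?] [? ?].
rewrite (_ : (fun x => _) = (fun x => complex.Re (f x) * complex.Im (g x) + complex.Im (f x) * complex.Re (g x))).
  by apply: measurable_funD; exact: measurable_funM.
by apply/funext => x; case: (f x) (g x) => [? ?] [? ?].
Qed.

Lemma is_fourier_fourier h g : is_fourier h g -> is_fourier h (fourier h).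
Proof. by move=> hg; apply: (@xgetPex _ (fun=> 0) [set g | is_fourier h g]); exists g. Qed.

Lemma is_fourier_inv_fourier h g : is_fourier h g -> is_fourier (inv_fourier g) g.
Proof. by move=> hg; apply: (@xgetPex _ (fun=> 0) [set h | is_fourier h g]); exists h. Qed.

End AlmostEverywhere.

(** * The multiplier (- i xi)^s and its action on the family h_a *)

Section Symbol.
Context {R : realType}.
Notation mu := (@lebesgue_measure R).
Implicit Types (a s y c x xi : R).

Local Opaque gamma rgamma.

Lemma cmeasurable_symbol s : cmeasurable (symbol s).
Proof.
have mp : measurable_fun setT (fun xi : R => `|xi| `^ s).
  exact: (measurableT_comp (@measurable_powR R s) (@normr_measurable R setT)).
have mt : measurable_fun setT (fun xi : R => - (pi * s * Num.sg xi / 2)).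
  apply: measurable_funN; apply: measurable_funM => //.
  by apply: measurable_funM => //; exact: measurable_sgr.
split; rewrite /symbol /expi.
  rewrite (_ : (fun x => _) = (fun x => `|x| `^ s * cos (- (pi * s * Num.sg x / 2)))).
    by apply: measurable_funM => //; apply: measurableT_comp => //; exact: measurable_cos.
  by apply/funext => x /=; rewrite mul0r subr0.
rewrite (_ : (fun x => _) = (fun x => `|x| `^ s * sin (- (pi * s * Num.sg x / 2)))).
  by apply: measurable_funM => //; apply: measurableT_comp => //; exact: measurable_sin.
by apply/funext => x /=; rewrite mul0r addr0.
Qed.

(** At xi = 0 the rule can fail, for instance when a = - s is nonzero: 0^0 is 1 whereas 0 to a
    nonzero power is 0. *)
Lemma symbolM s a xi : xi != 0 -> symbol s xi * symbol a xi = symbol (a + s) xi.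
Proof.
move=> xi0; have n0 : `|xi| != 0 by rewrite normr_eq0.
rewrite /symbol /expi [a + s]addrC powRD; last by rewrite (negPf n0) implybT.
have -> : - (pi * (s + a) * Num.sg xi / 2) = - (pi * s * Num.sg xi / 2) + - (pi * a * Num.sg xi / 2).
  by ring.
rewrite cosD sinD; apply/eqP; rewrite eq_complex /=; apply/andP; split; apply/eqP; by ring.
Qed.

(** The scalar [c] is left free because [fracD s] multiplies it by y^(-s). *)
Definition weber_function a y c x : R[i] := (c * (heat_kernel y x * pcH a x y))%:C.

Definition weber_transform a y c xi : R[i] := (c * y `^ a)%:C * (symbol a xi * (gauss y xi)%:C).

Lemma is_fourier_weber a y c : - 2^-1 < a -> 0 < y ->
  is_fourier (weber_function a y c) (weber_transform a y c).
Proof.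
move=> a2 y0; have a1 : -1 < a by lra.
set k := c * y `^ a; pose m xi := k * weber a y xi.
have Im : mu.-integrable setT (EFin \o m) by exact: L1_Zl k measurableT (weber_L1 a1 y0).
have Im2 : mu.-integrable setT (EFin \o (fun x : R => m x ^+ 2)).
  have e : (fun x : R => m x ^+ 2) = (fun x => k ^+ 2 * weber a y x ^+ 2).
    by apply/funext => x; rewrite /m exprMn.
  by rewrite e; exact: L1_Zl (k ^+ 2) measurableT (weber_L2 a2 y0).
have cm x : x != 0 -> {for x, continuous m}.
  by move=> x0; apply: continuousM; [exact: cst_continuous|exact: continuous_weber].
have := is_fourier_hartley Im Im2 cm.
rewrite (_ : (fun x => _) = weber_function a y c); last first.
  apply/funext => x; rewrite /weber_function; congr (_%:C).
  rewrite (_ : hartley m x = k * hartley (weber a y) x).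
    rewrite mulrCA hartley_weber// /k -mulrA; congr (_ * _).
    by rewrite (mulrA (y `^ a)) -powRD ?subrr ?powRr0 ?mul1r// (gt_eqF y0) implybT.
  rewrite /hartley -RintegralZl//; last exact: L1_cas (weber_L1 a1 y0).
  by apply: eq_Rintegral => t _; rewrite mulrCA.
rewrite (_ : even_odd m = weber_transform a y c)//.
apply/funext => xi; rewrite /weber_transform -even_odd_weber /even_odd /m -/k.
move: (weber a y xi) (weber a y (- xi)) => p q.
by apply/eqP; rewrite eq_complex /=; apply/andP; split; apply/eqP; field.
Qed.

(** This amounts to H_0 = 1, the starting point of the Rodrigues formula; it is read off the Hartley
    transform of a Gaussian instead of the series of D_0. *)
Lemma weber_function0 y x : 0 < y -> weber_function 0 y 1 x = (heat_kernel y x)%:C.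
Proof.
move=> y0; rewrite /weber_function mul1r; congr (_%:C).
have [Ic Ec] := @gauss_cos R y x y0; have [Is Es] := @gauss_sin R y x y0.
have := @hartley_weber R 0 y x (ltrN10 _) y0; rewrite oppr0 powRr0 mul1r => <-.
have -> : hartley (weber 0 y) x = 2 * pi * heat_kernel y x.
  transitivity (\int[mu]_t (gauss y t * cos (x * t) + gauss y t * sin (x * t))).
    by apply: eq_Rintegral => t _; rewrite /weber powRr0 mulr0 !mul0r cas0 /cas; ring.
  by rewrite (RintegralD measurableT Ic Is) Ec Es addr0.
by rewrite mulrA mulVf ?mul1r// gt_eqF// mulr_gt0// pi_gt0.
Qed.

(** The argument is only assumed measurable and almost everywhere equal to a member of the family,
    and the conclusion returns the same two facts, so the lemma can be iterated. Multiplying the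
    transform by the symbol keeps its scalar, as c y^(-s) y^(a+s) = c y^a. *)
Lemma fracD_weber a s y c (h : R -> R[i]) : 0 < y -> - 2^-1 < a -> - 2^-1 < a + s ->
  cmeasurable h -> aeq h (weber_function a y c) ->
  [/\ fracD_dom s h, cmeasurable (fracD s h) &
      aeq (fracD s h) (weber_function (a + s) y (c * y `^ (- s)))].
Proof.
move=> y0 a2 as2 mh hW.
have pair := is_fourier_weber c a2 y0; have pairs := is_fourier_weber (c * y `^ (- s)) as2 y0.
have [_ LG _] := pair; have [LW _ _] := pairs.
have hG : is_fourier h (weber_transform a y c).
  by apply: is_fourier_aeq pair (aeq_sym hW) (aeq_refl _) mh LG.1.
have hF := is_fourier_fourier hG; have [Lh LF _] := hF.
have FG := is_fourier_unique hF hG.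
have mS : cmeasurable (symbol_fourier s h) by exact: cmeasurableM (cmeasurable_symbol s) LF.1.
have SG : aeq (weber_transform (a + s) y (c * y `^ (- s))) (symbol_fourier s h).
  apply: (ae_impl2 FG ae_neq0) => xi Fxi xi0; rewrite /symbol_fourier Fxi /weber_transform.
  rewrite -(symbolM s a xi0) [RHS]mulrCA -!mulrA; congr (_%:C * _).
  rewrite -powRD; last by rewrite (gt_eqF y0) implybT.
  by rewrite addrCA addNr addr0.
have hS := is_fourier_aeq pairs (aeq_refl _) SG LW.1 mS.
have inv := is_fourier_inv_fourier hS; have [Li LS _] := inv.
split; [by split|exact: Li.1|exact: is_fourier_inj inv hS].
Qed.

End Symbol.

Theorem proposition4p1 (R : realType) (y : R) (hy : 0 < y) :
  [/\ forall a : R, - 2^-1 < a ->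
        fracD_dom a (fun x => (heat_kernel y x)%:C) /\
        aeq (fun x => (heat_kernel y x)%:C * cpcH a y x)
            (fun x => (y `^ a)%:C * fracD a (fun x' => (heat_kernel y x')%:C) x),
      forall a : R, - 2^-1 < a ->
        rodrigues_dom y a (fun=> 1) /\
        aeq (rodrigues y a (fun=> 1)) (cpcH a y),
      forall a s : R, - 2^-1 < a -> - 2^-1 < a + s ->
        rodrigues_dom y s (cpcH a y) /\
        aeq (rodrigues y s (cpcH a y)) (cpcH (a + s) y) &
      forall a s t : R, - 2^-1 < a -> - 2^-1 < a + s -> - 2^-1 < a + s + t ->
        [/\ rodrigues_dom y s (cpcH a y),
            rodrigues_dom y t (rodrigues y s (cpcH a y)),
            rodrigues_dom y (s + t) (cpcH a y),
            aeq (rodrigues y t (rodrigues y s (cpcH a y)))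
                (rodrigues y (s + t) (cpcH a y)) &
            aeq (rodrigues y (s + t) (cpcH a y)) (cpcH (a + s + t) y)]].
Proof.
have yK s : y `^ s * y `^ (- s) = 1.
  by rewrite -powRD ?subrr ?powRr0// (gt_eqF hy) implybT.
have w0 x : heat_kernel y x != 0 by rewrite gt_eqF// heat_kernel_gt0.
have mW a c : - 2^-1 < a -> cmeasurable (weber_function a y c).
  by move=> a2; have [[]] := is_fourier_weber c a2 hy.
have wW a : weighted y (cpcH a y) = weber_function a y 1.
  apply/funext => x; rewrite /weighted /cpcH /weber_function mul1r.
  by apply/eqP; rewrite eq_complex /= !mul0r !mulr0 subr0 addr0 !eqxx.
have hW : (fun x => (heat_kernel y x)%:C) = weber_function 0 y 1.
  by apply/funext => x; rewrite weber_function0.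
have h0 : - 2^-1 < 0 :> R by rewrite oppr_lt0 invr_gt0.
(* [f] is only known up to a null set, so that the lemma applies to iterates *)
have rod a s f : - 2^-1 < a -> - 2^-1 < a + s -> cmeasurable (weighted y f) ->
    aeq (weighted y f) (weber_function a y 1) ->
    [/\ rodrigues_dom y s f, cmeasurable (weighted y (rodrigues y s f)),
        aeq (weighted y (rodrigues y s f)) (weber_function (a + s) y 1) &
        aeq (rodrigues y s f) (cpcH (a + s) y)].
  move=> a2 as2 mf fW; have [dom mD DW] := fracD_weber hy a2 as2 mf fW.
  have E : weighted y (rodrigues y s f) = (fun x => (y `^ s)%:C * fracD s (weighted y f) x).
    apply/funext => x; rewrite /weighted /rodrigues.
    by rewrite [(y `^ s)%:C * _]mulrC !mulrA -rmorphM mulfV// rmorph1 mul1r.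
  split => //.
  - by rewrite E; apply: (@cmeasurableM _ (fun=> (y `^ s)%:C) (fracD s (weighted y f))) => //.
  - rewrite E; apply: (ae_impl DW) => x ->; rewrite /weber_function.
    by rewrite -rmorphM !mul1r [y `^ s * _]mulrA yK mul1r.
  - apply: (ae_impl DW) => x Dx; rewrite /rodrigues Dx /weber_function /cpcH.
    rewrite -!rmorphM mul1r; congr (_%:C).
    by rewrite mulrACA yK mul1r mulKf.
have rodH a s : - 2^-1 < a -> - 2^-1 < a + s ->
    [/\ rodrigues_dom y s (cpcH a y), cmeasurable (weighted y (rodrigues y s (cpcH a y))),
        aeq (weighted y (rodrigues y s (cpcH a y))) (weber_function (a + s) y 1) &
        aeq (rodrigues y s (cpcH a y)) (cpcH (a + s) y)].
  by move=> a2 as2; apply: rod => //; rewrite wW; [exact: mW|exact: aeq_refl].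
split.
(* The first two claims start from the exponent 0: w_y itself is the member a = 0 of the family. *)
- move=> a a2; rewrite hW.
  have a2' : - 2^-1 < 0 + a by rewrite add0r.
  have [dom _ DW] := @fracD_weber R 0 a y 1 _ hy h0 a2' (mW _ _ h0) (aeq_refl _).
  split => //; apply: aeq_sym; apply: (ae_impl DW) => x ->.
  by rewrite /weber_function add0r -!rmorphM mul1r [y `^ a * _]mulrA yK mul1r.
- move=> a a2; have w1 : weighted y (fun=> 1) = weber_function 0 y 1.
    by rewrite -hW; apply/funext => x; rewrite /weighted mulr1.
  have [|||] := @rod 0 a (fun=> 1) h0; rewrite ?w1 ?add0r//.
  + exact: mW.
  + exact: aeq_refl.
- by move=> a s a2 as2; have [] := rodH a s a2 as2.
- move=> a s t a2 as2 ast2; have [d1 m1 W1 H1] := rodH a s a2 as2.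
  have [d2 _ _ H2] := rod (a + s) t _ as2 ast2 m1 W1.
  have ast2' : - 2^-1 < a + (s + t) by rewrite addrA.
  have [d3 _ _ H3] := rodH a (s + t) a2 ast2'.
  rewrite -addrA in H2 *.
  by split; [exact: d1|exact: d2|exact: d3|exact: (aeq_trans H2 (aeq_sym H3))|exact: H3].
Qed.
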